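(* Let $0<\beta<1$, $0<\alpha<\alpha+\beta<n$, and let $b$ be a locally integrable function on $\mathbb{Q}_p^n$. Then the following assertions are equivalent: (A.1) $b\in\Lambda_\beta(\mathbb{Q}_p^n)$ and $b\ge 0$. (A.2) The commutator $[b,\mathcal{M}_\alpha^p]$ is bounded from $L^{r(\cdot)}(\mathbb{Q}_p^n)$ to $L^{q(\cdot)}(\mathbb{Q}_p^n)$ for all $r(\cdot),q(\cdot)\in\mathscr{C}^{\log}(\mathbb{Q}_p^n)$ with $r(\cdot)\in\mathscr{P}(\mathbb{Q}_p^n)$, $r_+<\frac{n}{\alpha+\beta}$ and $1/q(\cdot)=1/r(\cdot)-(\alpha+\beta)/n$. (A.3) The commutator $[b,\mathcal{M}_\alpha^p]$ is bounded from $L^{r(\cdot)}(\mathbb{Q}_p^n)$ to $L^{q(\cdot)}(\mathbb{Q}_p^n)$ for some $r(\cdot),q(\cdot)\in\mathscr{C}^{\log}(\mathbb{Q}_p^n)$ with $r(\cdot)\in\mathscr{P}(\mathbb{Q}_p^n)$, $r_+<\frac{n}{\alpha+\beta}$ and $1/q(\cdot)=1/r(\cdot)-(\alpha+\beta)/n$. (A.4) There exist some $r(\cdot),q(\cdot)\in\mathscr{C}^{\log}(\mathbb{Q}_p^n)$ with $r(\cdot)\in\mathscr{P}(\mathbb{Q}_p^n)$, $r_+<\frac{n}{\alpha+\beta}$ and $1/q(\cdot)=1/r(\cdot)-(\alpha+\beta)/n$ such that $$\sup_{\gamma\in\mathbb{Z},\,x\in\mathbb{Q}_p^n}\frac{1}{|B_\gamma(x)|_h^{\beta/n}}\,\frac{\big\|\big(b-|B_\gamma(x)|_h^{-\alpha/n}\mathcal{M}_{\alpha,B_\gamma(x)}^p(b)\big)\chi_{B_\gamma(x)}\big\|_{L^{q(\cdot)}(\mathbb{Q}_p^n)}}{\|\chi_{B_\gamma(x)}\|_{L^{q(\cdot)}(\mathbb{Q}_p^n)}}<\infty.$$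 (A.5) For all $r(\cdot),q(\cdot)\in\mathscr{C}^{\log}(\mathbb{Q}_p^n)$ with $r(\cdot)\in\mathscr{P}(\mathbb{Q}_p^n)$, $r_+<\frac{n}{\alpha+\beta}$ and $1/q(\cdot)=1/r(\cdot)-(\alpha+\beta)/n$, the displayed supremum in (A.4) is finite.
   Context: Let $p$ be a prime, $n\ge1$, $\mathbb{Q}_p$ the field of $p$-adic numbers with $p$-adic absolute value $|\cdot|_p$, and $\mathbb{Q}_p^n$ equipped with $|x|_p=\max_{1\le j\le n}|x_j|_p$. For $\gamma\in\mathbb{Z}$ and $a\in\mathbb{Q}_p^n$, $B_\gamma(a)=\{x\in\mathbb{Q}_p^n:|x-a|_p\le p^\gamma\}$. Haar measure on $\mathbb{Q}_p^n$ is normalized by $|B_0(0)|_h=1$, so $|B_\gamma(a)|_h=p^{n\gamma}$; $|E|_h$ is the Haar measure of $E$, $dx$ denotes integration against it, and $\chi_E$ is the characteristic function of $E$. Functions are real-valued, and as usual functions equal almost everywhere are identified in function spaces. Fractional maximal function: for $0\le\alpha<n$ and $f$ measurable, $\mathcal{M}_\alpha^p(f)(x)=\sup_{\gamma\in\mathbb{Z}}|B_\gamma(x)|_h^{-1+\alpha/n}\int_{B_\gamma(x)}|f(y)|\,dy$. For a fixed ball $B_*$, $\mathcal{M}_{\alpha,B_*}^p(f)(x)=\sup_{\gamma\in\mathbb{Z}:\,B_\gamma(x)\subset B_*}|B_\gamma(x)|_h^{-1+\alpha/n}\int_{B_\gamma(x)}|f(y)|\,dy$ for $x\in B_*$. Nonlinear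 commutator: $[b,\mathcal{M}_\alpha^p](f)(x)=b(x)\mathcal{M}_\alpha^p(f)(x)-\mathcal{M}_\alpha^p(bf)(x)$. An operator $T$ is bounded from a normed function space $X$ to $Y$ if there is a constant $C$ with $\|Tf\|_Y\le C\|f\|_X$ for all $f\in X$. Lipschitz space ($0<\beta<1$): $\Lambda_\beta(\mathbb{Q}_p^n)$ is the set of measurable $f$ with $\|f\|_{\Lambda_\beta(\mathbb{Q}_p^n)}=\sup_{x\ne y}\frac{|f(x)-f(y)|}{|x-y|_p^\beta}<\infty$. Variable exponents: for measurable $q(\cdot)$ on $\mathbb{Q}_p^n$ put $q_-=\operatorname{ess\,inf}_{x\in\mathbb{Q}_p^n}q(x)$, $q_+=\operatorname{ess\,sup}_{x\in\mathbb{Q}_p^n}q(x)$, and $q_\pm(B)$ for the corresponding quantities over a ball $B$. $\mathscr{P}(\mathbb{Q}_p^n)$ is the set of measurable $q(\cdot):\mathbb{Q}_p^n\to(1,\infty)$ with $1<q_-\le q(x)\le q_+<\infty$. $L^{q(\cdot)}(\mathbb{Q}_p^n)$ is the space of measurable $f$ with $\int_{\mathbb{Q}_p^n}(|f(x)|/\eta)^{q(x)}dx<\infty$ for some $\eta>0$, with norm $\|f\|_{L^{q(\cdot)}(\mathbb{Q}_p^n)}=\inf\{\eta>0:\int_{\mathbb{Q}_p^n}(|f(x)|/\eta)^{q(x)}dx\le1\}$. $\mathscr{C}^{\log}(\mathbb{Q}_p^n)$ is the set of $q(\cdot)\in\mathscr{P}(\mathbb{Q}_p^n)$ for which there is a constant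 $C>0$ such that (i) $\gamma\,(q_-(B_\gamma(x))-q_+(B_\gamma(x)))\le C$ for all $\gamma\in\mathbb{Z}$, $x\in\mathbb{Q}_p^n$, and (ii) $|q(x)-q(y)|\le\frac{C}{\log_p(p+\min\{|x|_p,|y|_p\})}$ for all $x,y\in\mathbb{Q}_p^n$. *)

(* Defs.v *)
From HB Require Import structures.
From mathcomp Require Import all_boot all_order all_algebra.
From mathcomp Require Import all_classical all_reals all_analysis.
From mathcomp Require Import ess_sup_inf.

Set Implicit Arguments.
Unset Strict Implicit.
Unset Printing Implicit Defensive.

Import Order.TTheory GRing.Theory Num.Theory.
Import numFieldNormedType.Exports.

Local Open Scope classical_set_scope.
Local Open Scope ring_scope.

Definition padic_abs_rat (p : nat) (R : realType) (x : rat) : R :=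
  if x == 0 then 0
  else p%:R ^ ((logn p `|denq x|)%:Z - (logn p `|numq x|)%:Z).

(* The field of p-adic numbers, i.e., the completion of (rat, |.|_p): a
   complete ultrametric valued field in which the rationals, with their p-adic
   absolute value, are dense. For p prime such a field exists and is unique up
   to a unique isometric isomorphism; as for realType, the structure is used
   in place of one particular construction. *)
Record padicField (p : nat) (R : realType) := PadicField {
  padic_sort :> fieldType ;
  padic_abs : padic_sort -> R ;
  padic_abs0_eq0 : forall x, padic_abs x = 0 -> x = 0 ;
  padic_absM : forall x y, padic_abs (x * y) = padic_abs x * padic_abs y ;
  padic_absD_max : forall x y,
    padic_abs (x + y) <= Num.max (padic_abs x) (padic_abs y) ;
  padic_abs_ratr : forall a : rat, padic_abs (ratr a) = padic_abs_rat p R a ;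
  padic_rat_dense : forall x (e : R), 0 < e ->
    exists a : rat, padic_abs (x - ratr a) < e ;
  padic_complete : forall u : nat -> padic_sort,
    (forall e : R, 0 < e -> exists N : nat, forall i j : nat,
       (N <= i)%N -> (N <= j)%N -> padic_abs (u i - u j) < e) ->
    exists l, forall e : R, 0 < e -> exists N : nat, forall i : nat,
       (N <= i)%N -> padic_abs (u i - l) < e }.

Definition padic_space (p : nat) (R : realType) (K : padicField p R) (n : nat)
  : Type := 'rV[K]_n.

HB.instance Definition _ p R (K : padicField p R) n :=
  GRing.Zmodule.on (padic_space K n).
HB.instance Definition _ p R (K : padicField p R) n :=
  isPointed.Build (padic_space K n) 0.

Definition padic_norm (p : nat) (R : realType) (K : padicField p R) (n : nat)
    (x : padic_space K n) : R :=
  \big[Num.max/0]_(j < n) padic_abs (x ord0 j).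

Section padic_metric.
Variables (p : nat) (R : realType) (K : padicField p R).

Lemma padic_abs0 : padic_abs (0 : K) = 0.
Proof.
by rewrite -[0](ratr_nat K 0) padic_abs_ratr /padic_abs_rat eqxx.
Qed.

Lemma padic_absN (x : K) : padic_abs (- x) = padic_abs x.
Proof.
rewrite -mulN1r padic_absM; have -> : (-1 : K) = ratr (-1)%:~R.
  by rewrite ratr_int mulrN1z.
rewrite padic_abs_ratr /padic_abs_rat numq_int denq_int/= logn1 subrr expr0z.
by rewrite mul1r.
Qed.

Lemma padic_abs_ge0 (x : K) : 0 <= padic_abs x.
Proof.
have := padic_absD_max x (- x).
by rewrite subrr padic_abs0 padic_absN maxxx.
Qed.

Variable n : nat.
Implicit Types x y : padic_space K n.

Lemma padic_norm_ge0 x : 0 <= padic_norm x.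
Proof.
rewrite /padic_norm; elim/big_ind : _ => //= [a b a0 b0|i _].
  by rewrite le_max a0.
exact: padic_abs_ge0.
Qed.

Lemma le_padic_norm x (j : 'I_n) : padic_abs (x ord0 j) <= padic_norm x.
Proof. by rewrite /padic_norm (bigD1 j)//= le_max lexx. Qed.

Lemma padic_norm_le x (e : R) : 0 <= e ->
  (forall j : 'I_n, padic_abs (x ord0 j) <= e) -> padic_norm x <= e.
Proof.
move=> e0 xe; rewrite /padic_norm; elim/big_ind : _ => //= a b ae be.
by rewrite ge_max ae.
Qed.

Lemma padic_norm0 : padic_norm (0 : padic_space K n) = 0.
Proof.
apply/eqP; rewrite eq_le padic_norm_ge0 andbT padic_norm_le// => j.
by rewrite mxE padic_abs0.
Qed.

Lemma padic_norm0_eq0 x : padic_norm x = 0 -> x = 0.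
Proof.
move=> x0; apply/rowP => j; rewrite mxE; apply: padic_abs0_eq0.
by apply/eqP; rewrite eq_le padic_abs_ge0 andbT -x0 le_padic_norm.
Qed.

Lemma padic_normN x : padic_norm (- x) = padic_norm x.
Proof. by apply: eq_bigr => j _; rewrite mxE padic_absN. Qed.

Lemma padic_normD_max x y :
  padic_norm (x + y) <= Num.max (padic_norm x) (padic_norm y).
Proof.
apply: padic_norm_le => [|j]; first by rewrite le_max padic_norm_ge0.
rewrite mxE (le_trans (padic_absD_max _ _))// ge_max !le_max.
by rewrite !le_padic_norm orbT.
Qed.

Let dist x y := padic_norm (x - y).

Let distxx x : dist x x = 0.
Proof. by rewrite /dist subrr padic_norm0. Qed.

Let dist_positivity x y : dist x y = 0 -> x = y.
Proof. by move/padic_norm0_eq0/eqP; rewrite subr_eq0 => /eqP. Qed.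

Let dist_sym x y : dist x y = dist y x.
Proof. by rewrite /dist -padic_normN opprB. Qed.

Let dist_triangle y x z : dist x z <= dist x y + dist y z.
Proof.
rewrite /dist; have -> : x - z = (x - y) + (y - z) by rewrite addrA subrK.
rewrite (le_trans (padic_normD_max _ _))// ge_max.
by rewrite lerDl lerDr !padic_norm_ge0.
Qed.

HB.instance Definition _ := @isMetric.Build R (padic_space K n) dist
  distxx dist_positivity dist_sym dist_triangle.

End padic_metric.

HB.instance Definition _ (p : nat) (R : realType) (K : padicField p R)
    (n : nat) :=
  Measurable.copy (padic_space K n)
    (g_sigma_algebraType (@open (padic_space K n))).

Definition padic_ball (p : nat) (R : realType) (K : padicField p R) (n : nat)
    (g : int) (a : padic_space K n) : set (padic_space K n) :=
  [set x | padic_norm (x - a) <= p%:R ^ g].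

Lemma measurable_padic_ball (p : nat) (R : realType) (K : padicField p R)
    (n : nat) (g : int) (a : padic_space K n) : measurable (padic_ball g a).
Proof.
rewrite -[padic_ball g a]setCK; apply: measurableC.
apply: sub_sigma_algebra; rewrite openE => x /= /negP; rewrite -ltNge => xa.
apply/nbhs_ballP; exists (padic_norm (x - a) - p%:R ^ g) => /=.
  by rewrite subr_gt0.
move=> y; rewrite ballEmdist /= /mdist/= => xy; apply/negP; rewrite -ltNge.
move: xy; rewrite ltrBrDr -ltrBrDl => /lt_le_trans; apply.
by rewrite lerBlDl; exact: (metric_triangle x y a).
Qed.

Section haar.
Context (p : nat) (R : realType) (K : padicField p R) (n : nat).
Local Notation X := (padic_space K n).
Implicit Type mu : {measure set X -> \bar R}.

Definition normalized_haar mu :=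
  (forall (a : X) (A : set X), measurable A -> mu [set a + x | x in A] = mu A)
  /\ mu (padic_ball 0 0) = 1%E.

Definition padic_locally_integrable mu (b : X -> R) :=
  measurable_fun [set: X] b /\
  forall D : set X, compact D -> (\int[mu]_(x in D) `|b x|%:E < +oo)%E.

End haar.

Section operators.
Context (p : nat) (R : realType) (K : padicField p R) (n : nat).
Local Notation X := (padic_space K n).
Variable mu : {measure set X -> \bar R}.
Local Open Scope ereal_scope.

Definition frac_maximal (alpha : R) (f : X -> R) (x : X) : \bar R :=
  ereal_sup [set mu (padic_ball g x) `^ (- 1 + alpha / n%:R)%R
                 * \int[mu]_(y in padic_ball g x) `|f y|%:E | g in [set: int]].

Definition frac_maximal_in (B : set X) (alpha : R) (f : X -> R) (x : X)
    : \bar R :=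
  ereal_sup [set mu (padic_ball g x) `^ (- 1 + alpha / n%:R)%R
                 * \int[mu]_(y in padic_ball g x) `|f y|%:E
            | g in [set g : int | padic_ball g x `<=` B]].

(* An undefined difference +oo - +oo evaluates to -oo, hence counts as infinite
   in the norm below. *)
Definition commutator (b : X -> R) (alpha : R) (f : X -> R) (x : X) : \bar R :=
  (b x)%:E * frac_maximal alpha f x - frac_maximal alpha (b \* f)%R x.

Definition var_modular (q : X -> R) (f : X -> \bar R) (eta : R) : \bar R :=
  \int[mu]_x (`|f x| / eta%:E) `^ (q x).

Definition var_Lspace (q : X -> R) (f : X -> R) :=
  measurable_fun [set: X] f /\
  exists2 eta : R, (0 < eta)%R & var_modular q (EFin \o f) eta < +oo.

Definition var_Lnorm (q : X -> R) (f : X -> \bar R) : \bar R :=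
  ereal_inf [set eta%:E | eta in
    [set eta : R | (0 < eta)%R /\ var_modular q f eta <= 1]].

Definition var_bounded (r q : X -> R) (T : (X -> R) -> X -> \bar R) :=
  exists C : R, forall f, var_Lspace r f ->
    var_Lnorm q (T f) <= C%:E * var_Lnorm r (EFin \o f).

Definition var_exponent (q : X -> R) :=
  [/\ measurable_fun [set: X] q,
      1 < ess_inf mu (EFin \o q),
      ess_sup mu (EFin \o q) < +oo &
      forall x, ess_inf mu (EFin \o q) <= (q x)%:E <= ess_sup mu (EFin \o q)].

Definition ball_ess_inf (q : X -> R) (g : int) (x : X) : \bar R :=
  ess_inf (mrestr mu (measurable_padic_ball g x)) (EFin \o q).

Definition ball_ess_sup (q : X -> R) (g : int) (x : X) : \bar R :=
  ess_sup (mrestr mu (measurable_padic_ball g x)) (EFin \o q).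

Definition log_holder_exponent (q : X -> R) :=
  var_exponent q /\
  exists2 C : R, (0 < C)%R &
    (forall (g : int) (x : X),
       (g%:~R)%:E * (ball_ess_inf q g x - ball_ess_sup q g x) <= C%:E) /\
    (forall x y : X, (`|q x - q y| <= C /
       (ln (p%:R + Num.min (padic_norm x) (padic_norm y)) / ln p%:R))%R).

Definition exponent_pair (alpha beta : R) (r q : X -> R) :=
  [/\ log_holder_exponent r, log_holder_exponent q, var_exponent r,
      ess_sup mu (EFin \o r) < (n%:R / (alpha + beta))%:E &
      forall x, ((q x)^-1 = (r x)^-1 - (alpha + beta) / n%:R)%R].

Definition lipschitz_seminorm (beta : R) (f : X -> R) : \bar R :=
  ereal_sup [set (`|f w.1 - f w.2| / padic_norm (w.1 - w.2) `^ beta)%:E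
            | w in [set w : X * X | w.1 <> w.2]].

(* Functions equal almost everywhere are identified, so b belongs to the space
   when some representative of its class has finite seminorm. *)
Definition lipschitz_space (beta : R) (b : X -> R) :=
  exists f : X -> R, [/\ {ae mu, forall x, b x = f x},
    measurable_fun [set: X] f & lipschitz_seminorm beta f < +oo].

(* For y outside B the supremum in frac_maximal_in is over the empty set, i.e.,
   -oo; the indicator turns the integrand into 0 there, as 0 * +oo = 0. *)
Definition maximal_oscillation (alpha beta : R) (q b : X -> R) : \bar R :=
  ereal_sup (range (fun w : int * X => let B := padic_ball w.1 w.2 in
    1 / mu B `^ (beta / n%:R)%R
    * (var_Lnorm q (fun y =>
         ((b y)%:E - mu B `^ (- (alpha / n%:R))%R * frac_maximal_in B alpha b y)
         * (\1_B y)%:E)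
       / var_Lnorm q (fun y => (\1_B y)%:E)))).

End operators.

(* Main.v *)
Require Import Defs.
From HB Require Import structures.
From mathcomp Require Import all_boot all_order all_algebra.
From mathcomp Require Import all_classical all_reals all_analysis.
From mathcomp Require Import measurable_realfun ess_sup_inf.
From mathcomp Require Import zify ring lra.

Set Implicit Arguments.
Unset Strict Implicit.
Unset Printing Implicit Defensive.

Import Order.TTheory GRing.Theory Num.Theory.
Import numFieldNormedType.Exports.

Local Open Scope classical_set_scope.
Local Open Scope ring_scope.

(** The five assertions form a loop: a nonnegative Lipschitz function has a bounded
    commutator, a bounded commutator tested on the characteristic functions of balls
    bounds the oscillation in the fourth and fifth assertions, and a bounded
    oscillation for a single pair of exponents makes b a nonnegative Lipschitz
    function. Constant exponents provide at least one pair
    ([exists_exponent_pair]), so each universal assertion implies its existential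
    counterpart.

    Boundedness ([commutator_bounded]). Replacing b(y) by b(x) in a mean of b f over
    a ball of radius p^g around x costs L p^(g beta) times the mean of |f|, and
    p^(g beta) is the power beta / n of the volume of the ball. Since b is
    nonnegative, b(x) M_alpha f(x) is the supremum of the means of b(x) f, so that
    the commutator at x is at most L M_(alpha + beta) f(x), as soon as M_alpha f(x)
    is finite ([commutator_le]). What remains is that M_s maps L^r(.) to L^q(.)
    when 1/q = 1/r - s/n ([frac_maximal_modular]). In constant exponent and for
    s = 0 this is interpolation ([maximal_strong_type]) of the weak type
    inequality ([maximal_weak_type]), whose covering argument is immediate as two
    balls are nested or disjoint. In variable exponent f is split at height 1. Above 1,
    on each ball the exponent is frozen at its essential infimum; the local
    log-Hoelder condition says that the correction factor V^(r_- - r(x)) is bounded.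
    Below 1, the exponent is compared with its limit at infinity; the condition at
    infinity bounds the error by an integrable function ([powR_decay],
    [decay_integrable]). In both cases the passage from s = 0 to s > 0 is Hedberg's
    pointwise inequality ([powR_hedberg]): if A^r <= C / V then
    (V^(s/n) A)^q <= C' A^r.

    Testing ([maximal_oscillation_lty]). On a ball B one has M_alpha 1_B = |B|^(alpha/n)
    and M_alpha (b 1_B) = M_(alpha,B) b, because balls larger than B have a smaller
    normalizing factor and see no more mass. Hence b - |B|^(-alpha/n) M_(alpha,B) b is
    |B|^(-alpha/n) [b, M_alpha] 1_B on B, and it remains to compare the norms of 1_B
    in L^r(.) and L^q(.), which differ by a factor 2 |B|^((alpha+beta)/n) at most
    ([var_Lnorm_indic_le]).

    Regularity ([lipschitz_of_oscillation]). Taking the ball B itself in the supremum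
    gives |B|^(-alpha/n) M_(alpha,B) b >= m_B, where m_B is the mean of |b| over B; so
    the positive part of m_B - b is dominated by the oscillation. Its mean over B is
    bounded by its L^q(.) norm relative to the one of 1_B, because the mean over B is
    below the maximal function everywhere on B ([ball_mean_var_Lnorm]). As m_B is
    the mean of |b| >= b, this one-sided bound controls the mean of |b - m_B| by
    C |B|^(beta/n), which is Campanato's condition. The Lipschitz
    representative of b is the limit of m_B as B shrinks to a point
    ([campanato_lipschitz]); since every m_B is nonnegative, so is the limit. *)

(** * The residue field and the powers of p *)

Section padic_field_theory.
Context (p : nat) (R : realType) (K : padicField p R).
Hypothesis pp : prime p.

Let p0 : (0 < p%:R :> R). Proof. by rewrite ltr0n prime_gt0. Qed.

Lemma padic_abs_int (z : int) :
  padic_abs (z%:~R : K) = if z == 0 then 0 else p%:R ^ (- (logn p `|z|)%:Z).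
Proof.
rewrite -(ratr_int K z) padic_abs_ratr /padic_abs_rat intr_eq0.
by case: eqP => // _; rewrite denq_int numq_int logn1 sub0r.
Qed.

Lemma padic_abs_int_le1 (z : int) : padic_abs (z%:~R : K) <= 1.
Proof.
rewrite padic_abs_int; case: eqP => // _.
rewrite -exprnN invf_le1 ?exprn_gt0//.
by rewrite exprn_ege1// ler1n prime_gt0.
Qed.

Lemma padic_abs_int_dvd (z : int) :
  (padic_abs (z%:~R : K) <= p%:R^-1) = (p%:Z %| z)%Z.
Proof.
rewrite padic_abs_int; case: eqP => [->|/eqP z0].
  by rewrite dvdz0 invr_ge0 ltW.
rewrite -exprnN lef_pV2 ?posrE ?exprn_gt0//.
rewrite -[leLHS]expr1 ler_eXn2l ?ltr1n ?prime_gt1//.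
by rewrite dvdzE/= -{2}(expn1 p) pfactor_dvdn// absz_gt0.
Qed.

Lemma padic_abs_p : padic_abs (p%:R : K) = p%:R^-1.
Proof.
have -> : (p%:R : K) = p%:Z%:~R by [].
rewrite padic_abs_int ifF; last first.
  by apply/negbTE; rewrite eqz_nat -lt0n prime_gt0.
by rewrite /= logn_prime// eqxx exprN1.
Qed.

Lemma padic_abs1 : padic_abs (1 : K) = 1.
Proof.
have := padic_abs_int 1; rewrite mulr1z => ->.
by rewrite /= logn1 oppr0 expr0z.
Qed.

Lemma padic_abs_uniformizer (g : int) : exists w : K, padic_abs w = p%:R ^ g.
Proof.
have absX (x : K) k : padic_abs (x ^+ k) = padic_abs x ^+ k.
  by elim: k => [|k ih]; rewrite ?expr0 ?padic_abs1// !exprS padic_absM ih.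
have pK : (p%:R : K) != 0.
  apply/eqP => pK; move: padic_abs_p; rewrite pK padic_abs0 => /esym/eqP.
  by rewrite invr_eq0 gt_eqF.
have absV : padic_abs (p%:R^-1 : K) = p%:R.
  apply: (mulfI (x := p%:R^-1)); first by rewrite invr_eq0 gt_eqF.
  by rewrite -{1}padic_abs_p -padic_absM mulfV// padic_abs1 mulVf// gt_eqF.
case: g => k.
  by exists (p%:R^-1 ^+ k); rewrite absX absV.
by exists (p%:R ^+ k.+1); rewrite absX padic_abs_p NegzE -exprnN exprVn.
Qed.

(** The residue field has p elements: by density a unit ball element is close to
    a fraction whose denominator is prime to p, and such a fraction is congruent
    to an integer by Bezout. *)
Lemma padic_digit (y : K) : padic_abs y <= 1 ->
  exists d : 'I_p, padic_abs (y - (d : nat)%:R) <= p%:R^-1.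
Proof.
move=> y1; have pV0 : 0 < p%:R^-1 :> R by rewrite invr_gt0.
have [a ya] := padic_rat_dense y pV0.
suff [d ad] : exists d : 'I_p, padic_abs (ratr a - (d : nat)%:R : K) <= p%:R^-1.
  exists d; rewrite (_ : _ - _ = (y - ratr a) + (ratr a - (d : nat)%:R)); last first.
    by rewrite addrA subrK.
  by rewrite (le_trans (padic_absD_max _ _))// ge_max ad (ltW ya).
have a1 : padic_abs (ratr a : K) <= 1.
  rewrite (_ : ratr a = y + - (y - ratr a)); last by rewrite opprB addrC subrK.
  rewrite (le_trans (padic_absD_max _ _))// ge_max y1 padic_absN.
  by rewrite (le_trans (ltW ya))// invf_le1// ler1n prime_gt0.
have [a0|a0] := eqVneq a 0.
  exists (Ordinal (prime_gt0 pp)).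
  by rewrite a0 (ratr_nat K 0) subr0 padic_abs0 invr_ge0 ltW.
set m := numq a; set k := denq a.
have kK : ratr a = m%:~R / k%:~R :> K by rewrite /ratr.
have pk : ~~ (p %| `|k|)%N.
  apply/negP => pk; move: a1; rewrite padic_abs_ratr /padic_abs_rat (negbTE a0).
  have -> : logn p `|numq a| = 0%N.
    apply/eqP; rewrite eqn0Ngt logn_gt0 mem_primes negb_and negb_and.
    apply/orP; right; apply/orP; right; apply/negP => pm.
    have := coprime_num_den a; rewrite /coprime => /eqP g1.
    have : (p %| gcdn `|numq a| `|denq a|)%N by rewrite dvdn_gcd pm.
    by rewrite g1 dvdn1 => /eqP p1; move: pp; rewrite p1.
  rewrite subr0; apply/negP; rewrite -ltNge exprn_egt1 ?ltr1n ?prime_gt1//.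
  by rewrite -lt0n logn_gt0 mem_primes pp absz_gt0 denq_neq0.
have k1 : padic_abs (k%:~R : K) = 1.
  rewrite padic_abs_int (negbTE (denq_neq0 _)).
  by rewrite lognE (negbTE pk) !andbF.
have /coprimezP[[u v] /= uv] : coprimez k p.
  by rewrite coprimezE/= coprime_sym prime_coprime.
pose d := ((m * u) %% p)%Z.
have p0z : p%:Z != 0 by rewrite eqz_nat -lt0n prime_gt0.
have d0 : 0 <= d by rewrite modz_ge0.
have dp : (`|d| < p)%N.
  by rewrite -ltz_nat gez0_abs// ltz_pmod// ltz_nat prime_gt0.
exists (Ordinal dp); rewrite /= kK.
have -> : (`|d|%N%:R : K) = d%:~R by rewrite -{2}(gez0_abs d0).
have kK0 : (k%:~R : K) != 0.
  by apply/eqP => k0; move: k1; rewrite k0 padic_abs0 => /eqP; rewrite eq_sym oner_eq0.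
suff : padic_abs ((m%:~R / k%:~R - d%:~R) * k%:~R : K) <= p%:R^-1.
  by rewrite padic_absM k1 mulr1.
rewrite mulrBl divfK// -intrM -intrB padic_abs_int_dvd.
have -> : m - d * k = p%:Z * (m * v + ((m * u) %/ p)%Z * k).
  have := divz_eq (m * u) p; rewrite -/d => mu.
  have -> : d = m * u - ((m * u) %/ p)%Z * p by rewrite {1}mu addrC addKr.
  have -> : m - (m * u - ((m * u) %/ p)%Z * p) * k
    = m * (1 - u * k) + ((m * u) %/ p)%Z * p * k by ring.
  by rewrite -uv; ring.
exact: dvdz_mulr.
Qed.

Lemma padic_digit_inj (i j : 'I_p) :
  padic_abs ((i : nat)%:R - (j : nat)%:R : K) <= p%:R^-1 -> i = j.
Proof.
have -> : ((i : nat)%:R - (j : nat)%:R : K) = ((i : nat)%:Z - (j : nat)%:Z)%:~R.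
  by rewrite intrB.
rewrite padic_abs_int_dvd => pij; apply/val_inj => /=.
move: pij; rewrite -eqz_mod_dvd => /eqP; rewrite !modz_nat => -[].
by rewrite !modn_small.
Qed.

End padic_field_theory.

Section scales.
Context (p : nat) (R : realType).
Hypothesis pp : prime p.

Let p0 : 0 < p%:R :> R. Proof. by rewrite ltr0n prime_gt0. Qed.
Let p1 : 1 < p%:R :> R. Proof. by rewrite ltr1n prime_gt1. Qed.

Lemma exists_small_radius (e : R) : 0 < e -> exists2 g : int, g <= 0 & p%:R ^ g < e.
Proof.
move=> e0; exists (- (Num.truncn e^-1).+1%:Z); first by rewrite oppr_le0.
set N := _.+1; rewrite -exprnN invf_plt ?posrE ?exprn_gt0//.
rewrite (lt_le_trans (truncnS_gt _))// -/N -natrX ler_nat ltnW//.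
by rewrite ltn_expl// prime_gt1.
Qed.

Lemma exists_radius_between (e : R) : 0 < e ->
  exists g : int, p%:R ^ (g - 1) < e <= p%:R ^ g.
Proof.
move=> e0; have [h _ he] := exists_small_radius e0.
have ex : exists k : nat, e <= p%:R ^ (h + k%:Z).
  have ph : 0 < p%:R ^ h :> R by rewrite exprz_gt0.
  exists (Num.truncn (e / p%:R ^ h)).+1; set N := _.+1.
  rewrite expfzDr ?gt_eqF// mulrC -ler_pdivrMr//.
  rewrite (le_trans (ltW (truncnS_gt _)))// -/N -exprnP -natrX ler_nat ltnW//.
  by rewrite ltn_expl// prime_gt1.
case: (ex_minnP ex) => -[|k] ek kmin.
  by move: ek; rewrite addr0 leNgt he.
exists (h + k.+1%:Z); rewrite ek andbT ltNge; apply/negP => ek1.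
have hk : h + k.+1%:Z - 1 = h + k%:Z by lia.
by rewrite hk in ek1; have := kmin _ ek1; rewrite ltnn.
Qed.

End scales.

(** * Balls and their measure *)

Section padic_balls.
Context (p : nat) (R : realType) (K : padicField p R) (n : nat).
Local Notation X := (padic_space K n).
Hypothesis pp : prime p.

Let p0 : (0 < p%:R :> R). Proof. by rewrite ltr0n prime_gt0. Qed.
Let p1 : (1 < p%:R :> R). Proof. by rewrite ltr1n prime_gt1. Qed.

Lemma padic_ball_center (g : int) (x : X) : padic_ball g x x.
Proof. by rewrite /padic_ball/= subrr padic_norm0 exprz_ge0// ltW. Qed.

Lemma padic_ball_sym (g : int) (x y : X) : padic_ball g x y -> padic_ball g y x.
Proof. by rewrite /padic_ball/= -padic_normN opprB. Qed.

Lemma padic_ball_trans (g : int) (x y z : X) :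
  padic_ball g x y -> padic_ball g y z -> padic_ball g x z.
Proof.
rewrite /padic_ball/= => xy yz.
have -> : z - x = (z - y) + (y - x) by rewrite addrA subrK.
by rewrite (le_trans (padic_normD_max _ _))// ge_max yz xy.
Qed.

Lemma padic_ball_eq (g : int) (x y : X) :
  padic_ball g x y -> padic_ball g y = padic_ball g x.
Proof.
move=> xy; apply/seteqP; split => z; apply: padic_ball_trans => //.
exact: padic_ball_sym.
Qed.

Lemma subset_padic_ball (g h : int) (x : X) : g <= h ->
  padic_ball g x `<=` padic_ball h x.
Proof. by move=> gh y /le_trans; apply; rewrite ler_weXz2l// ltW. Qed.

Lemma open_padic_ball (g : int) (x : X) : open (padic_ball g x).
Proof.
rewrite openE => y xy; apply/nbhs_ballP; exists (p%:R ^ g) => /=.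
  by rewrite exprz_gt0.
move=> z; rewrite ballEmdist /= /mdist/= => yz.
by apply: padic_ball_trans xy _; apply: padic_ball_sym; exact: ltW.
Qed.

Lemma padic_saturated_measurable (A : set X) :
  (forall x, A x -> exists g : int, padic_ball g x `<=` A) -> measurable A.
Proof.
move=> Asat; apply: sub_sigma_algebra; rewrite openE => x /Asat[g gA].
rewrite /interior; apply: filterS gA _; rewrite nbhsE/=.
exists (padic_ball g x) => //; split; first exact: open_padic_ball.
exact: padic_ball_center.
Qed.

Lemma padic_centers : exists c : nat -> X,
  forall (g : int) x, exists i, padic_ball g (c i) x.
Proof.
exists (fun i => map_mx ratr (odflt (0 : 'rV[rat]_n) (unpickle i))).
move=> g x.
have pg : 0 < p%:R ^ g :> R by rewrite exprz_gt0.
have /choice[a xa] (j : 'I_n) := padic_rat_dense (x ord0 j) pg.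
exists (pickle (\row_j a j)); rewrite pickleK /padic_ball/=.
by apply: padic_norm_le => [|j]; [exact: ltW|rewrite !mxE ltW].
Qed.

(** Balls of a fixed radius are equal or disjoint, so that listing the balls
    around countably many dense centres and discarding repetitions cuts the
    space into countably many of them. *)
Lemma padic_partition (g : int) : exists D : nat -> set X,
  [/\ trivIset setT D, \bigcup_i D i = setT &
      forall i, D i = set0 \/ exists a, D i = padic_ball g a].
Proof.
have [c cP] := padic_centers.
pose D i := if `[< exists2 j, (j < i)%N & padic_ball g (c j) (c i) >] then set0
            else padic_ball g (c i).
exists D; split.
- have DP i j x : (i < j)%N -> D i x -> D j x -> False.
    rewrite /D; case: asboolP => // _; case: asboolP => // jN ij ix jx.
    apply: jN; exists i => //; apply: padic_ball_trans ix _.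
    exact: padic_ball_sym.
  move=> i j _ _ [x [ix jx]]; have [ij|ji|//] := ltngtP i j.
    by have := DP _ _ _ ij ix jx.
  by have := DP _ _ _ ji jx ix.
- apply/seteqP; split => // x _.
  have ex : exists i, `[< padic_ball g (c i) x >].
    by have [i ix] := cP g x; exists i; apply/asboolP.
  case: (ex_minnP ex) => i /asboolP ix imin; exists i => //.
  rewrite /D; case: asboolP => // -[j ji jc].
  have := imin j; rewrite leqNgt ji => /(_ _)/negP; case; last by [].
  by apply/asboolP; apply: padic_ball_trans jc _.
- move=> i; rewrite /D; case: asboolP => _; [by left|right].
  by exists (c i).
Qed.

End padic_balls.

Section padic_measure.
Context (p : nat) (R : realType) (K : padicField p R) (n : nat).
Local Notation X := (padic_space K n).
Context (mu : {measure set X -> \bar R}).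
Hypotheses (pp : prime p) (haar : normalized_haar mu).

Let p0 : (0 < p%:R :> R). Proof. by rewrite ltr0n prime_gt0. Qed.
Let p1 : (1 < p%:R :> R). Proof. by rewrite ltr1n prime_gt1. Qed.

Lemma measure_padic_ball_center (g : int) (a : X) :
  mu (padic_ball g a) = mu (padic_ball g 0).
Proof.
have [inv _] := haar; rewrite -(inv a (padic_ball g 0)); last first.
  exact: measurable_padic_ball.
congr (mu _); apply/seteqP; split => [x ax|x [y + <-]].
  by exists (x - a); [rewrite /padic_ball/= subr0|rewrite addrC subrK].
by rewrite /padic_ball/= subr0 addrC addKr.
Qed.

(** A ball of radius p times larger is the disjoint union of the p ^ n translates
    of the ball by the vectors of digits. *)
Lemma measure_padic_ball_succ (g : int) :
  mu (padic_ball (g + 1) 0) = (((p ^ n)%:R : R)%:E * mu (padic_ball g (0 : X)%R))%E.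
Proof.
have [w wg] := padic_abs_uniformizer K pp (g + 1).
pose N := #|{ffun 'I_n -> 'I_p}|.
have NE : N = (p ^ n)%N by rewrite /N card_ffun !card_ord.
have pg : p%:R ^ g = p%:R^-1 * p%:R ^ (g + 1) :> R.
  rewrite -[in RHS](exprN1 p%:R) -expfzDr ?gt_eqF//.
  by congr (_ ^ _); rewrite addrC addrK.
have w0 : w != 0.
  apply/eqP => w0; move: wg; rewrite w0 padic_abs0 => /eqP.
  by rewrite lt_eqF// exprz_gt0.
pose t (d : {ffun 'I_n -> 'I_p}) : X := \row_j ((d j : nat)%:R * w).
have -> : padic_ball (g + 1) 0 =
    \big[setU/set0]_(i < N) padic_ball g (t (enum_val i)).
  rewrite -bigcup_seq; apply/seteqP; split => [x|x].
    rewrite /padic_ball/= subr0 => xg.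
    have /choice[d dP] (j : 'I_n) : exists d : 'I_p,
        padic_abs (x ord0 j / w - (d : nat)%:R) <= p%:R^-1.
      apply: padic_digit => //; rewrite padic_absM.
      have -> : padic_abs w^-1 = (padic_abs w)^-1.
        apply: (mulfI (x := padic_abs w)); first by rewrite wg gt_eqF// exprz_gt0.
        rewrite -padic_absM mulfV// padic_abs1// mulfV// wg gt_eqF//.
        by rewrite exprz_gt0.
      rewrite wg ler_pdivrMr ?exprz_gt0// mul1r (le_trans _ xg)//.
      exact: le_padic_norm.
    exists (enum_rank (finfun d)); rewrite /= ?mem_index_enum// enum_rankK.
    apply: padic_norm_le => [|j]; first by rewrite exprz_ge0// ltW.
    rewrite !mxE ffunE.
    have -> : x ord0 j - (d j : nat)%:R * w = (x ord0 j / w - (d j : nat)%:R) * w.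
      by rewrite mulrBl divfK.
    by rewrite padic_absM wg pg ler_wpM2r// exprz_ge0// ltW.
  move=> [i _]; rewrite /padic_ball/= subr0 => xi.
  rewrite -(subrK (t (enum_val i)) x) (le_trans (padic_normD_max _ _))//.
  rewrite ge_max (le_trans xi) ?ler_weXz2l ?(ltW p1) ?lerDl//=.
  apply: padic_norm_le => [|j]; first by rewrite exprz_ge0// ltW.
  rewrite mxE padic_absM wg ler_piMl ?exprz_ge0 ?(ltW p0)//.
  exact: (padic_abs_int_le1 K pp (Posz _)).
rewrite measure_bigsetU_ord; last 2 first.
- by move=> i; exact: measurable_padic_ball.
- move=> i j _ _ [x [ix jx]]; apply: enum_val_inj; apply/ffunP => k.
  apply: (@padic_digit_inj _ _ K) => //.
  have : padic_ball g (t (enum_val i)) (t (enum_val j)).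
    by apply: padic_ball_trans ix _; exact: padic_ball_sym.
  move=> /padic_ball_sym; rewrite /padic_ball/= => /(le_trans (le_padic_norm _ k)).
  rewrite !mxE -mulrBl padic_absM wg pg.
  by rewrite ler_pM2r// exprz_gt0.
rewrite (eq_bigr (fun=> mu (padic_ball g (0 : X)))); last first.
  by move=> i _; exact: measure_padic_ball_center.
by rewrite sumr_const card_ord NE; rewrite mule_natl.
Qed.

Lemma measure_padic_ball (g : int) (a : X) :
  mu (padic_ball g a) = (p%:R `^ (n%:R * g%:~R))%:E.
Proof.
have -> : p%:R `^ (n%:R * g%:~R) = (p ^ n)%:R ^ g :> R.
  by rewrite powRrM powR_mulrn ?ltW// powR_intmul ?exprn_ge0 ?ltW// natrX.
rewrite measure_padic_ball_center.
have pn0 : (p ^ n)%:R != 0 :> R by rewrite pnatr_eq0 expn_eq0 negb_and -lt0n prime_gt0.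
have step := measure_padic_ball_succ.
have pos k : mu (padic_ball (Posz k) 0) = ((p ^ n)%:R ^ (Posz k))%:E.
  elim: k => [|k ih]; first by rewrite (proj2 haar) expr0z.
  by rewrite -[k.+1]addn1 PoszD step ih -EFinM exprzDr ?unitfE// expr1z mulrC.
have neg k : mu (padic_ball (- Posz k) 0) = ((p ^ n)%:R ^ (- Posz k))%:E.
  elim: k => [|k ih]; first by rewrite oppr0 (proj2 haar) expr0z.
  have := step (- Posz k.+1); rewrite [in LHS](_ : _ + 1 = - Posz k); last by lia.
  rewrite ih; case: (mu _) => [r| |] //=.
  - rewrite -EFinM => -[rE]; congr EFin; apply: (mulfI pn0); rewrite -rE.
    by rewrite -[X in _ = X * _]expr1z -expfzDr//; congr (_ ^ _); lia.
  - by rewrite gt0_muley// lte_fin lt_neqAle eq_sym pn0/=.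
  - by rewrite gt0_muleNy// lte_fin lt_neqAle eq_sym pn0/=.
by case: g => k; [exact: pos|rewrite NegzE; exact: neg].
Qed.

(** Ball-wise domination integrates: a union of balls of a fixed radius splits
    into countably many disjoint ones. *)
Lemma le_integral_padic_balls (g : int) (E : set X) (u v : X -> \bar R) :
  (forall x, E x -> padic_ball g x `<=` E) ->
  measurable_fun [set: X] u -> measurable_fun [set: X] v ->
  (forall x, 0 <= u x)%E -> (forall x, 0 <= v x)%E ->
  (forall x, E x -> \int[mu]_(y in padic_ball g x) u y
                 <= \int[mu]_(y in padic_ball g x) v y)%E ->
  (\int[mu]_(y in E) u y <= \int[mu]_(y in E) v y)%E.
Proof.
move=> Esat mu_ mv u0 v0 uv.
have [D [tD DT DP]] := padic_partition K n pp g.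
have EE : E = \bigcup_i (E `&` D i) by rewrite -setI_bigcupr DT setIT.
have ED i : E `&` D i = set0 \/ exists2 a, E a & E `&` D i = padic_ball g a.
  have [->|[a Da]] := DP i; first by left; rewrite setI0.
  have [->|/set0P[x [Ex Dx]]] := eqVneq (E `&` D i) set0; [by left|right].
  have {}Da : D i = padic_ball g x.
    by rewrite Da; apply/esym/padic_ball_eq; rewrite -Da.
  by exists x => //; rewrite Da; apply/setIidPr; exact: Esat.
have mED i : measurable (E `&` D i).
  by have [->//|[a _ ->]] := ED i; exact: measurable_padic_ball.
have tED : trivIset setT (fun i => E `&` D i).
  by move=> i j _ _ [x [[_ ix] [_ jx]]]; apply: tD => //; exists x.
rewrite EE !ge0_integral_bigcup//; last 2 first.
- exact: measurable_funTS.
- exact: measurable_funTS.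
apply: lee_nneseries => [i _ _|i _].
  by apply: integral_ge0 => x _; exact: u0.
by have [->|[a Ea ->]] := ED i; [rewrite !integral_set0|exact: uv].
Qed.

End padic_measure.

(** * Means over balls and the weak type inequality *)

Lemma measurable_superlevel d (T : measurableType d) (R : realType)
    (f : T -> \bar R) :
  (forall t : R, measurable [set x | (t%:E < f x)%E]) -> measurable_fun [set: T] f.
Proof.
move=> fP mT; apply: (measurability _ (ErealGenOInfty.measurableE R)) => //.
move=> _ [_ [t ->] <-]; rewrite setTI.
rewrite (_ : _ @^-1` _ = [set x | (t%:E < f x)%E])//.
by apply/seteqP; split => x /=; rewrite in_itv/= andbT.
Qed.

Section ball_means.
Context (p : nat) (R : realType) (K : padicField p R) (n : nat).
Local Notation X := (padic_space K n).
Context (mu : {measure set X -> \bar R}).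
Hypotheses (pp : prime p) (haar : normalized_haar mu).

Implicit Types f h : X -> R.

Definition ball_volume (g : int) : R := p%:R `^ (n%:R * g%:~R).

Lemma ball_volume_gt0 g : 0 < ball_volume g.
Proof. by rewrite powR_gt0// ltr0n prime_gt0. Qed.

Lemma measure_ball_volume g (x : X) : mu (padic_ball g x) = (ball_volume g)%:E.
Proof. exact: measure_padic_ball. Qed.

Definition ball_mean (f : X -> R) (g : int) (x : X) : \bar R :=
  ((ball_volume g)^-1%:E * \int[mu]_(y in padic_ball g x) `|f y|%:E)%E.

Lemma ball_mean_ge0 f g x : (0 <= ball_mean f g x)%E.
Proof.
apply: mule_ge0; first by rewrite lee_fin invr_ge0 ltW// ball_volume_gt0.
by apply: integral_ge0 => y _; rewrite lee_fin.
Qed.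

Lemma ball_mean_eq f g x y : padic_ball g x y -> ball_mean f g y = ball_mean f g x.
Proof. by rewrite /ball_mean => /padic_ball_eq ->. Qed.

Lemma measurable_norm_EFin (D : set X) (f : X -> R) : measurable_fun [set: X] f ->
  measurable_fun D (fun x => `|f x|%:E).
Proof.
move=> mf; apply/measurable_EFinP; apply: measurableT_comp => //.
exact: measurable_funTS.
Qed.

Lemma le_ball_mean f h g x : measurable_fun [set: X] f -> measurable_fun [set: X] h ->
  {ae mu, forall y, padic_ball g x y -> `|f y| <= `|h y|} ->
  (ball_mean f g x <= ball_mean h g x)%E.
Proof.
move=> mf mh fh; rewrite lee_pmul2l ?lte_fin ?invr_gt0 ?ball_volume_gt0//.
apply: ae_ge0_le_integral => //.
- exact: measurable_padic_ball.
- exact: measurable_norm_EFin.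
- exact: measurable_norm_EFin.
Qed.

Lemma ball_mean_cst (c : R) g x : 0 <= c -> ball_mean (cst c) g x = c%:E.
Proof.
move=> c0; rewrite /ball_mean (eq_integral (cst c%:E)); last first.
  by move=> y _; rewrite /= ger0_norm.
rewrite integral_cst/=; last exact: measurable_padic_ball.
rewrite measure_ball_volume -!EFinM mulrCA mulVf ?mulr1//.
by rewrite gt_eqF// ball_volume_gt0.
Qed.

Lemma ball_meanD f h g x : measurable_fun [set: X] f -> measurable_fun [set: X] h ->
  (forall x, 0 <= f x) -> (forall x, 0 <= h x) ->
  ball_mean (f \+ h) g x = (ball_mean f g x + ball_mean h g x)%E.
Proof.
move=> mf mh f0 h0; rewrite /ball_mean -ge0_muleDr; last 2 first.
- by apply: integral_ge0 => y _; rewrite lee_fin.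
- by apply: integral_ge0 => y _; rewrite lee_fin.
rewrite -ge0_integralD//; last 3 first.
- exact: measurable_padic_ball.
- exact: measurable_norm_EFin.
- exact: measurable_norm_EFin.
by congr (_ * _)%E; apply: eq_integral => y _; rewrite /= !ger0_norm// addr_ge0.
Qed.

Lemma ball_meanZ f (c : R) g x : measurable_fun [set: X] f ->
  ball_mean (fun y => c * f y) g x = (`|c|%:E * ball_mean f g x)%E.
Proof.
move=> mf; rewrite /ball_mean muleCA; congr (_ * _)%E.
rewrite -ge0_integralZl//; last exact: measurable_norm_EFin.
- by apply: eq_integral => y _; rewrite normrM EFinM.
- exact: measurable_padic_ball.
Qed.

Lemma frac_meanE (s : R) f g x :
  (mu (padic_ball g x) `^ (- 1 + s / n%:R) * \int[mu]_(y in padic_ball g x) `|f y|%:E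
   = (ball_volume g `^ (s / n%:R))%:E * ball_mean f g x)%E.
Proof.
rewrite measure_ball_volume poweR_EFin powRD; last first.
  by rewrite (gt_eqF (ball_volume_gt0 _)) implybT.
by rewrite powR_inv1 ?(ltW (ball_volume_gt0 _))// mulrC EFinM muleA.
Qed.

Lemma frac_maximalE (s : R) f x : frac_maximal mu s f x =
  ereal_sup (range (fun g => (ball_volume g `^ (s / n%:R))%:E * ball_mean f g x)%E).
Proof.
rewrite /frac_maximal; congr (ereal_sup (_ @` _)); apply/funext => g.
exact: frac_meanE.
Qed.

Lemma frac_maximal_ge (s : R) f x g :
  ((ball_volume g `^ (s / n%:R))%:E * ball_mean f g x <= frac_maximal mu s f x)%E.
Proof. by rewrite frac_maximalE; apply: ereal_sup_ubound; exists g. Qed.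

Lemma frac_maximal_le (s : R) f x c :
  (forall g, (ball_volume g `^ (s / n%:R))%:E * ball_mean f g x <= c)%E ->
  (frac_maximal mu s f x <= c)%E.
Proof. by move=> fc; rewrite frac_maximalE; apply: ge_ereal_sup => _ [g _ <-]. Qed.

Lemma frac_maximal_ge0 (s : R) f x : (0 <= frac_maximal mu s f x)%E.
Proof.
apply: le_trans (frac_maximal_ge s f x 0); apply: mule_ge0.
  by rewrite lee_fin powR_ge0.
exact: ball_mean_ge0.
Qed.

Lemma ball_mean_le_maximal f x g : (ball_mean f g x <= frac_maximal mu 0 f x)%E.
Proof. by have := frac_maximal_ge 0 f x g; rewrite mul0r powRr0 mul1e. Qed.

Lemma maximal_le f x c :
  (forall g, ball_mean f g x <= c)%E -> (frac_maximal mu 0 f x <= c)%E.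
Proof.
by move=> fc; apply: frac_maximal_le => g; rewrite mul0r powRr0 mul1e.
Qed.

Lemma frac_maximal_gtP (s : R) f x c : (c < frac_maximal mu s f x)%E ->
  exists g, (c < (ball_volume g `^ (s / n%:R))%:E * ball_mean f g x)%E.
Proof. by rewrite frac_maximalE => /ereal_sup_gt[_ [g _ <-] cg]; exists g. Qed.

Lemma measurable_frac_maximal (s : R) f : measurable_fun [set: X] (frac_maximal mu s f).
Proof.
apply: measurable_superlevel => t.
apply: (padic_saturated_measurable pp) => x /= /frac_maximal_gtP[g tg].
exists g => y xy; apply: lt_le_trans tg _.
by rewrite -(ball_mean_eq f xy); exact: frac_maximal_ge.
Qed.

Lemma maximal_gt_ball f (t : R) : measurable [set x | (t%:E < frac_maximal mu 0 f x)%E].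
Proof.
rewrite -[X in measurable X]setTI; apply: emeasurable_fun_o_infty => //.
exact: measurable_frac_maximal.
Qed.

(** Every point where some mean over a ball of radius at most p ^ N is large has a
    largest such ball; these largest balls are disjoint by the ultrametric
    inequality, so the covering has multiplicity one. *)
Lemma maximal_weak_type f (t : R) : measurable_fun [set: X] f -> 0 < t ->
  (t%:E * mu [set x | t%:E < frac_maximal mu 0 f x] <= \int[mu]_x `|f x|%:E)%E.
Proof.
move=> mf t0.
pose bad g x := (t%:E < ball_mean f g x)%E.
have bad_eq g x y : padic_ball g x y -> bad g y = bad g x.
  by move=> xy; rewrite /bad (ball_mean_eq f xy).
pose F (N k : nat) := [set x | bad (N%:Z - k%:Z) x /\
  forall j, (j < k)%N -> ~~ bad (N%:Z - j%:Z) x].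
pose E (N : nat) := \bigcup_k F N k.
have Fsat N k x : F N k x -> padic_ball (N%:Z - k%:Z) x `<=` F N k.
  move=> [xk xj] y xy; split; first by rewrite (bad_eq _ _ _ xy).
  move=> j jk; rewrite (bad_eq _ x) ?xj//.
  by apply: subset_padic_ball xy => //; lia.
have mF N k : measurable (F N k).
  by apply: (padic_saturated_measurable pp) => x /Fsat; exists (N%:Z - k%:Z).
have mE N : measurable (E N) by exact: bigcup_measurable.
have tF N : trivIset setT (F N).
  move=> i j _ _ [x [[xi iN] [xj jN]]]; have [ij|ji|//] := ltngtP i j.
    by have := jN _ ij; rewrite xi.
  by have := iN _ ji; rewrite xj.
have EP N x : E N x <-> exists2 k : nat, true & bad (N%:Z - k%:Z) x.
  split=> [[k _ [xk _]]|[k _ xk]]; first by exists k.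
  have ex : exists k : nat, bad (N%:Z - k%:Z) x by exists k.
  case: (ex_minnP ex) => m xm mmin; exists m => //; split => // j jm.
  by apply/negP => /mmin; rewrite leqNgt jm.
have Ele N : (\int[mu]_(x in E N) t%:E <= \int[mu]_x `|f x|%:E)%E.
  apply: (@le_trans _ _ (\int[mu]_(x in E N) `|f x|%:E)%E); last first.
    apply: ge0_subset_integral => //.
    by apply: measurable_norm_EFin.
  rewrite /E !ge0_integral_bigcup//; last 2 first.
  - exact: measurable_norm_EFin.
  - by move=> x _; rewrite lee_fin ltW.
  apply: lee_nneseries => [i _ _|i _].
    by apply: integral_ge0 => x _; rewrite lee_fin ltW.
  apply: (le_integral_padic_balls (g := N%:Z - i%:Z) pp) => //.
  - exact: Fsat.
  - exact: measurable_norm_EFin.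
  - by move=> x; rewrite lee_fin ltW.
  - move=> x [+ _]; rewrite /bad /ball_mean => xt.
    rewrite integral_cst; last exact: measurable_padic_ball.
    rewrite measure_ball_volume ltW//.
    by move: xt; rewrite lte_pdivlMl ?ball_volume_gt0// muleC.
have -> : [set x | (t%:E < frac_maximal mu 0 f x)%E] = \bigcup_N E N.
  apply/seteqP; split => x /=.
    move=> /frac_maximal_gtP[g]; rewrite mul0r powRr0 mul1e => xg.
    exists `|g|%N => //; apply/EP; exists `|(`|g|%N%:Z - g)%R|%N => //.
    rewrite /bad [X in ball_mean f X x](_ : _ = g)//; lia.
  by move=> [N _ /EP[k _ /lt_le_trans]]; apply; exact: ball_mean_le_maximal.
rewrite -integral_cst; last exact: bigcup_measurable.
have cE := @ge0_nondecreasing_set_cvg_integral _ _ R E (cst t%:E) mu.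
rewrite -(cvg_lim _ (cE _ _ _ _))//.
- apply: lime_le; last by apply: nearW => N; exact: Ele.
  apply/cvg_ex; eexists; apply: cE => //.
  - apply/nondecreasing_seqP => N; apply/subsetPset => x /EP[k _ xk].
    by apply/EP; exists k.+1 => //; rewrite [X in bad X x](_ : _ = N%:Z - k%:Z)//; lia.
  - by move=> N x _; rewrite lee_fin ltW.
- apply/nondecreasing_seqP => N; apply/subsetPset => x /EP[k _ xk].
  by apply/EP; exists k.+1 => //; rewrite [X in bad X x](_ : _ = N%:Z - k%:Z)//; lia.
- by move=> N x _; rewrite lee_fin ltW.
Qed.

(** The part of f below t contributes at most t to every mean. *)
Lemma maximal_weak_type_above f (t : R) : measurable_fun [set: X] f -> 0 < t ->
  (t%:E * mu [set x | (t + t)%:E < frac_maximal mu 0 f x]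
    <= \int[mu]_(x in [set x | (t < `|f x|)%R]) `|f x|%:E)%E.
Proof.
move=> mf t0; set A := [set x | t < `|f x|].
have mA : measurable A.
  rewrite -[A]setTI; apply: (@measurable_fun_ltr _ _ _ _ (cst t) (Num.norm \o f)) => //.
  exact: measurableT_comp.
pose h := (fun x => f x * \1_A x) : X -> R.
have mh : measurable_fun [set: X] h.
  by apply: measurable_funM => //; exact: measurable_indic.
have -> : (\int[mu]_(x in A) `|f x|%:E = \int[mu]_x `|h x|%:E)%E.
  rewrite integral_mkcond; apply: eq_integral => x _; rewrite /patch /h.
  by rewrite indicE; case: ifPn => xA; rewrite ?mulr1 ?mulr0 ?normr0.
apply: le_trans (maximal_weak_type mh t0).
rewrite lee_pmul2l//; apply: le_measure.
- by rewrite inE; exact: maximal_gt_ball.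
- by rewrite inE; exact: maximal_gt_ball.
move=> x /=; rewrite !ltNge; apply: contra => hx; apply: maximal_le => g.
apply: (@le_trans _ _ (ball_mean (fun y => `|h y| + cst t y) g x)).
  apply: le_ball_mean => //.
    by apply: measurable_funD => //; exact: measurableT_comp.
  apply: aeW => y _; rewrite [leRHS]ger0_norm ?addr_ge0 ?(ltW t0)//=.
  rewrite /h indicE; have [yA|yA] := boolP (y \in A).
    by rewrite mulr1 lerDl ltW.
  rewrite mulr0 normr0 add0r leNgt; apply/negP => ty; move: yA; apply/negP.
  by rewrite negbK inE.
have mnh : measurable_fun [set: X] (Num.norm \o h) by exact: measurableT_comp.
have ct0 (y : X) : 0 <= cst t y by exact: ltW.
rewrite (ball_meanD (f := Num.norm \o h) (h := cst t))//; last first.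
  by move=> y; exact: normr_ge0.
rewrite ball_mean_cst ?(ltW t0)// EFinD leeD2r//; apply: le_trans hx.
apply: le_trans (ball_mean_le_maximal h x g); apply: le_ball_mean => //.
by apply: aeW => y _; rewrite /= normr_id.
Qed.

End ball_means.

(** * The maximal function on spaces of constant exponent *)

Lemma powR_gt1 (R : realType) (a x : R) : 1 < a -> 0 < x -> 1 < a `^ x.
Proof.
move=> a1 x0; rewrite /powR gt_eqF ?(lt_trans ltr01)// expR_gt1 mulr_gt0//.
exact: ln_gt0.
Qed.

Lemma nneseries_term_le (R : realType) (u : nat -> \bar R) (k : nat) :
  (forall i, 0 <= u i)%E -> (u k <= \sum_(i <oo) u i)%E.
Proof.
move=> u0; apply: le_trans (nneseries_lim_ge k.+1 _); last by move=> i _ _.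
by rewrite big_mkord big_ord_recr/= leeDr// sume_ge0.
Qed.

(** A geometric series of ratio larger than 1 is controlled by its last term. *)
Lemma sum_dyadic_below (R : realType) (a c u : R) (N : nat) :
  0 < a -> 1 < c -> 0 <= u ->
  \sum_(k < N) (if a * 2 ^+ k < u then (a * 2 ^+ k) `^ (c - 1) else 0)
    <= (2 `^ (c - 1) / (2 `^ (c - 1) - 1)) * u `^ (c - 1).
Proof.
move=> a0 c1 u0; set t := 2 `^ (c - 1).
have t1 : 1 < t.
  by rewrite /t powR_gt1 ?subr_gt0// ltr1n.
pose S N := \sum_(k < N) (if a * 2 ^+ k < u then (a * 2 ^+ k) `^ (c - 1) else 0).
have bS k : (a * 2 ^+ k.+1) `^ (c - 1) = t * (a * 2 ^+ k) `^ (c - 1).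
  by rewrite exprS mulrCA [LHS]powRM// mulr_ge0 ?exprn_ge0// ltW.
have c10 : 0 <= c - 1 by rewrite subr_ge0 ltW.
suff [St _] : (t - 1) * S N <= t * u `^ (c - 1) /\
              (t - 1) * S N <= (a * 2 ^+ N) `^ (c - 1).
  by rewrite -/(S N) mulrAC ler_pdivlMr ?subr_gt0// mulrC.
elim: N => [|N [ih1 ih2]].
  by rewrite /S big_ord0 mulr0 powR_ge0 mulr_ge0 ?powR_ge0.
rewrite /S big_ord_recr/= -/(S N) bS; case: ifPn => aNu.
  have H : (t - 1) * (S N + (a * 2 ^+ N) `^ (c - 1)) <= t * (a * 2 ^+ N) `^ (c - 1).
    by rewrite mulrDr [X in _ + X]mulrBl mul1r; lra.
  split => //; apply: le_trans H _; rewrite ler_wpM2l ?powR_ge0//.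
  by apply: ge0_ler_powR => //; rewrite ?nnegrE ?mulr_ge0 ?exprn_ge0 ?ltW.
rewrite addr0; split => //; apply: le_trans ih2 _.
by rewrite ler_peMl ?powR_ge0// ltW.
Qed.

Section strong_type.
Context (p : nat) (R : realType) (K : padicField p R) (n : nat).
Local Notation X := (padic_space K n).
Context (mu : {measure set X -> \bar R}).
Hypotheses (pp : prime p) (haar : normalized_haar mu).
Implicit Types f h : X -> R.

Let dyadic_majorant (a c A : R) (M : \bar R) (S : \bar R) :
  0 < a -> 1 < c -> a + a < A -> (A%:E <= M)%E ->
  (forall k : nat, (a * 2 ^+ k + a * 2 ^+ k)%:E < M ->
     ((a * 2 ^+ k) `^ c)%:E <= S)%E ->
  ((A `^ c)%:E <= (4 `^ c)%:E * S)%E.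
Proof.
move=> a0 c1 aA AM MS.
have [m Am] : exists m : nat, A <= a * 2 ^+ m + a * 2 ^+ m.
  have [m mA] : exists m : nat, A / a <= m%:R.
    by exists (Num.truncn (A / a)).+1; rewrite ltW// truncnS_gt.
  exists m; rewrite -mulrDr -ler_pdivrMl// mulrC (le_trans mA)//.
  rewrite (@le_trans _ _ (2 ^+ m))//; last by rewrite lerDl exprn_ge0.
  by rewrite -natrX ler_nat ltnW// ltn_expl.
have : exists m : nat, A <= a * 2 ^+ m + a * 2 ^+ m by exists m.
move=> /ex_minnP[{Am}[|k] Ak kmin].
  by move: Ak; rewrite expr0 mulr1 leNgt aA.
have kA : a * 2 ^+ k + a * 2 ^+ k < A.
  by rewrite ltNge; apply/negP => /kmin; rewrite ltnn.
apply: (@le_trans _ _ ((4 `^ c)%:E * ((a * 2 ^+ k) `^ c)%:E)%E); last first.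
  rewrite lee_pmul2l ?lte_fin ?powR_gt0//; apply: MS.
  by apply: lt_le_trans AM; rewrite lte_fin.
have ak0 : 0 <= a * 2 ^+ k by rewrite mulr_ge0 ?exprn_ge0// ltW.
rewrite -EFinM lee_fin -powRM//; apply: ge0_ler_powR.
- by rewrite (le_trans _ (ltW c1)).
- by rewrite nnegrE (le_trans _ (ltW aA))// addr_ge0// ltW.
- by rewrite nnegrE mulr_ge0.
- by apply: le_trans Ak _; rewrite exprS; lra.
Qed.

Let powR_le_series (a c : R) (M : \bar R) (S : \bar R) :
  0 < a -> 1 < c -> ((a + a)%:E < M)%E -> (0 <= S)%E ->
  (forall k : nat, (a * 2 ^+ k + a * 2 ^+ k)%:E < M ->
     ((a * 2 ^+ k) `^ c)%:E <= S)%E ->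
  (M `^ c <= (4 `^ c)%:E * S)%E.
Proof.
move=> a0 c1; case: M => [M| |] // aM S0 MS.
  by rewrite poweR_EFin; apply: (dyadic_majorant (a := a) (M := M%:E)).
suff -> : ((4 `^ c)%:E * S = +oo)%E by rewrite leey.
apply/eqyP => A A0.
pose B := Num.max A (Num.max 1 (a + a + 1)).
have AB : A <= B by rewrite le_max lexx.
have B1 : 1 <= B by rewrite !le_max lexx orbT.
have Ba : a + a < B.
  by rewrite (@lt_le_trans _ _ (a + a + 1)) ?ltrDl// !le_max lexx !orbT.
apply: (@le_trans _ _ (B `^ c)%:E).
  by rewrite lee_fin (le_trans AB)// -[leLHS]powRr1 ?(le_trans _ B1)// ler_powR// ltW.
by apply: (dyadic_majorant (a := a) (M := +oo%E)) => //; rewrite leey.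
Qed.

Let tail (a c : R) f : 0 < a -> 1 < c -> measurable_fun [set: X] f ->
  (\int[mu]_(x in [set x | (a + a)%:E < frac_maximal mu 0 f x])
     (frac_maximal mu 0 f x) `^ c
   <= (4 `^ c)%:E * ((2 `^ (c - 1) / (2 `^ (c - 1) - 1))%:E
        * \int[mu]_x (`|f x| `^ c)%:E))%E.
Proof.
move=> a0 c1 mf; set M := frac_maximal mu 0 f.
have a0k k : 0 < a * 2 ^+ k by rewrite mulr_gt0 ?exprn_gt0.
have c40 : (0 <= (4 `^ c)%:E :> \bar R)%E by rewrite lee_fin powR_ge0.
pose E k := [set x | ((a * 2 ^+ k + a * 2 ^+ k)%:E < M x)%E].
pose A k := [set x | a * 2 ^+ k < `|f x|].
have mE k : measurable (E k) by exact: maximal_gt_ball.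
have mA k : measurable (A k).
  rewrite -[A k]setTI; apply: (@measurable_fun_ltr _ _ _ _ (cst _) (Num.norm \o f)) => //.
  exact: measurableT_comp.
pose s k x := ((a * 2 ^+ k) `^ c * \1_(E k) x)%:E.
have s0 k x : (0 <= s k x)%E by rewrite lee_fin mulr_ge0 ?powR_ge0.
have ms k : measurable_fun [set: X] (s k).
  by apply/measurable_EFinP; apply: measurable_funM => //; exact: measurable_indic.
pose S : X -> \bar R := fun x => (\sum_(k <oo) s k x)%E.
have S0 x : (0 <= S x)%E by apply: nneseries_ge0.
have mS : measurable_fun [set: X] S by apply: ge0_emeasurable_sum.
have MS x : ((a + a)%:E < M x)%E -> (M x `^ c <= (4 `^ c)%:E * S x)%E.
  move=> aM; apply: (powR_le_series a0 c1 aM) => // k kM.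
  have -> : ((a * 2 ^+ k) `^ c)%:E = s k x by rewrite /s indicE mem_set// mulr1.
  exact: nneseries_term_le.
have mM : measurable_fun [set: X] (fun x => M x `^ c)%E.
  apply: (measurableT_comp (measurable_poweR c)).
  exact: measurable_frac_maximal.
apply: (@le_trans _ _ (\int[mu]_x ((4 `^ c)%:E * S x))%E).
  apply: (@le_trans _ _ (\int[mu]_(x in E 0%N) ((4 `^ c)%:E * S x))%E).
    rewrite (_ : [set x | _] = E 0%N); last by rewrite /E expr0 mulr1.
    apply: ge0_le_integral => //.
    - by move=> x _; exact: poweR_ge0.
    - exact: measurable_funTS.
    - by apply: measurable_funTS; exact: measurable_funeM.
    - by move=> x; rewrite /E/= expr0 mulr1; exact: MS.
  apply: ge0_subset_integral => //; first exact: measurable_funeM.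
  by move=> x _; apply: mule_ge0; [exact: c40|exact: S0].
rewrite ge0_integralZl//.
rewrite lee_pmul2l ?lte_fin ?powR_gt0//.
pose h k x := (((a * 2 ^+ k) `^ (c - 1) * \1_(A k) x) * `|f x|)%:E.
have h0 k x : (0 <= h k x)%E by rewrite lee_fin !mulr_ge0 ?powR_ge0.
have mh k : measurable_fun [set: X] (h k).
  apply/measurable_EFinP; apply: measurable_funM; last exact: measurableT_comp.
  by apply: measurable_funM => //; exact: measurable_indic.
rewrite integral_nneseries//.
apply: (@le_trans _ _ (\sum_(k <oo) \int[mu]_x h k x)%E).
  apply: lee_nneseries => [k _ _|k _]; first exact: integral_ge0.
  rewrite (eq_integral (fun x => ((a * 2 ^+ k) `^ c)%:E * (\1_(E k) x)%:E)%E)//.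
  have mi : measurable_fun [set: X] (fun x => (\1_(E k) x)%:E : \bar R).
    by apply/measurable_EFinP; exact: measurable_indic.
  rewrite ge0_integralZl_EFin ?powR_ge0//.
  rewrite integral_indic// setIT.
  have -> : (a * 2 ^+ k) `^ c = (a * 2 ^+ k) `^ (c - 1) * (a * 2 ^+ k).
    by rewrite [RHS]mulrC mulr_powRB1// ?(lt_trans ltr01)// ltW.
  have := maximal_weak_type_above pp haar mf (a0k k) => wk.
  rewrite EFinM -muleA; apply: (@le_trans _ _ (((a * 2 ^+ k) `^ (c - 1))%:E *
      \int[mu]_(x in A k) `|f x|%:E)%E).
    by rewrite lee_pmul2l ?lte_fin ?powR_gt0.
  rewrite -ge0_integralZl_EFin ?powR_ge0//; last first.
    exact: measurable_norm_EFin.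
  rewrite integral_mkcond; apply: ge0_le_integral => //.
  - by move=> x _; rewrite /patch; case: ifP => // _; rewrite -EFinM lee_fin mulr_ge0 ?powR_ge0.
  - apply/(measurable_restrictT _ _).1 => //; apply: measurable_funeM.
    exact: measurable_norm_EFin.
  - move=> x _; rewrite /patch /h indicE; case: ifP => _.
      by rewrite mulr1 EFinM.
    by rewrite mulr0 mul0r.
have mfc : measurable_fun [set: X] (fun x => (`|f x| `^ c)%:E).
  apply/measurable_EFinP; apply: (measurableT_comp (measurable_powR c)).
  exact: measurableT_comp.
apply: (@le_trans _ _ (\int[mu]_x (\sum_(k <oo) h k x))%E).
  by rewrite integral_nneseries.
rewrite -ge0_integralZl_EFin//; last first.
  by rewrite divr_ge0 ?powR_ge0// subr_ge0 ltW// powR_gt1 ?subr_gt0 ?ltr1n.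
apply: ge0_le_integral => //.
- by move=> x _; apply: nneseries_ge0.
- by apply: ge0_emeasurable_sum.
- exact: measurable_funeM.
move=> x _; apply: lime_le; first exact: is_cvg_nneseries.
apply: nearW => N; rewrite sumEFin -EFinM lee_fin big_mkord -mulr_suml.
have -> : `|f x| `^ c = `|f x| `^ (c - 1) * `|f x|.
  by rewrite mulrC mulr_powRB1// (lt_trans ltr01).
rewrite mulrA ler_wpM2r//; apply: le_trans (sum_dyadic_below N a0 c1 (normr_ge0 (f x))).
rewrite le_eqVlt; apply/orP; left; apply/eqP; apply: eq_bigr => k _.
rewrite indicE; have -> : (x \in A k) = (a * 2 ^+ k < `|f x|).
  by apply/idP/idP; rewrite inE.
by case: ifP; rewrite ?mulr1 ?mulr0.
Qed.

(** Real interpolation between the weak type inequality and the trivial bound at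
    infinity, by a dyadic layer-cake decomposition; the sum over the layers
    above 2 ^- m is bounded independently of m. *)
Lemma maximal_strong_type (c : R) : 1 < c -> exists2 C : R, 0 < C &
  forall f, measurable_fun [set: X] f ->
    (\int[mu]_x (frac_maximal mu 0 f x) `^ c
      <= C%:E * \int[mu]_x (`|f x| `^ c)%:E)%E.
Proof.
move=> c1; exists (4 `^ c * (2 `^ (c - 1) / (2 `^ (c - 1) - 1))).
  rewrite mulr_gt0 ?powR_gt0// divr_gt0 ?powR_gt0//.
  by rewrite subr_gt0 powR_gt1 ?subr_gt0 ?ltr1n.
move=> f mf; set M := frac_maximal mu 0 f.
have cn0 : c != 0 by rewrite gt_eqF// (lt_trans _ c1).
pose D (m : nat) := [set x | ((2 ^- m + 2 ^- m)%:E < M x)%E].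
have mD m : measurable (D m) by exact: maximal_gt_ball.
have ndD : nondecreasing_seq D.
  apply/nondecreasing_seqP => m; apply/subsetPset => x; apply: le_lt_trans.
  have : 2 ^- m.+1 <= 2 ^- m :> R.
    by rewrite lef_pV2 ?posrE ?exprn_gt0// ler_weXn2l// ler1n.
  by rewrite lee_fin; lra.
have mM : measurable_fun [set: X] (fun x => M x `^ c)%E.
  apply: (measurableT_comp (measurable_poweR c)).
  exact: measurable_frac_maximal.
have DT : (\int[mu]_x M x `^ c = \int[mu]_(x in \bigcup_m D m) M x `^ c)%E.
  rewrite [RHS]integral_mkcond; apply: eq_integral => x _.
  rewrite /patch; case: ifPn => //; rewrite notin_setE => xD.
  suff -> : M x = 0%E by rewrite poweR0r.
  apply/eqP; rewrite eq_le frac_maximal_ge0// andbT leNgt; apply/negP => M0.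
  have [e e0 eM] : exists2 e : R, 0 < e & (e%:E < M x)%E.
    move: M0; case: (M x) => [r| |] //; rewrite ?lte_fin => r0.
      by exists (r / 2); rewrite ?lte_fin; lra.
    by exists 1 => //; rewrite ltry.
  apply: xD; exists (Num.truncn (2 / e)).+1 => //; rewrite /D/=; apply: le_lt_trans eM.
  rewrite lee_fin.
  set N := (Num.truncn (2 / e)).+1.
  have Ne : 2 / e < N%:R by rewrite truncnS_gt.
  have N2 : N%:R <= 2 ^+ N :> R by rewrite -natrX ler_nat ltnW// ltn_expl.
  have : 2 / e < 2 ^+ N by exact: lt_le_trans N2.
  have p2 : 0 < 2 ^+ N :> R by rewrite exprn_gt0.
  rewrite ltr_pdivrMr// => H.
  have -> : 2 ^- N + 2 ^- N = 2 / 2 ^+ N :> R by ring.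
  by rewrite ler_pdivrMr// mulrC ltW.
rewrite DT.
have cD := @ge0_nondecreasing_set_cvg_integral _ _ R D (fun x => M x `^ c)%E mu ndD mD.
rewrite -(cvg_lim _ (cD _ _))//.
- apply: lime_le.
    apply/cvg_ex; eexists; apply: cD.
    + by move=> i; exact: measurable_funTS.
    + by move=> i x _; exact: poweR_ge0.
  apply: nearW => m; rewrite EFinM -muleA; exact: tail.
- by move=> i; exact: measurable_funTS.
- by move=> i x _; exact: poweR_ge0.
Qed.

End strong_type.

(** * Variable powers and power means *)

Section power_lemmas.
Context {R : realType}.
Implicit Types (x y : \bar R) (r : R).

Lemma ge0_le_poweR r x y : 0 <= r -> (0 <= x)%E -> (x <= y)%E ->
  (x `^ r <= y `^ r)%E.
Proof.
move=> r0 x0 xy; apply: gt0_ler_poweR => //; rewrite in_itv/= ?x0 ?leey//.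
by rewrite (le_trans x0 xy).
Qed.

Lemma poweRK r x : 0 < r -> (0 <= x)%E -> ((x `^ r) `^ r^-1 = x)%E.
Proof. by move=> r0 x0; rewrite -poweRrM divff ?gt_eqF// poweRe1. Qed.

Lemma poweRVK r x : 0 < r -> (0 <= x)%E -> ((x `^ r^-1) `^ r = x)%E.
Proof. by move=> r0 x0; rewrite -poweRrM mulVf ?gt_eqF// poweRe1. Qed.

Lemma poweRD_le r x y : 1 <= r -> (0 <= x)%E -> (0 <= y)%E ->
  ((x + y) `^ r <= (2 `^ r)%:E * (x `^ r + y `^ r))%E.
Proof.
move=> r1; have r0 : 0 <= r by rewrite (le_trans _ r1).
wlog xy : x y / (x <= y)%E => [H x0 y0|x0 y0].
  have [xy|/ltW yx] := leP x y; first exact: H.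
  by rewrite addeC [X in (_ * X)%E]addeC; exact: H.
apply: (@le_trans _ _ ((2%:E * y) `^ r)%E).
  apply: ge0_le_poweR => //; first exact: adde_ge0.
  by rewrite mule_natl mule2n leeD2r.
rewrite poweRM// poweR_EFin lee_pmul2l ?lte_fin ?powR_gt0//.
by rewrite leeDr// poweR_ge0.
Qed.

(** For t >= tau this is t <= t ^ rho for t >= 1, rescaled by tau. Its right-hand side
    is affine in t ^ rho, so the inequality survives averaging, and the choice of
    tau is left for afterwards. *)
Lemma le_powR_threshold (t tau rho : R) : 0 <= t -> 0 < tau -> 1 <= rho ->
  t <= tau + tau `^ (1 - rho) * t `^ rho.
Proof.
move=> t0 tau0 rho1; have [tt|tt] := leP t tau.
  by rewrite (le_trans tt)// lerDl mulr_ge0 ?powR_ge0.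
have {}t0 : 0 < t by exact: lt_trans tt.
rewrite (@le_trans _ _ (tau `^ (1 - rho) * t `^ rho))//; last by rewrite lerDr ltW.
have {1}-> : t = t `^ (1 - rho) * t `^ rho.
  by rewrite -powRD ?subrK ?powRr1 ?(ltW t0)// gt_eqF ?implybT.
rewrite ler_wpM2r ?powR_ge0// -(opprB rho) !powRN lef_pV2 ?posrE ?powR_gt0//.
by apply: ge0_ler_powR; rewrite ?subr_ge0 ?nnegrE ?(ltW tau0) ?(ltW t0) ?(ltW tt).
Qed.

End power_lemmas.

Lemma measurable_poweR_fun d (T : measurableType d) (R : realType)
    (F : T -> \bar R) (q : T -> R) :
  (forall x, (0 <= F x)%E) -> (forall x, 0 < q x) ->
  measurable_fun [set: T] F -> measurable_fun [set: T] q ->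
  measurable_fun [set: T] (fun x => F x `^ q x)%E.
Proof.
move=> F0 q0 mF mq; apply: measurable_superlevel => t.
have [t0|t0] := ltP t 0.
  rewrite (_ : [set x | _] = setT)//; apply/seteqP; split => // x _ /=.
  by apply: (@lt_le_trans _ _ 0%E); rewrite ?lte_fin ?poweR_ge0.
rewrite (_ : [set x | _] = [set x | (t `^ (q x `^ (-1)))%:E < F x]%E); last first.
  apply/seteqP; split => x /=; rewrite powR_inv1 ?(ltW (q0 x))// !ltNge;
    apply: contra => H.
    rewrite -[leRHS](@poweRVK _ (q x)) ?lee_fin//.
    by rewrite ge0_le_poweR// ltW.
  rewrite -[leLHS](@poweRK _ (q x))//.
  by rewrite -poweR_EFin ge0_le_poweR ?invr_ge0 ?poweR_ge0// ltW.
rewrite -[X in measurable X]setTI; apply: measurable_lte => //.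
apply/measurable_EFinP; apply: (measurableT_comp (measurable_powRr t)).
exact: (measurableT_comp (measurable_powR (-1))).
Qed.

Lemma measurable_powR_fun d (T : measurableType d) (R : realType) (f q : T -> R) :
  (forall x, 0 <= f x) -> (forall x, 0 < q x) ->
  measurable_fun [set: T] f -> measurable_fun [set: T] q ->
  measurable_fun [set: T] (fun x => f x `^ q x).
Proof.
move=> f0 q0 mf mq; apply/measurable_EFinP.
have mF : measurable_fun [set: T] (EFin \o f) by exact/measurable_EFinP.
by have := measurable_poweR_fun (F := EFin \o f) f0 q0 mF mq.
Qed.

Section power_means.
Context (p : nat) (R : realType) (K : padicField p R) (n : nat).
Local Notation X := (padic_space K n).
Context (mu : {measure set X -> \bar R}).
Hypotheses (pp : prime p) (haar : normalized_haar mu).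
Implicit Types f h : X -> R.

(** Jensen's inequality up to the factor 2 ^ rho: the mean of [le_powR_threshold] is
    taken at the threshold tau that balances its two terms, tau = a ^ (1 / rho) for
    a the mean of h. *)
Lemma ball_mean_powR f h (rho : R) g x : 1 <= rho ->
  measurable_fun [set: X] f -> measurable_fun [set: X] h -> (forall y, 0 <= h y) ->
  {ae mu, forall y, padic_ball g x y -> `|f y| `^ rho <= h y} ->
  (ball_mean mu f g x `^ rho <= (2 `^ rho)%:E * ball_mean mu h g x)%E.
Proof.
move=> rho1 mf mh h0 fh.
have rho0 : 0 < rho by rewrite (lt_le_trans _ rho1).
have tauP tau : 0 < tau ->
    (ball_mean mu f g x <= tau%:E + (tau `^ (1 - rho))%:E * ball_mean mu h g x)%E.
  move=> tau0.
  apply: (@le_trans _ _ (ball_mean mu (cst tau \+ (fun y => tau `^ (1 - rho) * h y)) g x)).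
    apply: le_ball_mean => //.
      by apply: measurable_funD => //; exact: measurable_funM.
    apply: filterS fh => y fhy By.
    rewrite [leRHS]ger0_norm; last by rewrite addr_ge0 ?mulr_ge0 ?powR_ge0// ltW.
    apply: le_trans (le_powR_threshold (normr_ge0 (f y)) tau0 rho1) _.
    by rewrite lerD2l ler_wpM2l ?powR_ge0// fhy.
  rewrite ball_meanD//; last 3 first.
  - exact: measurable_funM.
  - by move=> y; rewrite ltW.
  - by move=> y; rewrite mulr_ge0 ?powR_ge0.
  by rewrite ball_mean_cst ?(ltW tau0)// ball_meanZ// ger0_norm ?powR_ge0.
have [hoo|] := eqVneq (ball_mean mu h g x) +oo%E.
  by rewrite hoo mulry gtr0_sg ?powR_gt0// mul1e leey.
rewrite -ltey => hfin; have := ball_mean_ge0 mu pp h g x.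
move: hfin tauP; case: (ball_mean mu h g x) => [a| |] // _ tauP.
rewrite lee_fin le_eqVlt => /predU1P[a0|a0].
  move: tauP; rewrite -a0 => tauP.
  suff -> : ball_mean mu f g x = 0%E by rewrite poweR0r ?gt_eqF// mule_ge0// lee_fin powR_ge0.
  apply/eqP; rewrite eq_le ball_mean_ge0// andbT; apply/lee_addgt0Pr => e e0.
  by rewrite add0e (le_trans (tauP _ e0))// -EFinM mulr0 adde0.
have ar0 : 0 < a `^ rho^-1 by rewrite powR_gt0.
apply: (@le_trans _ _ ((2 * a `^ rho^-1)%:E `^ rho)%E).
  apply: ge0_le_poweR; [exact: ltW|exact: ball_mean_ge0|].
  apply: le_trans (tauP _ ar0) _; rewrite -EFinM -EFinD lee_fin.
  suff -> : (a `^ rho^-1) `^ (1 - rho) * a = a `^ rho^-1 by lra.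
  rewrite -powRrM -{2}(powRr1 (ltW a0)) -powRD ?(gt_eqF a0) ?implybT//.
  by congr (_ `^ _); rewrite mulrBr mulVf ?gt_eqF// mulr1 subrK.
by rewrite poweR_EFin powRM ?powR_ge0// -powRrM mulVf ?gt_eqF// powRr1 ?(ltW a0)// EFinM.
Qed.

Lemma frac_maximal_powR_le (s q : R) f x c : 0 < q ->
  (forall g, ((ball_volume p R n g `^ (s / n%:R))%:E * ball_mean mu f g x) `^ q <= c)%E ->
  (frac_maximal mu s f x `^ q <= c)%E.
Proof.
move=> q0 fc.
have c0 : (0 <= c)%E by exact: le_trans (poweR_ge0 _ _) (fc 0).
rewrite -[leRHS](poweRVK q0)//; apply: ge0_le_poweR; [exact: ltW|exact: frac_maximal_ge0|].
apply: frac_maximal_le => // g; rewrite -[leLHS](poweRK q0); last first.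
  by apply: mule_ge0; rewrite ?ball_mean_ge0// lee_fin powR_ge0.
by apply: ge0_le_poweR; [rewrite invr_ge0 ltW|exact: poweR_ge0|exact: fc].
Qed.

End power_means.

(** * Log-Hoelder exponents *)

Section real_inequalities.
Context {R : realType}.

(** The hypothesis on A ^ (rho / c) is Jensen's inequality in a frozen exponent rho.
    Raising it to the exponent r leaves A1 with a surplus exponent between 0 and
    r - rho, and V ^ (rho - r) is what the local log-Hoelder condition bounds by L. *)
Lemma powR_mean_local (A A1 V rho c r L : R) : 0 <= A -> 0 <= A1 -> 0 < V ->
  1 <= c -> c <= rho -> rho <= r ->
  A `^ (rho / c) <= 2 `^ (rho / c) * A1 -> A1 <= V^-1 ->
  V `^ (rho - r) <= L -> 1 <= L ->
  A `^ r <= 2 `^ r * L * A1 `^ c.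
Proof.
move=> A0 A10 V0 c1 crho rhor AA1 A1V VL L1.
have c0 : 0 < c by rewrite (lt_le_trans _ c1).
have rho0 : 0 < rho by exact: lt_le_trans crho.
have r0 : 0 < r by exact: lt_le_trans rhor.
have rE : r = (rho / c) * (r * c / rho).
  by field; rewrite !gt_eqF.
pose e := c * (r - rho) / rho.
have e0 : 0 <= e by rewrite divr_ge0 ?mulr_ge0 ?subr_ge0// ltW.
have er : e <= r - rho.
  by rewrite ler_pdivrMr// mulrC ler_wpM2l// subr_ge0.
have ceE : r * c / rho = c + e.
  by rewrite /e; field; rewrite gt_eqF.
have -> : A `^ r = (A `^ (rho / c)) `^ (r * c / rho) by rewrite -powRrM -rE.
apply: (@le_trans _ _ ((2 `^ (rho / c) * A1) `^ (r * c / rho))).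
  by apply: ge0_ler_powR; rewrite ?nnegrE ?mulr_ge0 ?powR_ge0 ?invr_ge0// ltW.
rewrite powRM ?powR_ge0// -powRrM -rE -(mulrA (2 `^ r)) ler_wpM2l ?powR_ge0//.
rewrite ceE powRD; last by rewrite gt_eqF// ltr_wpDr.
rewrite mulrC ler_wpM2r ?powR_ge0//.
apply: (@le_trans _ _ (V^-1 `^ e)).
  by apply: ge0_ler_powR; rewrite ?nnegrE// invr_ge0 ltW.
rewrite -powR_inv1 ?(ltW V0)// -powRrM mulN1r.
have [V1|V1] := leP 1 V.
  apply: (le_trans _ L1); rewrite -(powRr0 V); apply: ler_powR => //.
  by rewrite oppr_le0.
apply: (le_trans _ VL); apply: ger_powR; first by rewrite V0 ltW.
by rewrite lerNr opprB.
Qed.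

(** Hedberg's trick: the power of V that distinguishes the fractional from the
    ordinary mean A is paid for by the a priori bound of A in terms of V, and since
    q = r + r t q the exponents match. *)
Lemma powR_hedberg (A V r q t C : R) : 0 <= A -> 0 < V -> 0 < r -> 0 < q ->
  0 <= t -> q^-1 = r^-1 - t -> 0 < C -> A `^ r <= C / V ->
  (V `^ t * A) `^ q <= C `^ (t * q) * A `^ r.
Proof.
move=> A0 V0 r0 q0 t0 qr C0 AV.
rewrite powRM ?powR_ge0// -powRrM.
move: A0; rewrite le_eqVlt => /predU1P[<-|A0].
  by rewrite !powR0 ?gt_eqF// !mulr0.
have qE : q = r + r * (t * q).
  have : q * r * q^-1 = q * r * (r^-1 - t) by rewrite qr.
  rewrite mulrBr mulrAC mulfV ?gt_eqF// mul1r mulfK ?gt_eqF// => rE.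
  by rewrite [X in _ = X + _]rE; ring.
rewrite {2}qE powRD; last by rewrite (gt_eqF A0) implybT.
rewrite mulrCA mulrC ler_wpM2r ?powR_ge0// (powRrM A).
apply: (@le_trans _ _ (V `^ (t * q) * (C / V) `^ (t * q))).
  rewrite ler_wpM2l ?powR_ge0//; apply: ge0_ler_powR => //.
  - by rewrite mulr_ge0// ltW.
  - by rewrite nnegrE powR_ge0.
  - by rewrite nnegrE divr_ge0// ltW.
by rewrite -powRM ?divr_ge0 ?(ltW C0) ?(ltW V0)// mulrC divfK// gt_eqF.
Qed.

(** Changing the exponent by the reciprocal of a logarithm costs a constant factor,
    except where the base is smaller than a fixed negative power of u; there the
    power is below that bound, because a >= 1. *)
Lemma powR_decay (p u F a c C : R) (m : nat) : 1 < p -> p <= u -> 0 <= F <= 1 ->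
  1 <= a -> 1 <= c -> 0 <= C -> `|a - c| <= C / (ln u / ln p) ->
  F `^ a <= p `^ (m%:R * C) * F `^ c + u ^- m.
Proof.
move=> p1 pu /andP[F0 F1] a1 c1 C0 aC.
have u1 : 1 < u by exact: lt_le_trans pu.
have u0 : 0 < u by exact: lt_trans u1.
have p0 : 0 < p by exact: lt_trans p1.
have lnu : 0 < ln u by exact: ln_gt0.
have lnp : 0 < ln p by exact: ln_gt0.
have um0 : 0 < u ^- m by rewrite invr_gt0 exprn_gt0.
have [Fu|uF] := leP F (u ^- m).
  apply: (@le_trans _ _ F); last first.
    by rewrite (le_trans Fu)// lerDr mulr_ge0 ?powR_ge0.
  move: F0; rewrite le_eqVlt => /predU1P[<-|F0].
    by rewrite powR0// gt_eqF// (lt_le_trans _ a1).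
  by apply: ge1r_powR; rewrite ?F0.
have {}F0 : 0 < F by exact: lt_trans uF.
rewrite -[leLHS]addr0 lerD ?(ltW um0)//.
rewrite -[X in F `^ X](subrK c) powRD; last by rewrite (gt_eqF F0) implybT.
rewrite ler_wpM2r ?powR_ge0//.
apply: (@le_trans _ _ (F `^ (- `|a - c|))).
  by apply: ger_powR; rewrite ?F0// lerNl -normrN ler_norm.
apply: (@le_trans _ _ ((u ^- m) `^ (- `|a - c|))).
  rewrite !powRN lef_pV2 ?posrE ?powR_gt0//.
  by apply: ge0_ler_powR; rewrite ?nnegrE ?(ltW um0) ?(ltW F0)// ltW.
rewrite -powR_invn ?(ltW u0)// -powRrM mulrNN.
rewrite /powR !gt_eqF// ler_expR -!mulrA ler_wpM2l//.
have -> : C * ln p = C / (ln u / ln p) * ln u.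
  by rewrite invf_div -!mulrA mulVf ?mulr1// gt_eqF.
by rewrite ler_wpM2r// ltW.
Qed.

End real_inequalities.

Section log_holder.
Context (p : nat) (R : realType) (K : padicField p R) (n : nat).
Local Notation X := (padic_space K n).
Context (mu : {measure set X -> \bar R}).
Hypotheses (pp : prime p) (n1 : (1 <= n)%N) (haar : normalized_haar mu).
Local Notation V := (ball_volume p R n).

Let p1 : 1 < p%:R :> R. Proof. by rewrite ltr1n prime_gt1. Qed.

Lemma var_exponent_bounds (q : X -> R) : var_exponent mu q ->
  exists qm qM : R, [/\ ess_inf mu (EFin \o q) = qm%:E,
    ess_sup mu (EFin \o q) = qM%:E, 1 < qm & forall x, qm <= q x <= qM].
Proof.
move=> [_]; set qi := ess_inf _ _; set qs := ess_sup _ _ => i1 s1 b.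
have /andP[bi bs] := b 0.
have iE : qi = (fine qi)%:E.
  by rewrite fineK// fin_real// (lt_trans _ i1) ?ltNyr//= (le_lt_trans bi) ?ltry.
have sE : qs = (fine qs)%:E.
  by rewrite fineK// fin_real// s1 andbT (lt_le_trans _ bs) ?ltNyr.
exists (fine qi), (fine qs); split => //; first by rewrite -lte_fin -iE.
by move=> x; have := b x; rewrite iE sE !lee_fin.
Qed.

Lemma ae_mrestr (D : set X) (mD : measurable D) (P : X -> Prop) :
  {ae mrestr mu mD, forall x, P x} -> {ae mu, forall x, D x -> P x}.
Proof.
move=> [N [mN N0 NP]]; exists (N `&` D); split => //.
  exact: measurableI.
by move=> x /= /not_implyP[Dx Px]; split => //; exact: NP.
Qed.

(** The local condition, made pointwise: almost every point lies, for each of its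
    balls, between the essential bounds of the exponent on that ball, because up
    to equality there are only countably many balls. *)
Lemma log_holder_local (q : X -> R) (qm : R) : log_holder_exponent mu q ->
  (forall x, qm <= q x) ->
  exists2 L : R, 1 <= L & {ae mu, forall x, forall g : int, exists rho : R,
    [/\ qm <= rho, rho <= q x,
        {ae mu, forall y, padic_ball g x y -> rho <= q y} &
        V g `^ (rho - q x) <= L]}.
Proof.
move=> [vq [C C0 [Cloc _]]] qmq.
have [c cP] := padic_centers K n pp.
exists (p%:R `^ (n%:R * C)).
  by rewrite -[leLHS](powRr0 p%:R); apply: ler_powR; rewrite ?(ltW p1)// mulr_ge0// ltW.
have infP g a := ae_mrestr (ess_inf_le (mrestr mu (measurable_padic_ball g a)) (EFin \o q)).
have supP g a := ae_mrestr (ess_sup_ge (mrestr mu (measurable_padic_ball g a)) (EFin \o q)).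
pose G (g : int) i x := padic_ball g (c i) x ->
  (ball_ess_inf mu q g (c i) <= (q x)%:E <= ball_ess_sup mu q g (c i))%E.
have GP g i : {ae mu, forall x, G g i x}.
  apply: filterS2 (infP g (c i)) (supP g (c i)) => x xi xs xB.
  by apply/andP; split; [exact: xi|exact: xs].
have : {ae mu, forall x, forall k i : nat, G k%:Z i x /\ G (- k%:Z) i x}.
  by apply/ae_foralln => k; apply/ae_foralln => i; apply: filterS2 (GP k%:Z i) (GP (- k%:Z) i).
apply: filterS => x xG g.
have [i ix] := cP g x.
have Gx : G g i x.
  by case: g {ix} => k; [exact: (xG k i).1|rewrite NegzE; exact: (xG k.+1 i).2].
have /andP[xi xs] := Gx ix.
set q1 := ball_ess_inf mu q g (c i) in xi.
have qm1 : (qm%:E <= q1)%E.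
  by apply/ess_infP; apply: aeW => y; rewrite lee_fin.
have q1E : q1 = (fine q1)%:E.
  rewrite fineK// fin_real//; apply/andP; split.
    by apply: lt_le_trans qm1; rewrite ltNyr.
  by apply: le_lt_trans xi _; rewrite ltry.
exists (fine q1); split.
- by rewrite -lee_fin -q1E.
- by rewrite -lee_fin -q1E.
- apply: filterS (infP g (c i)) => y + xy; rewrite -/(ball_ess_inf mu q g (c i)) -/q1.
  rewrite q1E lee_fin; apply.
  by apply: padic_ball_trans ix xy.
have qx1 : fine q1 <= q x by rewrite -lee_fin -q1E.
rewrite /ball_volume -powRrM; apply: ler_powR; first exact: ltW.
rewrite -mulrA ler_wpM2l//.
have [g0|g0] := leP 0 g.
  rewrite (le_trans _ (ltW C0))// mulr_ge0_le0 ?ler0z// subr_le0//.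
rewrite -lee_fin; apply: le_trans (Cloc g (c i)).
rewrite EFinM leNgt lte_nmul2l ?lte_fin ?ltrz0// -leNgt -/q1 q1E EFinB.
by rewrite leeB.
Qed.

(** With l x the logarithm in the condition at infinity, any two of the intervals of
    centre q x and radius C / l x meet, so the supremum of their left ends lies in
    all of them; it serves as the value of q at infinity. Clipping it to the range of
    q keeps it in every interval, as the centres are in that range. *)
Lemma log_holder_infinity (q : X -> R) (qm qM : R) : log_holder_exponent mu q ->
  (forall x, qm <= q x <= qM) ->
  exists a C : R, [/\ qm <= a, a <= qM, 0 < C &
    forall x, `|q x - a| <= C / (ln (p%:R + padic_norm x) / ln p%:R)].
Proof.
move=> [vq [C C0 [_ Cinf]]] qb.
pose l (x : X) : R := ln (p%:R + padic_norm x) / ln p%:R.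
have lnp : 0 < ln p%:R :> R by exact: ln_gt0.
have l0 x : 0 < l x.
  rewrite divr_gt0// ln_gt0// (lt_le_trans p1)// lerDl padic_norm_ge0//.
have Cl0 x : 0 <= C / l x by rewrite divr_ge0// ltW.
have H x y : q x - C / l x <= q y + C / l y.
  have := Cinf x y; rewrite minEle; case: ifP => _; rewrite -/(l _) ler_norml => /andP[];
    by have := Cl0 x; have := Cl0 y; lra.
pose S := [set q x - C / l x | x in [set: X]].
have ubS y : ubound S (q y + C / l y) by move=> _ [x _ <-]; exact: H.
have S0 : S !=set0 by exists (q 0 - C / l 0); exists 0.
have supS : has_sup S by split => //; exists (q 0 + C / l 0); exact: ubS.
have a1 x : q x - C / l x <= sup S by apply: (sup_ubound (proj2 supS)); exists x.
have a2 x : sup S <= q x + C / l x by apply: ge_sup.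
exists (Num.max qm (Num.min qM (sup S))), C; split => //.
- by rewrite le_max lexx.
- by rewrite ge_max ge_min lexx andbT; have /andP[] := qb 0; exact: le_trans.
move=> x; rewrite -/(l x) ler_norml.
have /andP[mx xM] := qb x; have Sx := a1 x; have xS := a2 x; have Cx := Cl0 x.
case: (leP qM (sup S)) => ?; first by case: (leP qm qM) => ?; lra.
by case: (leP qm (sup S)) => ?; lra.
Qed.

Lemma measurable_padic_norm : measurable_fun [set: X] (@padic_norm p R K n).
Proof.
have p0 : 0 < p%:R :> R by exact: lt_trans p1.
rewrite (_ : @padic_norm _ _ _ _ = \- (\- @padic_norm p R K n)); last first.
  by apply/funext => x; rewrite /= opprK.
apply: measurable_funN; apply/measurable_EFinP; apply: measurable_superlevel => t.
apply: (padic_saturated_measurable pp) => x /=; rewrite lte_fin ltrNr => xt.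
have t0 : 0 < - t by exact: le_lt_trans (padic_norm_ge0 _) xt.
have [g _ gt] := exists_small_radius pp t0; exists g => y; rewrite /padic_ball /= => xy.
rewrite lte_fin ltrNr -(subrK x y) (le_lt_trans (padic_normD_max _ _))//.
by rewrite gt_max xt andbT (le_lt_trans xy).
Qed.

(** The integrand is at most p ^ (2 n) p ^ (- 2 n k) on the ball of radius p ^ k outside
    the next smaller one, and that ball has volume p ^ (n k); this leaves a geometric
    series. *)
Lemma decay_integrable : exists2 H : R, 0 <= H &
  (\int[mu]_x ((p%:R + padic_norm x) ^- (2 * n))%:E <= H%:E)%E.
Proof.
pose a : R := p%:R ^+ n.
have a1 : 1 < a by rewrite /a exprn_egt1// -lt0n.
have a0 : 0 < a by exact: lt_trans a1.
have a20 : 0 < a ^+ 2 by exact: exprn_gt0.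
pose s (k : nat) (x : X) : \bar R :=
  ((a ^+ 2) ^- k * \1_(padic_ball k%:Z (0 : X)) x)%:E.
have s0 k x : (0 <= s k x)%E.
  by rewrite lee_fin mulr_ge0// invr_ge0 !exprn_ge0// ltW.
have ms k : measurable_fun [set: X] (s k).
  apply/measurable_EFinP; apply: measurable_funM => //.
  by apply: measurable_indic; exact: measurable_padic_ball.
have dom x : (((p%:R + padic_norm x) ^- (2 * n))%:E <=
    (a ^+ 2)%:E * \sum_(k <oo) s k x)%E.
  have [k0 xk0] : exists k : nat, padic_norm x <= p%:R ^+ k.
    exists (Num.truncn (padic_norm x)).+1; set N := _.+1.
    rewrite (le_trans (ltW (truncnS_gt _)))// -/N -natrX ler_nat ltnW//.
    by rewrite ltn_expl// prime_gt1.
  have : exists k : nat, padic_norm x <= p%:R ^+ k by exists k0.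
  move=> /ex_minnP[k xk kmin].
  apply: (@le_trans _ _ ((a ^+ 2)%:E * s k x)%E); last first.
    by rewrite lee_pmul2l ?lte_fin//; exact: (nneseries_term_le (u := s ^~ x)).
  rewrite /s indicE mem_set ?mulr1; last by rewrite /padic_ball/= subr0.
  have u1 : 1 <= p%:R + padic_norm x.
    by rewrite (le_trans (ltW p1))// lerDl padic_norm_ge0.
  have u0 : 0 < p%:R + padic_norm x by rewrite (lt_le_trans _ u1).
  have ak0 : 0 < (a ^+ 2) ^+ k by exact: exprn_gt0 a20.
  have um0 : 0 < (p%:R + padic_norm x) ^+ (2 * n) by exact: exprn_gt0 u0.
  rewrite -EFinM lee_fin ler_pdivlMr// mulrC ler_pdivrMr//.
  have -> : (a ^+ 2) ^+ k = (p%:R ^+ k) ^+ (2 * n).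
    by rewrite /a -!exprM; congr (_ ^+ _); ring.
  have -> : a ^+ 2 * (p%:R + padic_norm x) ^+ (2 * n) =
      (p%:R * (p%:R + padic_norm x)) ^+ (2 * n).
    by rewrite exprMn /a -exprM [(n * 2)%N]mulnC.
  rewrite lerXn2r ?nnegrE ?mulr_ge0 ?exprn_ge0// ?(ltW u0)//.
  case: k xk kmin {ak0} => [|k] xk kmin; first by rewrite expr0 mulr_ege1// ltW.
  rewrite exprS ler_wpM2l// (@le_trans _ _ (padic_norm x)) ?lerDr//.
  by rewrite leNgt; apply/negP => /ltW /kmin; rewrite ltnn.
have geo N : \sum_(k < N) a ^- k <= a / (a - 1).
  rewrite ler_pdivlMr ?subr_gt0//.
  suff -> : (\sum_(k < N) a ^- k) * (a - 1) = a - a / a ^+ N.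
    by rewrite gerBl divr_ge0 ?exprn_ge0// ltW.
  elim: N => [|N ih]; first by rewrite big_ord0 mul0r expr0 divr1 subrr.
  rewrite big_ord_recr/= mulrDl ih exprS invfM mulrA mulfV ?gt_eqF//.
  by rewrite mul1r; ring.
exists (a ^+ 2 * (a / (a - 1))).
  by rewrite mulr_ge0 ?exprn_ge0 ?divr_ge0 ?subr_ge0 ?(ltW a0) ?(ltW a1).
have mS : measurable_fun [set: X] (fun x => \sum_(k <oo) s k x)%E.
  by apply: ge0_emeasurable_sum.
have md : measurable_fun [set: X] (fun x => (p%:R + padic_norm x) ^- (2 * n))%R.
  rewrite (_ : (fun x => _) =
      (fun x : X => (p%:R + padic_norm x) `^ (- (2 * n)%:R))); last first.
    by apply/funext => x; rewrite powR_invn// addr_ge0// padic_norm_ge0.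
  apply: (measurableT_comp (measurable_powR _)); apply: measurable_funD => //.
  exact: measurable_padic_norm.
apply: (@le_trans _ _ (\int[mu]_x ((a ^+ 2)%:E * \sum_(k <oo) s k x))%E).
  apply: ge0_le_integral => //.
  - by move=> x _; rewrite lee_fin invr_ge0 exprn_ge0// addr_ge0// padic_norm_ge0.
  - exact/measurable_EFinP.
  - exact: measurable_funeM.
rewrite ge0_integralZl_EFin ?(ltW a20)//; last first.
  by move=> x _; exact: nneseries_ge0.
rewrite integral_nneseries// (EFinM (a ^+ 2)) lee_pmul2l ?lte_fin//.
apply: lime_le.
  by apply: is_cvg_nneseries => k _ _; apply: integral_ge0.
apply: nearW => N; rewrite big_mkord.
rewrite (eq_bigr (fun k : 'I_N => (a ^- k)%:E)).
  by rewrite sumEFin lee_fin geo.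
move=> k _; rewrite (eq_integral (fun x => ((a ^+ 2) ^- k)%:E
    * (\1_(padic_ball k%:Z (0 : X)) x)%:E)%E)//.
have mB := measurable_padic_ball k%:Z (0 : X).
rewrite ge0_integralZl_EFin ?invr_ge0 ?exprn_ge0//; last first.
  by apply/measurable_EFinP; exact: measurable_indic.
rewrite integral_indic// setIT measure_ball_volume// -EFinM; congr EFin.
rewrite /ball_volume powRrM !powR_mulrn ?exprn_ge0// -/a exprAC expr2 invfM.
by rewrite mulfVK// gt_eqF// exprn_gt0.
Qed.
End log_holder.

(** * The modular inequality for the fractional maximal function *)

Section modular_inequality.
Context (p : nat) (R : realType) (K : padicField p R) (n : nat).
Local Notation X := (padic_space K n).
Context (mu : {measure set X -> \bar R}).
Hypotheses (pp : prime p) (n1 : (1 <= n)%N) (haar : normalized_haar mu).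
Local Notation V := (ball_volume p R n).
Context (s : R) (r q : X -> R) (rm rM : R).
Hypotheses (s0 : 0 <= s) (hr : log_holder_exponent mu r) (rm1 : 1 < rm)
  (rb : forall x, rm <= r x <= rM) (sM : rM * (s / n%:R) < 1)
  (mq : measurable_fun [set: X] q)
  (qr : forall x, (q x)^-1 = (r x)^-1 - s / n%:R).

Local Notation t := (s / n%:R).
Let qM := (rM^-1 - t)^-1.

Let t0 : 0 <= t. Proof. by rewrite divr_ge0. Qed.

Let mr : measurable_fun [set: X] r. Proof. by case: hr => -[]. Qed.

Let rM0 : 0 < rM.
Proof.
by have /andP[h1 h2] := rb 0; rewrite (lt_le_trans _ h2)// (lt_le_trans _ h1)// (lt_trans _ rm1).
Qed.

Let rmM : rm <= rM.
Proof. by have /andP[] := rb 0; exact: le_trans. Qed.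

Let rge x : rm <= r x. Proof. by case/andP: (rb x). Qed.
Let rle x : r x <= rM. Proof. by case/andP: (rb x). Qed.
Let r0 x : 0 < r x.
Proof. by rewrite (lt_le_trans _ (rge x))// (lt_trans _ rm1). Qed.

Let conj_gt0 a : 0 < a -> a <= rM -> 0 < a^-1 - t.
Proof.
move=> a0 aM; rewrite subr_gt0 -(ltr_pM2l a0) mulfV ?gt_eqF//.
by apply: le_lt_trans sM; rewrite ler_wpM2r.
Qed.

Let q0 x : 0 < q x.
Proof. by rewrite -invr_gt0 qr conj_gt0. Qed.

Let qM0 : 0 < qM. Proof. by rewrite invr_gt0 conj_gt0. Qed.

Let qle x : q x <= qM.
Proof.
rewrite -[leLHS]invrK lef_pV2 ?posrE ?invr_gt0 ?conj_gt0// qr lerD2r.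
by rewrite lef_pV2 ?posrE.
Qed.

Let rq x : r x <= q x.
Proof. by rewrite -lef_pV2 ?posrE// qr gerBl. Qed.

Let q1 x : 1 <= q x.
Proof. by rewrite (le_trans _ (rq x))// (le_trans _ (rge x))// ltW. Qed.

Let mpow (f : X -> R) (a : X -> R) : (forall x, 0 < a x) ->
  measurable_fun [set: X] f -> measurable_fun [set: X] a ->
  measurable_fun [set: X] (fun x => `|f x| `^ a x).
Proof.
move=> a0 mf ma; apply: measurable_powR_fun => //.
exact: measurableT_comp.
Qed.

Let mMax u (f : X -> R) (a : X -> R) : (forall x, 0 < a x) ->
  measurable_fun [set: X] a ->
  measurable_fun [set: X] (fun x => frac_maximal mu u f x `^ a x)%E.
Proof.
move=> a0 ma; apply: measurable_poweR_fun => //.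
- by move=> x; exact: frac_maximal_ge0.
- exact: measurable_frac_maximal.
Qed.

Let mean_le (f : X -> R) (C : R) g x : measurable_fun [set: X] f ->
  (\int[mu]_y `|f y|%:E <= C%:E)%E -> (ball_mean mu f g x <= (C / V g)%:E)%E.
Proof.
move=> mf fC; rewrite mulrC EFinM lee_pmul2l ?lte_fin ?invr_gt0 ?ball_volume_gt0//.
apply: le_trans fC; apply: ge0_subset_integral => //.
- exact: measurable_padic_ball.
- exact: measurable_norm_EFin.
Qed.

(** Where |f| is at least 1, its powers are monotone in the exponent, so the exponent
    may be frozen at its essential infimum on the ball. The exponent c is free
    because two values are used: c = 1 gives the a priori bound for Hedberg's
    inequality, and c > 1 gives a power to which the strong type inequality
    applies. *)
Let large_mean (f : X -> R) (c L rho : R) g x : measurable_fun [set: X] f ->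
  (forall y, f y = 0 \/ 1 <= `|f y|) -> (\int[mu]_y (`|f y| `^ r y)%:E <= 1)%E ->
  1 <= c -> c <= rm -> rm <= rho -> rho <= r x -> 1 <= L ->
  {ae mu, forall y, padic_ball g x y -> rho <= r y} ->
  V g `^ (rho - r x) <= L ->
  ball_mean mu f g x \is a fin_num /\
  (ball_mean mu f g x `^ r x <=
    (2 `^ rM * L)%:E * ball_mean mu (fun y => `|f y| `^ (r y / c))%R g x `^ c)%E.
Proof.
move=> mf f1 fr c1 crm rmrho rhor L1 arho VL.
have c0 : 0 < c by rewrite (lt_le_trans _ c1).
have rho0 : 0 < rho by rewrite (lt_le_trans _ rmrho)// (lt_trans _ rm1).
pose F y := `|f y| `^ (r y / c).
have mF : measurable_fun [set: X] F.
  apply: mpow => //; first by move=> y; rewrite divr_gt0.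
  exact: measurable_funM.
have F0 y : 0 <= F y by exact: powR_ge0.
have powmono y a b : 0 < a -> a <= b -> `|f y| `^ a <= `|f y| `^ b.
  move=> a0 ab; have [->|fy] := f1 y; last exact: ler_powR.
  by rewrite normr0 !powR0// gt_eqF// (lt_le_trans a0).
have rho_c : 1 <= rho / c by rewrite ler_pdivlMr// mul1r (le_trans crm).
have jen : (ball_mean mu f g x `^ (rho / c) <=
    (2 `^ (rho / c))%:E * ball_mean mu F g x)%E.
  apply: ball_mean_powR => //; apply: filterS arho => y + xy => /(_ xy) ry.
  by apply: powmono; rewrite ?divr_gt0// ler_pM2r ?invr_gt0.
have A1V : (ball_mean mu F g x <= (1 / V g)%:E)%E.
  apply: mean_le => //; apply: le_trans fr; apply: ge0_le_integral => //.
  - exact: measurable_norm_EFin.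
  - by apply/measurable_EFinP; exact: mpow.
  - move=> y _; rewrite lee_fin ger0_norm//; apply: powmono; first by rewrite divr_gt0.
    by rewrite ler_pdivrMr// ler_peMr// ltW.
have A1fin : ball_mean mu F g x \is a fin_num.
  by rewrite ge0_fin_numE ?ball_mean_ge0// (le_lt_trans A1V) ?ltry.
have Afin : ball_mean mu f g x \is a fin_num.
  rewrite ge0_fin_numE ?ball_mean_ge0//.
  apply: (@lty_poweRy _ _ (rho / c)); first by rewrite gt_eqF ?divr_gt0.
  by apply: le_lt_trans jen _; rewrite -(fineK A1fin) -EFinM ltry.
split => //; move: jen A1V; rewrite -/F -(fineK Afin) -(fineK A1fin).
rewrite !poweR_EFin -!EFinM !lee_fin div1r => jen A1V.
have A0 : 0 <= fine (ball_mean mu f g x) by rewrite fine_ge0// ball_mean_ge0.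
have A10 : 0 <= fine (ball_mean mu F g x) by rewrite fine_ge0// ball_mean_ge0.
have V0 : 0 < V g by exact: ball_volume_gt0.
apply: le_trans (powR_mean_local A0 A10 V0 c1 (le_trans crm rmrho) rhor jen A1V VL L1) _.
rewrite ler_wpM2r ?powR_ge0// ler_wpM2r ?(le_trans _ L1)//.
by apply: ler_powR; rewrite ?ler1n.
Qed.

(** Pointwise, M_s f ^ q is at most a constant times (M G) ^ r_- for
    G = |f| ^ (r / r_-), and the integral of G ^ r_- is the modular of f. *)
Lemma frac_maximal_modular_large : exists2 C : R, 0 < C &
  forall f : X -> R, measurable_fun [set: X] f -> (forall y, f y = 0 \/ 1 <= `|f y|) ->
  (\int[mu]_y (`|f y| `^ r y)%:E <= 1)%E ->
  (\int[mu]_x frac_maximal mu s f x `^ q x <= C%:E)%E.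
Proof.
have [L L1 loc] := log_holder_local pp hr rge.
have [C0 C00 strong] := maximal_strong_type pp haar rm1.
pose C2 := 2 `^ rM * L.
have C21 : 1 <= C2.
  by rewrite mulr_ege1// ltW// powR_gt1// ltr1n.
have C20 : 0 < C2 by rewrite (lt_le_trans _ C21).
pose C3 := C2 `^ (t * qM) * C2.
have C30 : 0 < C3 by rewrite mulr_gt0// powR_gt0.
exists (C3 * C0); first by rewrite mulr_gt0.
move=> f mf f1 fr; pose G y := `|f y| `^ (r y / rm).
have rm0 : 0 < rm by rewrite (lt_trans _ rm1).
have mG : measurable_fun [set: X] G.
  apply: mpow => //; first by move=> y; rewrite divr_gt0.
  exact: measurable_funM.
apply: (@le_trans _ _ (\int[mu]_x (C3%:E * frac_maximal mu 0 G x `^ rm))%E).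
  apply: ae_ge0_le_integral => //.
  - by move=> x _; exact: poweR_ge0.
  - exact: mMax.
  - by move=> x _; rewrite mule_ge0 ?poweR_ge0// lee_fin ltW.
  - by apply: measurable_funeM; exact: (@mMax 0 G (cst rm)).
  apply: filterS loc => x xloc _; apply: frac_maximal_powR_le => // g.
  have [rho [rmrho rhor arho VL]] := xloc g.
  have [Afin A1] := large_mean mf f1 fr (lexx 1) (ltW rm1) rmrho rhor L1 arho VL.
  have [_ Arm] := large_mean mf f1 fr (ltW rm1) (lexx rm) rmrho rhor L1 arho VL.
  have V0 : 0 < V g by exact: ball_volume_gt0.
  set A := ball_mean mu f g x in Afin A1 Arm *.
  have A0 : 0 <= fine A by rewrite fine_ge0// ball_mean_ge0.
  have AV : fine A `^ r x <= C2 / V g.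
    rewrite -lee_fin -poweR_EFin fineK// (le_trans A1)// poweRe1 ?ball_mean_ge0//.
    rewrite -/C2 (EFinM C2) lee_pmul2l ?lte_fin// -[X in (_ <= X%:E)%E]div1r.
    apply: mean_le.
      by apply: mpow => //; [move=> y; rewrite divr1|under eq_fun do rewrite divr1].
    under eq_integral do rewrite ger0_norm ?powR_ge0// divr1.
    exact: fr.
  have H := powR_hedberg A0 V0 (r0 x) (q0 x) t0 (qr x) C20 AV.
  rewrite -(fineK Afin) -EFinM poweR_EFin.
  apply: (@le_trans _ _ ((C2 `^ (t * qM))%:E * A `^ r x)%E).
    rewrite -{2}(fineK Afin) poweR_EFin -EFinM lee_fin (le_trans H)//.
    by rewrite ler_wpM2r ?powR_ge0//; apply: ler_powR => //; rewrite ler_wpM2l.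
  rewrite EFinM -muleA lee_pmul2l ?lte_fin ?powR_gt0// (le_trans Arm)//.
  rewrite lee_pmul2l ?lte_fin//; apply: ge0_le_poweR; first exact: ltW.
    exact: ball_mean_ge0.
  exact: ball_mean_le_maximal.
rewrite ge0_integralZl_EFin ?(ltW C30)//; last 2 first.
- by move=> x _; exact: poweR_ge0.
- exact: (@mMax 0 G (cst rm)).
rewrite (EFinM C3) lee_pmul2l ?lte_fin// (le_trans (strong _ mG))//.
rewrite -[leRHS]mule1; apply: lee_wpmul2l; first by rewrite lee_fin ltW.
apply: le_trans fr.
rewrite le_eqVlt; apply/orP; left; apply/eqP; apply: eq_integral => y _.
by rewrite ger0_norm ?powR_ge0// -powRrM divfK// gt_eqF.
Qed.

(** Below 1 the exponents are compared with their values a and d at infinity, at the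
    cost of an integrable error: once to see that f is in L^a, and once to
    return from (M_s f) ^ d to (M_s f) ^ q. In between everything has constant
    exponent. *)
Lemma frac_maximal_modular_small : exists2 C : R, 0 < C &
  forall f : X -> R, measurable_fun [set: X] f -> (forall y, `|f y| <= 1) ->
  (\int[mu]_y (`|f y| `^ r y)%:E <= 1)%E ->
  (\int[mu]_x frac_maximal mu s f x `^ q x <= C%:E)%E.
Proof.
have [a [Cd [rma aM Cd0 decay]]] := log_holder_infinity pp hr rb.
have [H H0 He] := decay_integrable pp n1 haar.
have p1 : 1 < p%:R :> R by rewrite ltr1n prime_gt1.
have a1 : 1 < a by exact: lt_le_trans rma.
have a0 : 0 < a by exact: lt_trans a1.
have [C0 C00 strong] := maximal_strong_type pp haar a1.
pose d := (a^-1 - t)^-1.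
have d0 : 0 < d by rewrite invr_gt0 conj_gt0.
have ad : a <= d.
  by rewrite -[leLHS]invrK lef_pV2 ?posrE ?invr_gt0 ?conj_gt0// gerBl.
pose m := (2 * n)%N.
pose u (x : X) : R := p%:R + padic_norm x.
have pu x : p%:R <= u x by rewrite lerDl padic_norm_ge0.
have u0 x : 0 < u x by rewrite (lt_le_trans _ (pu x))// (lt_trans _ p1).
have e0 x : 0 < u x ^- m by rewrite invr_gt0 exprn_gt0.
have l0 x : 0 < ln (u x) / ln p%:R.
  by rewrite divr_gt0// ln_gt0// (lt_le_trans p1).
have me : measurable_fun [set: X] (fun x => (u x ^- m)%:E).
  apply/measurable_EFinP.
  rewrite (_ : (fun x => _) = (fun x => u x `^ (- m%:R))); last first.
    by apply/funext => x; rewrite powR_invn// ltW.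
  apply: (measurableT_comp (measurable_powR _)); apply: measurable_funD => //.
  exact: measurable_padic_norm.
pose Cq := qM * d * Cd.
have Cq0 : 0 < Cq by rewrite !mulr_gt0.
have qdecay x : `|q x - d| <= Cq / (ln (u x) / ln p%:R).
  have -> : q x - d = q x * d * ((r x - a) / (a * r x)).
    rewrite -[q x in LHS]invrK qr /d -[q x in RHS]invrK qr.
    have ra0 := conj_gt0 a0 aM; have rr0 := conj_gt0 (r0 x) (rle x).
    have -> : (r x - a) / (a * r x) = (a^-1 - t) - ((r x)^-1 - t).
      rewrite opprB addrA subrK; move: (r x) (r0 x) => w w0.
      by field; rewrite !gt_eqF.
    move: (a^-1 - t) ((r x)^-1 - t) ra0 rr0 => v w v0 w0.
    by field; rewrite !gt_eqF.
  rewrite normrM ger0_norm ?mulr_ge0 ?(ltW (q0 x)) ?(ltW d0)//.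
  rewrite /Cq -(mulrA (qM * d)); apply: ler_pM => //.
  - by rewrite mulr_ge0 ?(ltW (q0 x)) ?(ltW d0).
  - by rewrite ler_wpM2r ?(ltW d0).
  apply: le_trans (decay x); rewrite normrM ler_piMr// ger0_norm; last first.
    by rewrite invr_ge0 mulr_ge0 ?(ltW (r0 x)) ?(ltW a0).
  rewrite invf_le1 ?mulr_gt0// mulr_ege1 ?(ltW a1)//.
  by rewrite (le_trans (ltW rm1)).
pose C4 := p%:R `^ (m%:R * Cd) + H.
have C40 : 0 < C4 by rewrite ltr_pwDl// powR_gt0// (lt_trans _ p1).
pose C5 := (2 `^ a * C4) `^ (t * d).
have C50 : 0 < C5 by rewrite powR_gt0// mulr_gt0// powR_gt0.
pose D := Num.max 1 (C5 `^ d^-1).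
have D1 : 1 <= D by rewrite le_max lexx.
have D0 : 0 < D by rewrite (lt_le_trans _ D1).
pose P := p%:R `^ (m%:R * Cq) : R.
have P0 : 0 < P by rewrite powR_gt0// (lt_trans _ p1).
exists (D `^ qM * (P * C5) * (C0 * C4) + D `^ qM * H).
  rewrite ltr_pwDl//; last by rewrite mulr_ge0 ?powR_ge0.
  by rewrite !mulr_gt0// powR_gt0.
move=> f mf f1 fr.
have fa : (\int[mu]_y (`|f y| `^ a)%:E <= C4%:E)%E.
  apply: (@le_trans _ _ (\int[mu]_y ((p%:R `^ (m%:R * Cd))%:E * (`|f y| `^ r y)%:E
      + (u y ^- m)%:E))%E).
    apply: ge0_le_integral => //.
    - by apply/measurable_EFinP; exact: (@mpow f (cst a)).
    - apply: emeasurable_funD => //; apply: measurable_funeM.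
      by apply/measurable_EFinP; exact: mpow.
    move=> y _; rewrite -EFinM -EFinD lee_fin; apply: powR_decay => //.
    - by rewrite normr_ge0 f1.
    - exact: ltW.
    - by rewrite (le_trans (ltW rm1)).
    - exact: ltW.
    - by rewrite distrC; exact: decay.
  have mfr : measurable_fun [set: X] (fun y => (`|f y| `^ r y)%:E).
    by apply/measurable_EFinP; exact: mpow.
  rewrite ge0_integralD//; last 2 first.
  - exact: measurable_funeM.
  - by move=> y _; rewrite lee_fin ltW.
  rewrite EFinD leeD// ge0_integralZl_EFin ?powR_ge0//.
  by rewrite -[leRHS]mule1 lee_pmul2l ?lte_fin ?powR_gt0// (lt_trans _ p1).
have mfa : measurable_fun [set: X] (fun y => `|f y| `^ a) by exact: (@mpow f (cst a)).
have hedberg x : (frac_maximal mu s f x `^ d <= C5%:E * frac_maximal mu 0 f x `^ a)%E.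
  apply: frac_maximal_powR_le => // g.
  have jen : (ball_mean mu f g x `^ a <= (2 `^ a)%:E * (C4 / V g)%:E)%E.
    apply: (@le_trans _ _ ((2 `^ a)%:E * ball_mean mu (fun y => `|f y| `^ a)%R g x)%E).
      by apply: ball_mean_powR => //; [exact: ltW|apply: aeW].
    rewrite lee_pmul2l ?lte_fin ?powR_gt0//; apply: mean_le => //.
    by under eq_integral do rewrite ger0_norm ?powR_ge0//.
  have Afin : ball_mean mu f g x \is a fin_num.
    rewrite ge0_fin_numE ?ball_mean_ge0//.
    apply: (@lty_poweRy _ _ a); first by rewrite gt_eqF.
    by apply: le_lt_trans jen _; rewrite -EFinM ltry.
  have A0 : 0 <= fine (ball_mean mu f g x) by rewrite fine_ge0// ball_mean_ge0.
  have V0 : 0 < V g by exact: ball_volume_gt0.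
  have AV : fine (ball_mean mu f g x) `^ a <= 2 `^ a * C4 / V g.
    by rewrite -lee_fin -poweR_EFin fineK// -mulrA EFinM.
  have dE : d^-1 = a^-1 - t by rewrite invrK.
  have C24 : 0 < 2 `^ a * C4 by rewrite mulr_gt0// powR_gt0.
  have hed := powR_hedberg A0 V0 a0 d0 t0 dE C24 AV.
  apply: (@le_trans _ _ (C5%:E * ball_mean mu f g x `^ a)%E).
    by rewrite -(fineK Afin) -EFinM !poweR_EFin -EFinM lee_fin.
  rewrite lee_pmul2l ?lte_fin//; apply: ge0_le_poweR; first exact: ltW.
    exact: ball_mean_ge0.
  exact: ball_mean_le_maximal.
have Mf1 x : (frac_maximal mu 0 f x <= 1)%E.
  apply: maximal_le => // g; rewrite -(ball_mean_cst pp haar g x ler01).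
  by apply: le_ball_mean => //; apply: aeW => y _; rewrite normr1 f1.
have MD x : (frac_maximal mu s f x <= D%:E)%E.
  rewrite -[leLHS](poweRK d0) ?frac_maximal_ge0//.
  apply: (@le_trans _ _ (C5%:E `^ d^-1)%E); last first.
    by rewrite poweR_EFin lee_fin le_max lexx orbT.
  apply: ge0_le_poweR; [by rewrite invr_ge0 ltW|exact: poweR_ge0|].
  rewrite (le_trans (hedberg x))// -[leRHS]mule1 lee_pmul2l ?lte_fin//.
  rewrite -(poweR1r a); apply: ge0_le_poweR => //; first exact: ltW.
  exact: frac_maximal_ge0.
apply: (@le_trans _ _ (\int[mu]_x ((D `^ qM * (P * C5))%:E * frac_maximal mu 0 f x `^ a
    + (D `^ qM)%:E * (u x ^- m)%:E))%E).
  have mMa : measurable_fun [set: X] (fun x => frac_maximal mu 0 f x `^ a)%E.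
    exact: (@mMax 0 f (cst a)).
  apply: ge0_le_integral => //.
  - by move=> x _; exact: poweR_ge0.
  - exact: mMax.
  - by apply: emeasurable_funD; exact: measurable_funeM.
  move=> x _.
  have Mfin : frac_maximal mu s f x \is a fin_num.
    by rewrite ge0_fin_numE ?frac_maximal_ge0// (le_lt_trans (MD x)) ?ltry.
  have := hedberg x; have := MD x; have := frac_maximal_ge0 pp haar s f x.
  rewrite -(fineK Mfin); set y := fine _; rewrite !poweR_EFin !lee_fin => y0 yD yd.
  apply: (@le_trans _ _ ((D `^ qM * P)%:E * (y `^ d)%:E + (D `^ qM)%:E * (u x ^- m)%:E)%E).
    rewrite -!EFinM -EFinD lee_fin -mulrA -mulrDr.
    (* The comparison of exponents requires a base at most 1, hence the division by
       the uniform bound D of M_s f. *)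
    have {1}-> : y = D * (y / D) by rewrite mulrC divfK// gt_eqF.
    rewrite powRM ?divr_ge0 ?(ltW D0)//; apply: ler_pM; rewrite ?powR_ge0//.
      exact: ler_powR.
    apply: le_trans (powR_decay (C := Cq) (c := d) (u := u x) m p1 _ _ _ _ _ _) _ => //.
    - by rewrite divr_ge0 ?(ltW D0)//= ler_pdivrMr// mul1r.
    - by rewrite (le_trans _ ad)// ltW.
    - exact: ltW.
    rewrite lerD2r ler_wpM2l ?powR_ge0//; apply: ge0_ler_powR; first exact: ltW.
    + by rewrite nnegrE divr_ge0// ltW.
    + by rewrite nnegrE.
    + by rewrite ler_pdivrMr// ler_peMr.
  rewrite leeD2r// (mulrA _ P) (EFinM _ C5) -muleA lee_pmul2l// lte_fin.
  by rewrite mulr_gt0// powR_gt0.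
have mMa : measurable_fun [set: X] (fun x => frac_maximal mu 0 f x `^ a)%E.
  exact: (@mMax 0 f (cst a)).
have DP0 : 0 < D `^ qM * (P * C5) by rewrite !mulr_gt0// powR_gt0.
rewrite ge0_integralD//; last 4 first.
- by move=> x _; rewrite mule_ge0 ?poweR_ge0// lee_fin ltW.
- exact: measurable_funeM.
- by move=> x _; rewrite -EFinM lee_fin mulr_ge0 ?powR_ge0// ltW.
- exact: measurable_funeM.
rewrite EFinD leeD//.
  rewrite ge0_integralZl_EFin ?(ltW DP0)//; last first.
    by move=> x _; exact: poweR_ge0.
  rewrite (EFinM _ (C0 * C4)) lee_pmul2l ?lte_fin// (le_trans (strong _ mf))//.
  by rewrite EFinM lee_pmul2l ?lte_fin.
rewrite ge0_integralZl_EFin ?powR_ge0//; last first.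
  by move=> x _; rewrite lee_fin ltW.
by rewrite EFinM lee_pmul2l ?lte_fin ?powR_gt0.
Qed.

Lemma frac_maximal_modular : exists2 C : R, 1 <= C &
  forall f : X -> R, measurable_fun [set: X] f -> (\int[mu]_y (`|f y| `^ r y)%:E <= 1)%E ->
  (\int[mu]_x frac_maximal mu s f x `^ q x <= C%:E)%E.
Proof.
have [C1 C10 large] := frac_maximal_modular_large.
have [C2 C20 small] := frac_maximal_modular_small.
exists (Num.max 1 (2 `^ qM * (C1 + C2))); first by rewrite le_max lexx.
move=> f mf fr; pose A := [set x | 1 <= `|f x|].
have mA : measurable A.
  rewrite -[A]setTI; apply: (@measurable_fun_ler _ _ _ _ (cst 1) (Num.norm \o f)) => //.
  exact: measurableT_comp.
pose f1 x := f x * \1_A x; pose f2 x := f x * \1_(~` A) x.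
have mf1 : measurable_fun [set: X] f1.
  by apply: measurable_funM => //; exact: measurable_indic.
have mf2 : measurable_fun [set: X] f2.
  by apply: measurable_funM => //; apply: measurable_indic; exact: measurableC.
have modle (h : X -> R) : measurable_fun [set: X] h -> (forall x, `|h x| <= `|f x|) ->
    (\int[mu]_y (`|h y| `^ r y)%:E <= 1)%E.
  move=> mh hf; apply: le_trans fr; apply: ge0_le_integral => //.
  - by apply/measurable_EFinP; exact: mpow.
  - by apply/measurable_EFinP; exact: mpow.
  - by move=> y _; rewrite lee_fin; apply: ge0_ler_powR; rewrite ?nnegrE// ltW.
have indle (B : set X) x : `|f x * \1_B x| <= `|f x|.
  by rewrite normrM ler_piMr// indicE normr_nat; case: (_ \in _).
have I1 := large _ mf1 _ (modle _ mf1 (indle A)).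
have I2 := small _ mf2 _ (modle _ mf2 (indle (~` A))).
have {}I1 : (\int[mu]_x frac_maximal mu s f1 x `^ q x <= C1%:E)%E.
  apply: I1 => y; rewrite /f1 indicE; have [yA|yA] := boolP (y \in A).
    by right; rewrite mulr1; rewrite inE in yA.
  by left; rewrite mulr0.
have {}I2 : (\int[mu]_x frac_maximal mu s f2 x `^ q x <= C2%:E)%E.
  apply: I2 => y; rewrite /f2 indicE in_setC; have [yA|yA] := boolP (y \in A).
    by rewrite mulr0 normr0.
  rewrite mulr1; rewrite notin_setE in yA.
  by rewrite leNgt; apply/negP => /ltW.
apply: (@le_trans _ _ (\int[mu]_x ((2 `^ qM)%:E *
    (frac_maximal mu s f1 x `^ q x + frac_maximal mu s f2 x `^ q x)))%E).
  apply: ge0_le_integral => //.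
  - by move=> x _; exact: poweR_ge0.
  - exact: mMax.
  - by apply: measurable_funeM; apply: emeasurable_funD; exact: mMax.
  move=> x _; apply: (@le_trans _ _ ((frac_maximal mu s f1 x + frac_maximal mu s f2 x) `^ q x)%E).
    apply: ge0_le_poweR; [exact: ltW|exact: frac_maximal_ge0|].
    apply: frac_maximal_le => // g.
    apply: (@le_trans _ _ ((V g `^ t)%:E *
        (ball_mean mu (Num.norm \o f1) g x + ball_mean mu (Num.norm \o f2) g x))%E).
      rewrite lee_pmul2l ?lte_fin ?powR_gt0 ?ltr0n ?prime_gt0//.
      have mn1 : measurable_fun [set: X] (Num.norm \o f1) by exact: measurableT_comp.
      have mn2 : measurable_fun [set: X] (Num.norm \o f2) by exact: measurableT_comp.
      have n10 (y : X) : 0 <= (Num.norm \o f1) y by exact: normr_ge0.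
      have n20 (y : X) : 0 <= (Num.norm \o f2) y by exact: normr_ge0.
      rewrite -(ball_meanD mu g x mn1 mn2 n10 n20); apply: le_ball_mean => //.
        exact: measurable_funD.
      apply: aeW => y _; rewrite /= [leRHS]ger0_norm ?addr_ge0// /f1 /f2 !indicE in_setC.
      by case: (y \in A); rewrite mulr1 mulr0 normr0 ?addr0 ?add0r.
    rewrite ge0_muleDr ?ball_mean_ge0//.
    have nn (h : X -> R) : ball_mean mu (Num.norm \o h) g x = ball_mean mu h g x.
      by rewrite /ball_mean; under eq_integral do rewrite /= normr_id.
    by rewrite !nn leeD// frac_maximal_ge.
  apply: le_trans (poweRD_le (q1 x) _ _) _; rewrite ?frac_maximal_ge0//.
  rewrite lee_pmul ?lee_fin ?powR_ge0 ?adde_ge0 ?poweR_ge0//.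
  by apply: ler_powR; rewrite ?ler1n.
rewrite ge0_integralZl_EFin ?powR_ge0//; last 2 first.
- by move=> x _; rewrite adde_ge0 ?poweR_ge0.
- by apply: emeasurable_funD; exact: mMax.
rewrite ge0_integralD//; last 4 first.
- by move=> x _; exact: poweR_ge0.
- exact: mMax.
- by move=> x _; exact: poweR_ge0.
- exact: mMax.
apply: (@le_trans _ _ (2 `^ qM * (C1 + C2))%:E); last by rewrite lee_fin le_max lexx orbT.
by rewrite EFinM lee_pmul2l ?lte_fin ?powR_gt0// EFinD leeD.
Qed.

End modular_inequality.

(** * Variable exponent norms *)

Section variable_norms.
Context (p : nat) (R : realType) (K : padicField p R) (n : nat).
Local Notation X := (padic_space K n).
Context (mu : {measure set X -> \bar R}).
Implicit Types (q : X -> R) (F : X -> \bar R) (f : X -> R).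

Lemma var_Lnorm_le q F eta : 0 < eta -> (var_modular mu q F eta <= 1)%E ->
  (var_Lnorm mu q F <= eta%:E)%E.
Proof. by move=> eta0 Feta; apply: ereal_inf_lbound; exists eta. Qed.

Lemma var_Lnorm_ge q F c : (forall eta : R, 0 < eta ->
    (var_modular mu q F eta <= 1)%E -> (c <= eta%:E)%E) ->
  (c <= var_Lnorm mu q F)%E.
Proof. by move=> cP; apply: le_ereal_inf_tmp => _ [eta [eta0 Feta] <-]; exact: cP. Qed.

Lemma var_Lnorm_ge0 q F : (0 <= var_Lnorm mu q F)%E.
Proof. by apply: var_Lnorm_ge => eta eta0 _; rewrite lee_fin ltW. Qed.

Lemma var_modular_EFin q f eta : 0 < eta -> var_modular mu q (EFin \o f) eta =
  (\int[mu]_x (`|eta^-1 * f x| `^ q x)%:E)%E.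
Proof.
move=> eta0; apply: eq_integral => x _ /=.
rewrite inver gt_eqF// -EFinM poweR_EFin normrM mulrC.
by rewrite (ger0_norm (x := eta^-1))// invr_ge0 ltW.
Qed.

(** The modulars are integrals while the norms are not, so inequalities between
    norms are obtained from modulars, with the constant moved into eta. *)
Lemma var_Lnorm_le_scale q r (F G : X -> \bar R) (C : R) : 0 < C ->
  (forall eta : R, 0 < eta -> (var_modular mu r G eta <= 1)%E ->
    (var_modular mu q F (C * eta) <= 1)%E) ->
  (var_Lnorm mu q F <= C%:E * var_Lnorm mu r G)%E.
Proof.
move=> C0 FG; rewrite -lee_pdivrMl//; apply: var_Lnorm_ge => eta eta0 Geta.
rewrite lee_pdivrMl// -EFinM; apply: var_Lnorm_le; first exact: mulr_gt0.
exact: FG.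
Qed.

Lemma poweR_divl_le (c q : R) (x : \bar R) : 1 <= c -> 1 <= q -> (0 <= x)%E ->
  ((c^-1%:E * x) `^ q <= c^-1%:E * x `^ q)%E.
Proof.
move=> c1 q1 x0.
have c0 : 0 < c by rewrite (lt_le_trans _ c1).
rewrite poweRM// ?lee_fin ?invr_ge0 ?(ltW c0)//.
apply: lee_wpmul2r; first exact: poweR_ge0.
rewrite poweR_EFin lee_fin; apply: ge1r_powR => //.
by rewrite invr_gt0 c0 invf_le1.
Qed.

Lemma measurable_modular q F eta : (forall x, 0 < q x) -> 0 < eta ->
  measurable_fun [set: X] F -> measurable_fun [set: X] q ->
  measurable_fun [set: X] (fun x => (`|F x| / eta%:E) `^ q x)%E.
Proof.
move=> q0 eta0 mF mq; apply: measurable_poweR_fun => //.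
  by move=> x; rewrite mule_ge0// inve_ge0 lee_fin ltW.
apply: emeasurable_funM => //.
exact: measurableT_comp.
Qed.

End variable_norms.

(** * Boundedness of the commutator *)

Section commutator_bound.
Context (p : nat) (R : realType) (K : padicField p R) (n : nat).
Local Notation X := (padic_space K n).
Context (mu : {measure set X -> \bar R}).
Hypotheses (pp : prime p) (n1 : (1 <= n)%N) (haar : normalized_haar mu).
Local Notation V := (ball_volume p R n).

Let p0 : 0 < p%:R :> R. Proof. by rewrite ltr0n prime_gt0. Qed.

Lemma ball_volume_powR (g : int) (beta : R) :
  V g `^ (beta / n%:R) = (p%:R ^ g) `^ beta.
Proof.
rewrite -(powR_intmul g (ltW p0)) /ball_volume -!powRrM; congr (_ `^ _).
by rewrite [LHS]mulrC mulrA divfK ?pnatr_eq0 -?lt0n// mulrC.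
Qed.

Lemma ball_mean_norm (f : X -> R) g x :
  ball_mean mu (fun y => `|f y|) g x = ball_mean mu f g x.
Proof. by rewrite /ball_mean; under eq_integral do rewrite normr_id. Qed.

Lemma frac_maximalZ_le (s c : R) (f : X -> R) x : measurable_fun [set: X] f ->
  (frac_maximal mu s (fun y => c * f y)%R x <= `|c|%:E * frac_maximal mu s f x)%E.
Proof.
move=> mf; apply: frac_maximal_le => // g; rewrite ball_meanZ// muleCA.
by apply: lee_wpmul2l; rewrite ?lee_fin// frac_maximal_ge.
Qed.

(** The factor V ^ (s / n) is at most 1 on small balls and at most V ^ (u / n) on large
    ones. This makes M_alpha f finite almost everywhere for f in L^r(.), since M_0 f
    and M_(alpha + beta) f have finite modulars. *)
Lemma frac_maximal_le_max (s u : R) (f : X -> R) x : 0 <= s -> s <= u ->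
  (frac_maximal mu s f x <= maxe (frac_maximal mu 0 f x) (frac_maximal mu u f x))%E.
Proof.
move=> s0 su; apply: frac_maximal_le => // g.
have V0 : 0 < V g by exact: ball_volume_gt0.
have n0 : 0 < n%:R :> R by rewrite ltr0n.
have [V1|/ltW V1] := leP (V g) 1.
  rewrite le_max; apply/orP; left.
  apply: le_trans (ball_mean_le_maximal pp haar f x g).
  rewrite -[leRHS]mul1e; apply: lee_wpmul2r; first exact: ball_mean_ge0.
  rewrite lee_fin -[leRHS](powRr0 (V g)); apply: ger_powR; rewrite ?V0//.
  by rewrite divr_ge0// ltW.
rewrite le_max; apply/orP; right; apply: le_trans (frac_maximal_ge pp haar u f x g).
apply: lee_wpmul2r; first exact: ball_mean_ge0.
by rewrite lee_fin; apply: ler_powR => //; rewrite ler_pM2r// invr_gt0.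
Qed.

Lemma ae_lty_of_modular (F : X -> \bar R) (q : X -> R) (C : R) :
  (forall x, (0 <= F x)%E) -> (forall x, 0 < q x) ->
  measurable_fun [set: X] F -> measurable_fun [set: X] q ->
  (\int[mu]_x F x `^ q x <= C%:E)%E -> {ae mu, forall x, (F x < +oo)%E}.
Proof.
move=> F0 q0 mF mq FC.
have iF : mu.-integrable [set: X] (fun x => F x `^ q x)%E.
  apply/integrableP; split; first exact: measurable_poweR_fun.
  under eq_integral do rewrite gee0_abs ?poweR_ge0//.
  by rewrite (le_lt_trans FC) ?ltry.
apply: filterS (integrable_ae measurableT iF) => x /(_ Logic.I).
rewrite ge0_fin_numE ?poweR_ge0//; apply: lty_poweRy.
by rewrite gt_eqF.
Qed.

(** Multiplying by a nonnegative Lipschitz function almost commutes with the mean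
    over a ball, up to the oscillation of the function on that ball. *)
Lemma commutator_le (alpha beta L : R) (b b0 f : X -> R) x :
  0 < beta -> 0 < L ->
  measurable_fun [set: X] b -> measurable_fun [set: X] f ->
  {ae mu, forall y, b y = b0 y} -> b x = b0 x -> 0 <= b x ->
  (forall y z, `|b0 y - b0 z| <= L * padic_norm (y - z) `^ beta) ->
  (frac_maximal mu alpha f x < +oo)%E ->
  (`|commutator mu b alpha f x| <= L%:E * frac_maximal mu (alpha + beta) f x)%E.
Proof.
move=> beta0 L0 mb mf bb0 bx bx0 lip Afin; rewrite /commutator.
have S0 := frac_maximal_ge0 pp haar (alpha + beta) f x.
have A0 := frac_maximal_ge0 pp haar alpha f x.
have B0 := frac_maximal_ge0 pp haar alpha (b \* f) x.
have [Soo|Sfin] := eqVneq (frac_maximal mu (alpha + beta) f x) +oo%E.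
  by rewrite Soo gt0_muley ?lte_fin// leey.
have {Afin}Af : frac_maximal mu alpha f x \is a fin_num by rewrite ge0_fin_numE.
have {Sfin}Sf : frac_maximal mu (alpha + beta) f x \is a fin_num.
  by rewrite ge0_fin_numE// ltey.
set A := frac_maximal mu alpha f x in A0 Af *.
set S := frac_maximal mu (alpha + beta) f x in S0 Sf *.
set B := frac_maximal mu alpha (b \* f) x in B0 *.
have Vab g : V g `^ ((alpha + beta) / n%:R) = V g `^ (alpha / n%:R) * (p%:R ^ g) `^ beta.
  rewrite -ball_volume_powR -powRD ?mulrDl//.
  by rewrite (gt_eqF (ball_volume_gt0 _ _ pp g)) implybT.
have oscb g : {ae mu, forall y, padic_ball g x y ->
    `|b y - b x| <= L * (p%:R ^ g) `^ beta}.
  apply: filterS bb0 => y yb xy; rewrite yb bx (le_trans (lip _ _))//.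
  rewrite ler_wpM2l ?(ltW L0)//; apply: ge0_ler_powR; rewrite ?nnegrE ?(ltW beta0)//.
    exact: padic_norm_ge0.
  by rewrite exprz_ge0// ltW.
have mbf : measurable_fun [set: X] (b \* f)%R by exact: measurable_funM.
have mnf : measurable_fun [set: X] (fun y => `|f y|) by exact: measurableT_comp.
have upper : (B <= (b x)%:E * A + L%:E * S)%E.
  apply: frac_maximal_le => // g.
  have k0 : 0 <= b x + L * (p%:R ^ g) `^ beta.
    by rewrite addr_ge0// mulr_ge0 ?powR_ge0// ltW.
  apply: (@le_trans _ _ ((V g `^ (alpha / n%:R))%:E *
      ((b x + L * (p%:R ^ g) `^ beta)%:E * ball_mean mu f g x))%E).
    apply: lee_wpmul2l; first by rewrite lee_fin powR_ge0.
    rewrite -[X in (X%:E * _)%E](ger0_norm k0) -ball_meanZ//; apply: le_ball_mean => //.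
      exact: measurable_funM.
    apply: filterS (oscb g) => y + xy => /(_ xy) yb.
    rewrite !normrM ler_wpM2r// (ger0_norm k0).
    rewrite -[X in `|X|](subrK (b x)) (le_trans (ler_normD _ _))// addrC.
    by rewrite lerD// ger0_norm.
  rewrite EFinD ge0_muleDl ?lee_fin ?mulr_ge0 ?powR_ge0 ?(ltW L0)//.
  have mean0 : (0 <= ball_mean mu f g x)%E by exact: ball_mean_ge0.
  have k10 : (0 <= (L * (p%:R ^ g) `^ beta)%:E)%E.
    by rewrite lee_fin mulr_ge0 ?powR_ge0// ltW.
  rewrite ge0_muleDr; [|exact: mule_ge0|exact: mule_ge0].
  apply: leeD.
    by rewrite muleCA; apply: lee_wpmul2l; rewrite ?lee_fin// frac_maximal_ge.
  rewrite EFinM -muleA muleCA (muleA (V g `^ _)%:E) -EFinM -Vab.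
  by apply: lee_wpmul2l; rewrite ?lee_fin ?(ltW L0)// frac_maximal_ge.
have Bf : B \is a fin_num.
  rewrite ge0_fin_numE// (le_lt_trans upper)//.
  by rewrite -(fineK Af) -(fineK Sf) -!EFinM -EFinD ltry.
have lower : ((b x)%:E * A <= B + L%:E * S)%E.
  have [->|bn0] := eqVneq (b x) 0.
    by rewrite mul0e adde_ge0// mule_ge0// lee_fin ltW.
  have {bn0}bpos : 0 < b x by rewrite lt_neqAle eq_sym bn0.
  rewrite -lee_pdivlMl//; apply: frac_maximal_le => // g; rewrite lee_pdivlMl//.
  have k0 : 0 <= L * (p%:R ^ g) `^ beta by rewrite mulr_ge0 ?powR_ge0// ltW.
  rewrite muleCA; apply: (@le_trans _ _ ((V g `^ (alpha / n%:R))%:E *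
      (ball_mean mu (b \* f)%R g x + (L * (p%:R ^ g) `^ beta)%:E * ball_mean mu f g x))%E).
    apply: lee_wpmul2l; first by rewrite lee_fin powR_ge0.
    rewrite -[X in (X%:E * _ <= _)%E](ger0_norm (ltW bpos)) -ball_meanZ//.
    rewrite -[X in (_ <= _ + X%:E * _)%E](ger0_norm k0) -(ball_mean_norm f).
    rewrite -(ball_mean_norm (b \* f)) -ball_meanZ// -ball_meanD//; last 3 first.
    - exact: measurableT_comp.
    - exact: measurable_funM.
    - by move=> y; rewrite mulr_ge0.
    apply: le_ball_mean => //; first exact: measurable_funM.
      by apply: measurable_funD; [exact: measurableT_comp|exact: measurable_funM].
    apply: filterS (oscb g) => y + xy => /(_ xy) yb.
    rewrite [leRHS]ger0_norm; last by rewrite addr_ge0// mulr_ge0.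
    rewrite /= !normrM -mulrDl ler_wpM2r//.
    rewrite -[X in `|X| <= _](subrK (b y)) (le_trans (ler_normD _ _))// addrC.
    by rewrite lerD2l distrC.
  have mean0 : (0 <= ball_mean mu f g x)%E by exact: ball_mean_ge0.
  rewrite ge0_muleDr ?ball_mean_ge0//; last exact: mule_ge0.
  apply: leeD; first exact: frac_maximal_ge.
  rewrite EFinM -muleA muleCA (muleA (V g `^ _)%:E) -EFinM -Vab.
  by apply: lee_wpmul2l; rewrite ?lee_fin ?(ltW L0)// frac_maximal_ge.
move: upper lower; rewrite -(fineK Af) -(fineK Sf) -(fineK Bf).
rewrite -!EFinM -!EFinD !lee_fin => upper lower.
by rewrite ler_norml lerNl opprB !lerBlDl upper lower.
Qed.

End commutator_bound.

Section commutator_theorems.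
Context (p : nat) (R : realType) (K : padicField p R) (n : nat).
Local Notation X := (padic_space K n).
Context (mu : {measure set X -> \bar R}) (alpha beta : R).
Hypotheses (pp : prime p) (n1 : (1 <= n)%N) (haar : normalized_haar mu)
  (beta0 : 0 < beta) (alpha0 : 0 < alpha) (abn : alpha + beta < n%:R).
Local Notation V := (ball_volume p R n).

Let n0 : 0 < n%:R :> R. Proof. by rewrite ltr0n. Qed.
Let ab0 : 0 < alpha + beta. Proof. exact: addr_gt0. Qed.
Let V0 g : 0 < V g. Proof. exact: ball_volume_gt0. Qed.

Lemma exponent_pair_bounds (r q : X -> R) : exponent_pair mu alpha beta r q ->
  exists rm rM : R, [/\ 1 < rm, forall x, rm <= r x <= rM &
    rM * ((alpha + beta) / n%:R) < 1].
Proof.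
move=> [_ _ vr rs _]; have [rm [rM [_ rME rm1 rb]]] := var_exponent_bounds vr.
exists rm, rM; split => //; move: rs; rewrite rME lte_fin.
by rewrite ltr_pdivlMr// mulrA ltr_pdivrMr// mul1r.
Qed.

Lemma lipschitz_seminorm_lty (f : X -> R) :
  (lipschitz_seminorm beta f < +oo)%E <-> exists2 L : R, 0 < L &
    forall x y, `|f x - f y| <= L * padic_norm (x - y) `^ beta.
Proof.
have norm_gt0 (x y : X) : x <> y -> 0 < padic_norm (x - y).
  move=> xy; rewrite lt_neqAle padic_norm_ge0 andbT eq_sym; apply/eqP.
  by move=> /padic_norm0_eq0/eqP; rewrite subr_eq0 => /eqP.
split=> [fin|[L L0 lip]]; last first.
  apply: (@le_lt_trans _ _ L%:E); last by rewrite ltry.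
  apply: ge_ereal_sup => _ [[x y] /= xy <-]; rewrite lee_fin.
  by rewrite ler_pdivrMr ?powR_gt0 ?norm_gt0.
pose L := Num.max 1 (fine (lipschitz_seminorm beta f)).
exists L; first by rewrite lt_max ltr01.
move=> x y; have [->|/eqP xy] := eqVneq x y.
  by rewrite subrr normr0 mulr_ge0 ?powR_ge0// le_max ler01.
rewrite -ler_pdivrMr ?powR_gt0 ?norm_gt0// /L le_max; apply/orP; right.
have H : ((`|f x - f y| / padic_norm (x - y) `^ beta)%:E <= lipschitz_seminorm beta f)%E.
  by apply: ereal_sup_ubound; exists (x, y).
rewrite -lee_fin fineK// fin_real// fin andbT.
by rewrite (lt_le_trans _ H) ?ltNyr.
Qed.

Lemma measurable_commutator (b f : X -> R) : measurable_fun [set: X] b ->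
  measurable_fun [set: X] (commutator mu b alpha f).
Proof.
move=> mb; apply: emeasurable_funB; last exact: measurable_frac_maximal.
by apply: emeasurable_funM; [exact/measurable_EFinP|exact: measurable_frac_maximal].
Qed.

Lemma commutator_bounded (b : X -> R) (r q : X -> R) :
  measurable_fun [set: X] b ->
  lipschitz_space mu beta b -> {ae mu, forall x, 0 <= b x} ->
  exponent_pair mu alpha beta r q -> var_bounded mu r q (commutator mu b alpha).
Proof.
move=> mb [b0 [bb0 mb0 /lipschitz_seminorm_lty[L L0 lip]]] b_ge0 rq.
have [rm [rM [rm1 rb rMs]]] := exponent_pair_bounds rq.
have [hr hq vr _ qr] := rq.
have mr : measurable_fun [set: X] r by case: vr.
have mq : measurable_fun [set: X] q by case: hq => -[].
have [C C1 CP] := frac_maximal_modular pp n1 haar (ltW ab0) hr rm1 rb rMs mq qr.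
have r0 x : 0 < r x.
  by case/andP: (rb x) => + _; apply: lt_le_trans; exact: lt_trans rm1.
have [qm [qM [_ _ qm1 qb]]] := var_exponent_bounds (proj1 hq).
have q1 x : 1 <= q x by case/andP: (qb x) => + _; apply: le_trans; exact: ltW.
have q0 x : 0 < q x by rewrite (lt_le_trans _ (q1 x)).
have rM1 : rM * (0 / n%:R) < 1 by rewrite mul0r mulr0.
have rr x : (r x)^-1 = (r x)^-1 - 0 / n%:R by rewrite mul0r subr0.
have [C' _ CP'] := frac_maximal_modular pp n1 haar (lexx 0) hr rm1 rb rM1 mr rr.
have C0 : 0 < C by rewrite (lt_le_trans _ C1).
exists (L * C) => f [mf _].
apply: var_Lnorm_le_scale; first exact: mulr_gt0.
move=> eta eta0; rewrite var_modular_EFin// => fr.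
pose h x := eta^-1 * f x.
have mh : measurable_fun [set: X] h by exact: measurable_funM.
have fE : f = (fun x => eta * h x).
  by apply/funext => x; rewrite /h mulrA mulfV ?gt_eqF// mul1r.
have MsC := CP _ mh fr; have M0C := CP' _ mh fr.
have Mle u x : (frac_maximal mu u f x <= eta%:E * frac_maximal mu u h x)%E.
  rewrite {1}fE; apply: le_trans (frac_maximalZ_le pp haar u eta x mh) _.
  by rewrite ger0_norm// ltW.
have mM u : measurable_fun [set: X] (frac_maximal mu u h) by exact: measurable_frac_maximal.
have M0fin : {ae mu, forall x, (frac_maximal mu 0 h x < +oo)%E}.
  by apply: (ae_lty_of_modular _ r0 _ _ M0C) => // x; exact: frac_maximal_ge0.
have Msfin : {ae mu, forall x, (frac_maximal mu (alpha + beta) h x < +oo)%E}.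
  by apply: (ae_lty_of_modular _ q0 _ _ MsC) => // x; exact: frac_maximal_ge0.
have Tle : {ae mu, forall x, (`|commutator mu b alpha f x| <=
    (L * eta)%:E * frac_maximal mu (alpha + beta) h x)%E}.
  have cle := fun x => @commutator_le _ _ K n mu pp n1 haar alpha beta L b b0 f x
    beta0 L0 mb mf bb0.
  apply: filterS3 bb0 b_ge0 (filterI M0fin Msfin) => x bx bx0 [M0x Msx].
  apply: le_trans (cle x bx bx0 lip _) _.
    apply: le_lt_trans (Mle _ _) _; apply: lte_mul_pinfty; rewrite ?lee_fin ?(ltW eta0)//.
    apply: le_lt_trans (frac_maximal_le_max pp n1 haar h x (u := alpha + beta) (ltW alpha0) _) _.
      by rewrite lerDl ltW.
    by rewrite gt_max M0x.
  by rewrite EFinM -muleA; apply: lee_wpmul2l; rewrite ?lee_fin ?(ltW L0).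
apply: (@le_trans _ _ (\int[mu]_x (C^-1%:E * frac_maximal mu (alpha + beta) h x `^ q x))%E).
  apply: ae_ge0_le_integral => //.
  - by move=> x _; exact: poweR_ge0.
  - apply: measurable_modular => //; first by rewrite !mulr_gt0.
    exact: measurable_commutator.
  - by move=> x _; rewrite mule_ge0 ?poweR_ge0// lee_fin invr_ge0 ltW.
  - apply: measurable_funeM; apply: measurable_poweR_fun => //.
    by move=> x; exact: frac_maximal_ge0.
  apply: filterS Tle => x Tx _.
  apply: le_trans (poweR_divl_le C1 (q1 x) (frac_maximal_ge0 pp haar _ _ _)).
  apply: ge0_le_poweR; first exact: ltW.
    by rewrite mule_ge0// inve_ge0 lee_fin !mulr_ge0// ltW.
  rewrite inver gt_eqF ?mulr_gt0// lee_pdivrMr ?mulr_gt0//.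
  apply: le_trans Tx _; rewrite muleAC -EFinM.
  by rewrite (_ : C^-1 * (L * C * eta) = L * eta)//; field; rewrite gt_eqF.
rewrite ge0_integralZl_EFin ?invr_ge0 ?(ltW C0)//; last 2 first.
- by move=> x _; exact: poweR_ge0.
- by apply: measurable_poweR_fun => // x; exact: frac_maximal_ge0.
by rewrite lee_pdivrMl// mule1.
Qed.

Lemma var_modular_indic (q : X -> R) (g : int) x eta : (forall y, 0 < q y) -> 0 < eta ->
  var_modular mu q (fun y => (\1_(padic_ball g x) y)%:E) eta =
  (\int[mu]_(y in padic_ball g x) (eta^-1 `^ q y)%:E)%E.
Proof.
move=> q0 eta0; rewrite [RHS]integral_mkcond; apply: eq_integral => y _.
rewrite inver gt_eqF// -EFinM poweR_EFin /patch indicE.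
by case: ifP => _; rewrite ?normr1 ?mul1r// normr0 mul0r powR0// gt_eqF.
Qed.

Lemma var_Lnorm_indic (q : X -> R) (g : int) x : measurable_fun [set: X] q ->
  (forall y, 1 <= q y) ->
  exists2 N : R, 0 < N & var_Lnorm mu q (fun y => (\1_(padic_ball g x) y)%:E) = N%:E.
Proof.
move=> mq q1; have q0 y : 0 < q y by rewrite (lt_le_trans _ (q1 y)).
pose F : X -> \bar R := fun y => (\1_(padic_ball g x) y)%:E; rewrite -/F.
have mB := measurable_padic_ball g x.
have mpow c : 0 <= c -> measurable_fun (padic_ball g x) (fun y => (c `^ q y)%:E).
  move=> c0; apply/measurable_EFinP; apply: measurable_funTS.
  exact: (measurable_powR_fun (f := cst c)).
have int_cst c : (\int[mu]_(y in padic_ball g x) c%:E = (c * V g)%:E)%E.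
  by rewrite integral_cst// measure_ball_volume.
have lower : ((Num.min 1 (V g))%:E <= var_Lnorm mu q F)%E.
  apply: var_Lnorm_ge => eta eta0; rewrite var_modular_indic// => H.
  rewrite lee_fin ge_min; have [//|eta1] := leP 1 eta; rewrite /=.
  rewrite -[leRHS]mul1r -ler_pdivrMr// mulrC -lee_fin -int_cst; apply: le_trans H.
  apply: ge0_le_integral => //.
  - by move=> y _; rewrite lee_fin invr_ge0 ltW.
  - by apply: mpow; rewrite invr_ge0 ltW.
  move=> y _; rewrite lee_fin; apply: le1r_powR => //.
  by rewrite invf_ge1// ltW.
have upper : (var_Lnorm mu q F <= (Num.max 1 (V g))%:E)%E.
  have m1 : 1 <= Num.max 1 (V g) by rewrite le_max lexx.
  have m0 : 0 < Num.max 1 (V g) by rewrite (lt_le_trans _ m1).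
  apply: var_Lnorm_le => //; rewrite var_modular_indic//.
  apply: (@le_trans _ _ (\int[mu]_(y in padic_ball g x) (Num.max 1 (V g))^-1%:E)%E).
    apply: ge0_le_integral => //.
    - by move=> y _; rewrite lee_fin powR_ge0.
    - by apply: mpow; rewrite invr_ge0 ltW.
    by move=> y _; rewrite lee_fin; apply: ge1r_powR => //; rewrite invr_gt0 m0 invf_le1.
  by rewrite int_cst lee_fin mulrC ler_pdivrMr// mul1r le_max lexx orbT.
have fin : var_Lnorm mu q F \is a fin_num.
  by rewrite ge0_fin_numE ?var_Lnorm_ge0// (le_lt_trans upper) ?ltry.
exists (fine (var_Lnorm mu q F)); last by rewrite fineK.
by rewrite -lte_fin fineK// (lt_le_trans _ lower)// lte_fin lt_min ltr01 V0.
Qed.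

(** Hoelder's inequality with the constant exponent n / (alpha + beta), in the form
    of Young's inequality under the modular. *)
Lemma var_Lnorm_indic_le (r q : X -> R) (g : int) x :
  measurable_fun [set: X] r -> measurable_fun [set: X] q ->
  (forall y, 1 <= r y) -> (forall y, 0 < q y) ->
  (forall y, (q y)^-1 = (r y)^-1 - (alpha + beta) / n%:R) ->
  (var_Lnorm mu r (fun y => (\1_(padic_ball g x) y)%:E) <=
   (2 * V g `^ ((alpha + beta) / n%:R))%:E *
   var_Lnorm mu q (fun y => (\1_(padic_ball g x) y)%:E))%E.
Proof.
move=> mr mq r1 q0 qr; have r0 y : 0 < r y by rewrite (lt_le_trans _ (r1 y)).
set t := (alpha + beta) / n%:R in qr *.
have t0 : 0 < t by rewrite divr_gt0.
have mB := measurable_padic_ball g x.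
have Vt0 : 0 < V g `^ t by rewrite powR_gt0.
have mpow (a : X -> R) c : (forall y, 0 < a y) -> measurable_fun [set: X] a ->
    0 <= c -> measurable_fun (padic_ball g x) (fun y => (c `^ a y)%:E).
  move=> a0 ma c0; apply/measurable_EFinP; apply: measurable_funTS.
  exact: (measurable_powR_fun (f := cst c)).
apply: var_Lnorm_le_scale; first exact: mulr_gt0.
move=> eta eta0; have e20 : 0 < 2 * V g `^ t * eta by rewrite !mulr_gt0.
rewrite (var_modular_indic g x q0 eta0) (var_modular_indic g x r0 e20) => H.
have eV0 : 0 < eta^-1 by rewrite invr_gt0.
apply: (@le_trans _ _ (\int[mu]_(y in padic_ball g x)
    (2^-1%:E * ((eta^-1 `^ q y)%:E + (V g)^-1%:E)))%E).
  apply: ge0_le_integral => //.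
  - by move=> y _; rewrite lee_fin powR_ge0.
  - by apply: mpow => //; rewrite invr_ge0 !mulr_ge0// ltW.
  - apply: measurable_funeM; apply: emeasurable_funD => //.
    by apply: mpow => //; exact: ltW.
  move=> y _; rewrite -EFinD -EFinM lee_fin.
  have -> : (2 * V g `^ t * eta)^-1 = 2^-1 * ((V g `^ t)^-1 * eta^-1).
    by rewrite -mulrA !invfM mulrCA.
  rewrite powRM ?mulr_ge0 ?invr_ge0 ?(ltW Vt0) ?(ltW eta0)//.
  apply: ler_pM; rewrite ?powR_ge0//.
    by apply: ge1r_powR => //; rewrite invr_gt0 ltr0n/= invf_le1// ler1n.
  (* With u = eta^-q and v = |B|^-1 the product is u^a v^(1-a) for a = r / q, hence at
     most u + v; integrated over B, this is at most 1 + 1. *)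
  have rq : r y / q y = 1 - r y * t by rewrite qr mulrBr mulfV ?gt_eqF.
  have rt0 : 0 < r y * t by exact: mulr_gt0.
  have -> : ((V g `^ t)^-1 * eta^-1) `^ r y =
      (eta^-1 `^ q y) `^ (r y / q y) * (V g)^-1 `^ (r y * t).
    have -> : (eta^-1 `^ q y) `^ (r y / q y) = eta^-1 `^ r y.
      by rewrite -powRrM; congr (_ `^ _); rewrite mulrA mulrAC mulfV ?mul1r// gt_eqF.
    have -> : (V g)^-1 `^ (r y * t) = (V g `^ t)^-1 `^ r y.
      rewrite -powRN -(powR_inv1 (ltW (V0 g))) -!powRrM; congr (_ `^ _).
      by rewrite mulN1r mulNr [t * _]mulrC.
    by rewrite [LHS]powRM ?invr_ge0 ?(ltW Vt0) ?(ltW eta0)// [LHS]mulrC.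
  have a0 : 0 <= r y / q y by rewrite divr_ge0 ?(ltW (r0 y)) ?(ltW (q0 y)).
  have u0 : 0 < eta^-1 `^ q y by rewrite powR_gt0.
  have v0 : 0 < (V g)^-1 by rewrite invr_gt0.
  move: (eta^-1 `^ q y) (V g)^-1 u0 v0 => u v u0 v0.
  set w := u + v; have w0 : 0 < w by exact: addr_gt0.
  apply: (@le_trans _ _ (w `^ (r y / q y) * w `^ (r y * t))).
    apply: ler_pM; rewrite ?powR_ge0//; apply: ge0_ler_powR => //.
    - by rewrite nnegrE ltW.
    - by rewrite nnegrE ltW.
    - by rewrite lerDl ltW.
    - exact: ltW.
    - by rewrite nnegrE ltW.
    - by rewrite nnegrE ltW.
    - by rewrite lerDr ltW.
  rewrite -powRD; last by rewrite (gt_eqF w0) implybT.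
  by rewrite rq subrK powRr1// ltW.
have mq' : measurable_fun (padic_ball g x) (fun y => (eta^-1 `^ q y)%:E).
  by apply: mpow => //; exact: ltW.
rewrite ge0_integralZl_EFin//; last 2 first.
- by move=> y _; rewrite -EFinD lee_fin addr_ge0 ?powR_ge0// invr_ge0 ltW.
- exact: emeasurable_funD.
rewrite ge0_integralD//; last 2 first.
- by move=> y _; rewrite lee_fin powR_ge0.
- by move=> y _; rewrite lee_fin invr_ge0 ltW.
have -> : (\int[mu]_(y in padic_ball g x) (V g)^-1%:E = 1)%E.
  have /= -> := integral_cst mu mB (V g)^-1%:E.
  by rewrite measure_ball_volume// -EFinM mulVf ?gt_eqF.
by rewrite lee_pdivrMl// mule1 (_ : 2%:E = 1 + 1)%E ?leeD2r// -EFinD.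
Qed.

End commutator_theorems.

(** * The commutator on characteristic functions of balls *)

Section oscillation_of_bounded.
Context (p : nat) (R : realType) (K : padicField p R) (n : nat).
Local Notation X := (padic_space K n).
Context (mu : {measure set X -> \bar R}) (alpha beta : R).
Hypotheses (pp : prime p) (n1 : (1 <= n)%N) (haar : normalized_haar mu)
  (beta0 : 0 < beta) (alpha0 : 0 < alpha) (abn : alpha + beta < n%:R).
Local Notation V := (ball_volume p R n).

Let p0 : 0 < p%:R :> R. Proof. by rewrite ltr0n prime_gt0. Qed.
Let p1 : 1 < p%:R :> R. Proof. by rewrite ltr1n prime_gt1. Qed.
Let n0 : 0 < n%:R :> R. Proof. by rewrite ltr0n. Qed.
Let V0 g : 0 < V g. Proof. exact: ball_volume_gt0. Qed.

Lemma le_ball_volume g h : g <= h -> V g <= V h.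
Proof.
move=> gh; apply: ler_powR; first exact: ltW.
by rewrite ler_wpM2l// ler_int.
Qed.

Lemma frac_maximal_in_ge (B : set X) (s : R) (f : X -> R) x g :
  padic_ball g x `<=` B ->
  ((V g `^ (s / n%:R))%:E * ball_mean mu f g x <= frac_maximal_in mu B s f x)%E.
Proof. by move=> gB; rewrite -(frac_meanE pp haar); apply: ereal_sup_ubound; exists g. Qed.

Lemma frac_maximal_in_le (B : set X) (s : R) (f : X -> R) x c :
  (forall g, padic_ball g x `<=` B ->
    (V g `^ (s / n%:R))%:E * ball_mean mu f g x <= c)%E ->
  (frac_maximal_in mu B s f x <= c)%E.
Proof.
by move=> fc; apply: ge_ereal_sup => _ [g gB <-]; rewrite (frac_meanE pp haar); exact: fc.
Qed.

(** Balls larger than B only see the mass that f has in B, and their normalizing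
    factor is smaller because alpha < n. *)
Lemma frac_maximal_indic (f : X -> R) g x y : measurable_fun [set: X] f ->
  padic_ball g x y ->
  frac_maximal mu alpha (fun z => f z * \1_(padic_ball g x) z) y =
  frac_maximal_in mu (padic_ball g x) alpha f y.
Proof.
move=> mf xy; have mB := measurable_padic_ball g x.
have BE : padic_ball g y = padic_ball g x by exact: padic_ball_eq.
pose u z := f z * \1_(padic_ball g x) z.
have uE h : padic_ball h y `<=` padic_ball g x ->
    ball_mean mu u h y = ball_mean mu f h y.
  move=> hB; rewrite /ball_mean; congr (_ * _)%E; apply: eq_integral => z.
  by rewrite inE => yz; rewrite /u indicE mem_set ?mulr1//; exact: hB.
apply/eqP; rewrite eq_le; apply/andP; split; last first.
  apply: frac_maximal_in_le => h hB; rewrite -uE//.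
  exact: frac_maximal_ge.
apply: frac_maximal_le => // h.
have [hg|/ltW gh] := leP h g.
  have hB : padic_ball h y `<=` padic_ball g x.
    by rewrite -BE; exact: subset_padic_ball.
  by rewrite uE//; exact: frac_maximal_in_ge.
have gB : padic_ball g y `<=` padic_ball g x by rewrite BE.
apply: le_trans (frac_maximal_in_ge alpha f gB).
have meanE k (v : X -> R) : ((V k `^ (alpha / n%:R))%:E * ball_mean mu v k y =
    (V k `^ (alpha / n%:R - 1))%:E * \int[mu]_(z in padic_ball k y) `|v z|%:E)%E.
  rewrite /ball_mean muleA -EFinM; congr (_%:E * _)%E.
  by rewrite powRB ?powRr1 ?(ltW (V0 k))// (gt_eqF (V0 k)) implybT.
rewrite [leLHS](meanE h) [leRHS](meanE g); apply: lee_pmul.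
- by rewrite lee_fin powR_ge0.
- by apply: integral_ge0 => z _; rewrite lee_fin.
- have an : alpha / n%:R - 1 < 0.
    by rewrite subr_lt0 ltr_pdivrMr// mul1r (lt_trans _ abn)// ltrDl.
  rewrite lee_fin -(opprK (alpha / n%:R - 1)) (powRN (V h)) (powRN (V g)).
  rewrite lef_pV2 ?posrE; [|exact: powR_gt0|exact: powR_gt0].
  apply: ge0_ler_powR; rewrite ?nnegrE ?oppr_ge0 ?(ltW an) ?(ltW (V0 _))//.
  exact: le_ball_volume.
- rewrite BE [leLHS]integral_mkcond [leRHS]integral_mkcond.
  apply: ge0_le_integral => //.
  + by move=> z _; rewrite /patch; case: ifP => // _; rewrite lee_fin.
  + apply/(measurable_restrictT _ _).1; first exact: measurable_padic_ball.
    apply: measurable_norm_EFin; exact: measurable_funM.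
  + apply/(measurable_restrictT _ _).1 => //.
    exact: measurable_norm_EFin.
  move=> z _; rewrite /patch indicE; case: (z \in padic_ball g x).
    by rewrite mulr1; case: ifP => //; rewrite lee_fin.
  by rewrite mulr0 normr0; case: ifP.
Qed.

Lemma frac_maximal_indic1 g x y : padic_ball g x y ->
  frac_maximal mu alpha (\1_(padic_ball g x)) y = (V g `^ (alpha / n%:R))%:E.
Proof.
move=> xy; have an0 : 0 <= alpha / n%:R by rewrite divr_ge0 ?(ltW n0) ?(ltW alpha0).
rewrite (_ : \1_(padic_ball g x) = fun z => cst 1 z * \1_(padic_ball g x) z); last first.
  by apply/funext => z; rewrite mul1r.
rewrite frac_maximal_indic//; apply/eqP; rewrite eq_le; apply/andP; split.
  apply: frac_maximal_in_le => h hB; rewrite ball_mean_cst// mule1 lee_fin.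
  apply: ge0_ler_powR; rewrite ?nnegrE ?(ltW (V0 _))//.
  rewrite -lee_fin -!(measure_ball_volume pp haar _ x).
  rewrite [X in (X <= _)%E](_ : _ = mu (padic_ball h y)); last first.
    by rewrite !measure_ball_volume.
  by apply: le_measure => //; rewrite inE; exact: measurable_padic_ball.
have gB : padic_ball g y `<=` padic_ball g x by rewrite (padic_ball_eq xy).
by apply: le_trans (frac_maximal_in_ge _ _ gB); rewrite ball_mean_cst// mule1.
Qed.

(** The identity holds with infinite values too: if M_(alpha,B) b is +oo at y, both
    sides are -oo. *)
Lemma commutator_indic (b : X -> R) g x y : measurable_fun [set: X] b ->
  let B := padic_ball g x in
  (((b y)%:E - mu B `^ (- (alpha / n%:R)) * frac_maximal_in mu B alpha b y) * (\1_B y)%:E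
   = (V g `^ (- (alpha / n%:R)))%:E * commutator mu b alpha (\1_B) y * (\1_B y)%:E)%E.
Proof.
move=> mb B; rewrite indicE; have [yB|_] := boolP (y \in B); last by rewrite !mule0.
rewrite !mule1 /commutator measure_ball_volume// poweR_EFin.
rewrite inE in yB; rewrite frac_maximal_indic1// frac_maximal_indic//.
set v := V g `^ _; set w := V g `^ _.
have vw : v * w = 1 by rewrite /v powRN mulVf// gt_eqF// powR_gt0.
have v0 : 0 < v by rewrite powR_gt0.
case: (frac_maximal_in mu B alpha b y) => [m| |].
- have H : b y - v * m = v * (b y * w - m) by rewrite mulrBr mulrCA vw mulr1.
  exact: (congr1 EFin H).
- by rewrite -EFinM/= !gt0_muley ?lte_fin// gt0_muleNy ?lte_fin.
- by rewrite -EFinM/= gt0_muleNy ?lte_fin// gt0_muley ?lte_fin.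
Qed.

(** The powers of |B| cancel: |B|^(-alpha/n) from [commutator_indic] and
    |B|^((alpha+beta)/n) from [var_Lnorm_indic_le] against |B|^(-beta/n) in the
    supremum. *)
Lemma maximal_oscillation_lty (b r q : X -> R) : measurable_fun [set: X] b ->
  exponent_pair mu alpha beta r q -> var_bounded mu r q (commutator mu b alpha) ->
  (maximal_oscillation mu alpha beta q b < +oo)%E.
Proof.
move=> mb rq [C bounded].
have [rm [rM [rm1 rb rMs]]] := exponent_pair_bounds n1 beta0 alpha0 rq.
have [hr hq vr _ qr] := rq.
have mr : measurable_fun [set: X] r by case: vr.
have mq : measurable_fun [set: X] q by case: hq => -[].
have r1 x : 1 <= r x by case/andP: (rb x) => + _; apply: le_trans; exact: ltW.
have r0 x : 0 < r x by rewrite (lt_le_trans _ (r1 x)).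
have [qm [qM [_ _ qm1 qb]]] := var_exponent_bounds (proj1 hq).
have q1 x : 1 <= q x by case/andP: (qb x) => + _; apply: le_trans; exact: ltW.
have q0 x : 0 < q x by rewrite (lt_le_trans _ (q1 x)).
apply: (@le_lt_trans _ _ (`|C| * 2)%:E); last by rewrite ltry.
apply: ge_ereal_sup => _ [[g x] _ <-] /=.
have mB := measurable_padic_ball g x; set B := padic_ball g x in mB *.
have [N N0 NE] := var_Lnorm_indic pp haar g x mq q1.
rewrite -/B in NE; rewrite NE.
pose T := commutator mu b alpha (\1_B).
pose F y := ((V g `^ (- (alpha / n%:R)))%:E * T y * (\1_B y)%:E)%E.
have -> : (fun y => ((b y)%:E - mu B `^ (- (alpha / n%:R)) * frac_maximal_in mu B alpha b y)
    * (\1_B y)%:E)%E = F by apply/funext => y; exact: commutator_indic.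
have mT : measurable_fun [set: X] T by exact: measurable_commutator.
have mi : measurable_fun [set: X] (fun y => (\1_B y)%:E : \bar R).
  by apply/measurable_EFinP; exact: measurable_indic.
have mF : measurable_fun [set: X] F.
  by apply: emeasurable_funM => //; exact: measurable_funeM.
pose v := V g `^ (- (alpha / n%:R)); have v0 : 0 < v by rewrite powR_gt0.
have FT : (var_Lnorm mu q F <= v%:E * var_Lnorm mu q T)%E.
  apply: var_Lnorm_le_scale => // eta eta0; apply: le_trans.
  have ve0 : 0 < v * eta by exact: mulr_gt0.
  apply: ge0_le_integral => //.
  - by move=> y _; exact: poweR_ge0.
  - exact: measurable_modular.
  - exact: measurable_modular.
  move=> y _; apply: ge0_le_poweR; first exact: ltW.
    by rewrite mule_ge0// inve_ge0 lee_fin ltW.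
  rewrite !inver !gt_eqF//= lee_pdivrMr// -muleA -EFinM mulrCA mulVf ?gt_eqF// mulr1.
  rewrite /F !abseM -/v (gee0_abs (x := v%:E)) ?lee_fin ?(ltW v0)//.
  rewrite [leRHS]muleC -[leRHS]mule1; apply: lee_wpmul2l.
    by rewrite mule_ge0// lee_fin ltW.
  by rewrite indicE; case: (y \in B); rewrite ?abse1// abse0 lee_fin.
have chiL : var_Lspace mu r (\1_B).
  split; first exact: measurable_indic.
  exists 1 => //; rewrite (var_modular_indic mu g x r0)//.
  rewrite (eq_integral (cst 1%:E)); last by move=> y _; rewrite invr1 powR1.
  by rewrite integral_cst//= mul1e measure_ball_volume// ltry.
have chi := var_Lnorm_indic_le pp n1 haar beta0 alpha0 g x mr mq r1 q0 qr.
rewrite -/B NE in chi.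
have TC := bounded _ chiL.
set t := (alpha + beta) / n%:R in chi.
have FN : (var_Lnorm mu q F <= (v * (`|C| * (2 * V g `^ t * N)))%:E)%E.
  apply: le_trans FT _; rewrite (EFinM v); apply: lee_wpmul2l; first by rewrite lee_fin ltW.
  apply: le_trans TC _; apply: (@le_trans _ _ (`|C|%:E * var_Lnorm mu r (EFin \o \1_B))%E).
    by apply: lee_wpmul2r; [exact: var_Lnorm_ge0|rewrite lee_fin ler_norm].
  by rewrite (EFinM `|C|); apply: lee_wpmul2l => //; rewrite EFinM.
rewrite measure_ball_volume// poweR_EFin inver gt_eqF ?powR_gt0// mul1e.
rewrite inver gt_eqF//; set w := V g `^ (beta / n%:R).
have w0 : 0 < w by rewrite powR_gt0.
have VE : V g `^ t = w / v.
  rewrite /w /v powRN invrK -powRD; last by rewrite (gt_eqF (V0 g)) implybT.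
  by rewrite -mulrDl addrC.
apply: (@le_trans _ _ (w^-1%:E * ((v * (`|C| * (2 * V g `^ t * N)))%:E * N^-1%:E))%E).
  apply: lee_wpmul2l; first by rewrite lee_fin invr_ge0 ltW.
  by apply: lee_wpmul2r => //; rewrite lee_fin invr_ge0 ltW.
rewrite -!EFinM lee_fin VE le_eqVlt; apply/orP; left; apply/eqP.
by field; rewrite !gt_eqF.
Qed.

End oscillation_of_bounded.

(** * From oscillation to Lipschitz regularity *)

Section campanato.
Context (p : nat) (R : realType) (K : padicField p R) (n : nat).
Local Notation X := (padic_space K n).
Context (mu : {measure set X -> \bar R}).
Hypotheses (pp : prime p) (n1 : (1 <= n)%N) (haar : normalized_haar mu).
Local Notation V := (ball_volume p R n).
Context (beta E : R) (b : X -> R) (m : int -> X -> R).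
Hypotheses (beta0 : 0 < beta) (E0 : 0 <= E) (mb : measurable_fun [set: X] b)
  (m_ball : forall g x y, padic_ball g x y -> m g y = m g x)
  (m_ge0 : forall g x, 0 <= m g x)
  (m_osc : forall g x,
    (ball_mean mu (fun y => b y - m g x)%R g x <= (E * (p%:R ^ g) `^ beta)%:E)%E).

Let p0 : 0 < p%:R :> R. Proof. by rewrite ltr0n prime_gt0. Qed.
Let p1 : 1 < p%:R :> R. Proof. by rewrite ltr1n prime_gt1. Qed.
Let V0 g : 0 < V g. Proof. exact: ball_volume_gt0. Qed.

Let d (g : int) : R := (p%:R ^ g) `^ beta.
Let theta : R := p%:R `^ (- beta).
Let C1 : R := E + p%:R ^+ n * E.
Let C2 : R := C1 / (1 - theta).

Let d0 g : 0 < d g. Proof. by rewrite powR_gt0// exprz_gt0. Qed.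

Let theta_lt1 : theta < 1.
Proof. by rewrite /theta powRN invf_lt1 ?powR_gt0// powR_gt1. Qed.

Let theta_gt0 : 0 < theta. Proof. by rewrite powR_gt0. Qed.

Let d_pred g : d (g - 1) = theta * d g.
Proof.
rewrite /d /theta expfzDr ?gt_eqF// exprN1 powRM ?exprz_ge0 ?invr_ge0 ?(ltW p0)//.
by rewrite -powR_inv1 ?(ltW p0)// -[X in _ * X]powRrM mulN1r mulrC.
Qed.

Let C10 : 0 <= C1. Proof. by rewrite addr_ge0// mulr_ge0// exprn_ge0// ltW. Qed.

Let C20 : 0 <= C2. Proof. by rewrite divr_ge0// subr_ge0 ltW. Qed.

Let d_small e : 0 < e -> exists2 g : int, g <= 0 & d g < e.
Proof.
move=> e0; have e'0 : 0 < e `^ beta^-1 by rewrite powR_gt0.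
have [g g0 ge] := exists_small_radius pp e'0; exists g => //.
have -> : e = (e `^ beta^-1) `^ beta.
  by rewrite -powRrM mulVf ?gt_eqF// powRr1// ltW.
apply: gt0_ltr_powR => //; rewrite nnegrE ?powR_ge0//.
by rewrite exprz_ge0// ltW.
Qed.

Let mbm g x : measurable_fun [set: X] (fun y => b y - m g x).
Proof. exact: measurable_funB. Qed.

Let V_pred g : V g = p%:R ^+ n * V (g - 1).
Proof.
rewrite /ball_volume -powR_mulrn ?(ltW p0)// -powRD; last by rewrite (gt_eqF p0) implybT.
by congr (_ `^ _); rewrite intrB mulrBr mulr1 addrC subrK.
Qed.

Let ball_mean_pred (u : X -> R) g x : measurable_fun [set: X] u ->
  (ball_mean mu u (g - 1) x <= (p%:R ^+ n)%:E * ball_mean mu u g x)%E.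
Proof.
move=> mu_; rewrite /ball_mean (V_pred g) muleA -EFinM invfM mulrA mulfV ?mul1r; last first.
  by rewrite gt_eqF// exprn_gt0.
rewrite lee_pmul2l ?lte_fin ?invr_gt0//; apply: ge0_subset_integral => //.
- exact: measurable_padic_ball.
- exact: measurable_padic_ball.
- exact: measurable_norm_EFin.
- by apply: subset_padic_ball => //; lia.
Qed.

Let m_pred g x : `|m (g - 1) x - m g x| <= C1 * d g.
Proof.
rewrite -lee_fin -(ball_mean_cst pp haar (g - 1) x (normr_ge0 (m (g - 1) x - m g x))).
pose u h y := `|b y - m h x|.
have mu_ h : measurable_fun [set: X] (u h) by apply: measurableT_comp.
have u0 h y : 0 <= u h y by exact: normr_ge0.
apply: (@le_trans _ _ (ball_mean mu (u (g - 1) \+ u g) (g - 1) x)).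
  apply: le_ball_mean => //; first exact: measurable_funD.
  apply: aeW => y _; rewrite normr_id [leRHS]ger0_norm ?addr_ge0//= /u.
  have -> : m (g - 1) x - m g x = - (b y - m (g - 1) x) + (b y - m g x) by ring.
  by rewrite (le_trans (ler_normD _ _))// normrN.
rewrite ball_meanD// /C1 mulrDl EFinD; apply: leeD.
  rewrite /u ball_mean_norm; apply: le_trans (m_osc _ _) _.
  by rewrite lee_fin ler_wpM2l// -/(d (g - 1)) -/(d g) d_pred ler_piMl ?ltW.
apply: le_trans (ball_mean_pred _ _ _) _ => //.
rewrite -mulrA EFinM lee_pmul2l ?lte_fin ?exprn_gt0// /u ball_mean_norm.
exact: m_osc.
Qed.

Let m_telescope g x (k : nat) :
  `|m (g - k%:Z) x - m g x| <= C2 * (d g - d (g - k%:Z)).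
Proof.
elim: k => [|k ih]; first by rewrite subr0 !subrr normr0 mulr0.
have -> : g - k.+1%:Z = (g - k%:Z) - 1 by lia.
set h := g - k%:Z in ih *.
have -> : m (h - 1) x - m g x = (m (h - 1) x - m h x) + (m h x - m g x) by ring.
apply: le_trans (ler_normD _ _) _; apply: le_trans (lerD (m_pred h x) ih) _.
rewrite le_eqVlt; apply/orP; left; apply/eqP; rewrite d_pred /C2.
by field; rewrite subr_eq0 gt_eqF.
Qed.

Let m_close g h x : m g x - C2 * d g <= m h x + C2 * d h.
Proof.
have H g' h' : g' <= h' -> `|m g' x - m h' x| <= C2 * d h'.
  move=> gh; have := m_telescope h' x `|h' - g'|%N.
  have -> : h' - `|h' - g'|%N%:Z = g' by lia.
  move=> /le_trans; apply; rewrite ler_wpM2l// gerBl ltW//.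
have Cg := mulr_ge0 C20 (ltW (d0 g)); have Ch := mulr_ge0 C20 (ltW (d0 h)).
by case: (leP g h) => [/H|/ltW/H]; rewrite ler_norml => /andP[]; lra.
Qed.

Let F x := sup [set m g x - C2 * d g | g in [set: int]].

Let F_close g x : `|F x - m g x| <= C2 * d g.
Proof.
have ub h : ubound [set m g' x - C2 * d g' | g' in [set: int]] (m h x + C2 * d h).
  by move=> _ [g' _ <-]; exact: m_close.
have ne : [set m g' x - C2 * d g' | g' in [set: int]] !=set0.
  by exists (m 0 x - C2 * d 0); exists 0.
have F1 : m g x - C2 * d g <= F x.
  by apply: sup_ubound; [exists (m 0 x + C2 * d 0); exact: ub|exists g].
have F2 : F x <= m g x + C2 * d g by apply: ge_sup => //; exact: ub.
by rewrite ler_norml; apply/andP; split; lra.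
Qed.

Let F_ball g x y : padic_ball g x y -> `|F x - F y| <= 2 * C2 * d g.
Proof.
move=> xy; have := F_close g x; have := F_close g y; rewrite (m_ball xy).
by rewrite !ler_norml => /andP[? ?] /andP[? ?]; apply/andP; split; lra.
Qed.

Let F_ge0 x : 0 <= F x.
Proof.
rewrite leNgt; apply/negP => Fx0.
have C21 : 0 < C2 + 1 by rewrite ltr_wpDl.
have e0 : 0 < - F x / (C2 + 1) by rewrite divr_gt0// oppr_gt0.
have [g _] := d_small e0; rewrite ltr_pdivlMr// mulrDr mulr1 => dg.
have := F_close g x; rewrite ler_norml => /andP[+ _].
by have := m_ge0 g x; have := d0 g; lra.
Qed.

Let measurable_F : measurable_fun [set: X] F.
Proof.
apply/measurable_EFinP; apply: measurable_superlevel => t.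
apply: (padic_saturated_measurable pp) => x /=; rewrite lte_fin => tF.
have C21 : 0 < 2 * C2 + 1 by rewrite ltr_wpDl// mulr_ge0.
have e0 : 0 < (F x - t) / (2 * C2 + 1) by rewrite divr_gt0// subr_gt0.
have [g _] := d_small e0; rewrite ltr_pdivlMr// mulrDr mulr1 => dg.
exists g => y /F_ball; rewrite /= lte_fin ler_norml => /andP[_].
by have := d0 g; lra.
Qed.

Let F_lipschitz : (lipschitz_seminorm beta F < +oo)%E.
Proof.
have C22 : 0 <= 2 * C2 by exact: mulr_ge0.
have K0 : 0 <= 2 * C2 * p%:R `^ beta by exact: mulr_ge0 (powR_ge0 _ _).
apply/lipschitz_seminorm_lty; exists (2 * C2 * p%:R `^ beta + 1).
  by rewrite ltr_wpDl.
move=> x y; have [->|xy] := eqVneq x y.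
  by rewrite subrr normr0 mulr_ge0 ?powR_ge0// addr_ge0.
have xy0 : 0 < padic_norm (x - y).
  rewrite lt_neqAle padic_norm_ge0 andbT eq_sym; apply/eqP.
  by move=> /padic_norm0_eq0/eqP; rewrite subr_eq0 (negbTE xy).
have [g /andP[gxy xyg]] := exists_radius_between pp xy0.
have /F_ball : padic_ball g x y by apply: padic_ball_sym.
move=> /le_trans; apply; rewrite [leRHS]mulrDl mul1r.
rewrite -[leLHS]addr0 lerD ?powR_ge0// -[leRHS]mulrA ler_wpM2l//.
have -> : d g = p%:R `^ beta * d (g - 1).
  by rewrite d_pred /theta powRN mulVKf// gt_eqF// powR_gt0.
rewrite ler_wpM2l ?powR_ge0//; apply: ge0_ler_powR.
- exact: ltW.
- by rewrite nnegrE exprz_ge0// ltW.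
- by rewrite nnegrE padic_norm_ge0.
- exact: ltW.
Qed.

Let ball_mean_bF g x :
  (ball_mean mu (fun y => b y - F y)%R g x <= ((E + C2) * d g)%:E)%E.
Proof.
have m1 : measurable_fun [set: X] (fun y => `|b y - m g x|) by exact: measurableT_comp.
have n0 (y : X) : 0 <= `|b y - m g x| by exact: normr_ge0.
have c0 (y : X) : 0 <= cst (C2 * d g) y by rewrite /= mulr_ge0// ltW.
apply: (@le_trans _ _ (ball_mean mu ((fun y => `|b y - m g x|) \+ cst (C2 * d g)) g x)).
  apply: le_ball_mean => //; [exact: measurable_funB|exact: measurable_funD|].
  apply: aeW => y xy; rewrite [leRHS]ger0_norm ?addr_ge0// /=.
  have -> : b y - F y = (b y - m g x) + (m g x - F y) by ring.
  rewrite (le_trans (ler_normD _ _))// lerD2l distrC -(m_ball xy).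
  exact: F_close.
rewrite ball_meanD// ball_mean_norm (ball_mean_cst pp haar _ _ (c0 x)).
by rewrite mulrDl EFinD; apply: leeD.
Qed.

Let ae_b_F : {ae mu, forall x, b x = F x}.
Proof.
have [c cP] := padic_centers K n pp.
have mbF : measurable_fun [set: X] (fun y => b y - F y) by exact: measurable_funB.
have EC0 : 0 <= E + C2 by exact: addr_ge0.
have ball0 a : {ae mu, forall x, padic_ball 0 a x -> b x = F x}.
  have mB := measurable_padic_ball 0 a.
  suff I0 : (\int[mu]_(y in padic_ball 0 a) `|(b y - F y)%:E| = 0)%E.
    have /ae_eq_integral_abs : measurable_fun (padic_ball 0 a) (fun y => (b y - F y)%:E).
      by apply/measurable_EFinP; exact: measurable_funTS.
    move=> /(_ mu mB)[/(_ I0) + _]; apply: filterS => y + ay => /(_ ay) [].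
    by move/eqP; rewrite subr_eq0 => /eqP.
  apply/eqP; rewrite eq_le; apply/andP; split; last first.
    by apply: integral_ge0 => y _; rewrite lee_fin.
  have int_le g : g <= 0 ->
      (\int[mu]_(y in padic_ball 0 a) `|(b y - F y)%:E| <= ((E + C2) * d g)%:E)%E.
    move=> g0.
    apply: (@le_trans _ _ (\int[mu]_(y in padic_ball 0 a) cst ((E + C2) * d g)%:E y)%E).
      apply: (le_integral_padic_balls (g := g) pp) => //.
      - move=> x ax y xy; apply: padic_ball_trans ax _.
        exact: subset_padic_ball xy.
      - exact: measurable_norm_EFin.
      - by move=> y; rewrite lee_fin mulr_ge0// ltW.
      - move=> x _; rewrite integral_cst; last exact: measurable_padic_ball.
        rewrite measure_ball_volume// muleC -lee_pdivrMl//.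
        exact: ball_mean_bF.
    rewrite integral_cst// measure_ball_volume// /ball_volume mulr0 powRr0.
    by rewrite mule1.
  apply/lee_addgt0Pr => e e0; rewrite add0e.
  have EC1 : 0 < E + C2 + 1 by rewrite ltr_wpDl.
  have e'0 : 0 < e / (E + C2 + 1) by rewrite divr_gt0.
  have [g g0] := d_small e'0; rewrite ltr_pdivlMr// mulrDr mulr1 => dg.
  apply: le_trans (int_le g g0) _; rewrite lee_fin.
  by have := d0 g; lra.
have : {ae mu, forall x, forall i, padic_ball 0 (c i) x -> b x = F x}.
  by apply/ae_foralln => i; exact: ball0.
by apply: filterS => x xP; have [i ix] := cP 0 x; exact: xP ix.
Qed.

(** Campanato's characterization: the values m g x converge at a geometric rate as
    the radius shrinks, and the limit is the Lipschitz representative. It is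
    written as a supremum of lower bounds, and it equals b almost everywhere
    because the integral of their difference over a unit ball is the sum of its
    integrals over the balls of radius p ^ g, which are small as g decreases. *)
Lemma campanato_lipschitz :
  lipschitz_space mu beta b /\ {ae mu, forall x, 0 <= b x}.
Proof.
split; first by exists F; split.
by apply: filterS ae_b_F => x ->.
Qed.

End campanato.

Section lipschitz_of_oscillation.
Context (p : nat) (R : realType) (K : padicField p R) (n : nat).
Local Notation X := (padic_space K n).
Context (mu : {measure set X -> \bar R}) (alpha beta : R).
Hypotheses (pp : prime p) (n1 : (1 <= n)%N) (haar : normalized_haar mu)
  (beta0 : 0 < beta) (alpha0 : 0 < alpha) (abn : alpha + beta < n%:R).
Local Notation V := (ball_volume p R n).

Let n0 : 0 < n%:R :> R. Proof. by rewrite ltr0n. Qed.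
Let V0 g : 0 < V g. Proof. exact: ball_volume_gt0. Qed.

(** Everywhere on a ball the maximal function of h is at least the mean of |h| over the
    ball, so this is the boundedness of the maximal function. *)
Lemma ball_mean_var_Lnorm (q : X -> R) : log_holder_exponent mu q ->
  exists2 C : R, 0 < C & forall (h : X -> R) g x, measurable_fun [set: X] h ->
    (ball_mean mu h g x * var_Lnorm mu q (fun y => (\1_(padic_ball g x) y)%:E)
      <= C%:E * var_Lnorm mu q (EFin \o h))%E.
Proof.
move=> hq; have [qm [qM [_ _ qm1 qb]]] := var_exponent_bounds (proj1 hq).
have mq : measurable_fun [set: X] q by case: hq => -[].
have q1 x : 1 <= q x by case/andP: (qb x) => + _; apply: le_trans; exact: ltW.
have q0 x : 0 < q x by rewrite (lt_le_trans _ (q1 x)).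
have qM1 : qM * (0 / n%:R) < 1 by rewrite mul0r mulr0.
have qq x : (q x)^-1 = (q x)^-1 - 0 / n%:R by rewrite mul0r subr0.
have [C C1 CP] := frac_maximal_modular pp n1 haar (lexx 0) hq qm1 qb qM1 mq qq.
have C0 : 0 < C by rewrite (lt_le_trans _ C1).
exists C; first exact: C0.
move=> h g x mh; pose N := var_Lnorm mu q (fun y => (\1_(padic_ball g x) y)%:E); rewrite -/N.
have N0 : (0 <= N)%E by exact: var_Lnorm_ge0.
rewrite -lee_pdivrMl; last exact: C0.
apply: var_Lnorm_ge => eta eta0.
rewrite (var_modular_EFin _ _ _ eta0) => hr; rewrite lee_pdivrMl ?C0// -EFinM.
pose u y := eta^-1 * h y.
have mu_ : measurable_fun [set: X] u by exact: measurable_funM.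
have hE : ball_mean mu h g x = (eta%:E * ball_mean mu u g x)%E.
  rewrite -[X in (X%:E * _)%E](ger0_norm (ltW eta0)) -ball_meanZ//.
  by congr ball_mean; apply/funext => y; rewrite /u mulrA mulfV ?mul1r// gt_eqF.
rewrite hE -muleA mulrC EFinM lee_pmul2l//.
have mB := measurable_padic_ball g x.
set a := ball_mean mu u g x; have a0 : (0 <= a)%E by exact: ball_mean_ge0.
have mpow (c : \bar R) : (0 <= c)%E ->
    measurable_fun (padic_ball g x) (fun y => c `^ q y)%E.
  by move=> c0; apply: measurable_funTS; exact: (measurable_poweR_fun (F := cst c)).
have mMq : measurable_fun [set: X] (fun y => frac_maximal mu 0 u y `^ q y)%E.
  apply: measurable_poweR_fun => //; first by move=> y; exact: frac_maximal_ge0.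
  exact: measurable_frac_maximal.
have aC : (\int[mu]_(y in padic_ball g x) a `^ q y <= C%:E)%E.
  apply: le_trans (CP u mu_ hr).
  apply: (@le_trans _ _ (\int[mu]_(y in padic_ball g x) frac_maximal mu 0 u y `^ q y)%E).
    apply: ge0_le_integral => //.
    - by move=> y _; exact: poweR_ge0.
    - exact: mpow.
    - exact: measurable_funTS.
    move=> y xy; apply: ge0_le_poweR => //; first exact: ltW.
    by rewrite /a -(ball_mean_eq mu u xy); exact: ball_mean_le_maximal.
  by apply: ge0_subset_integral => // y _; exact: poweR_ge0.
move: a0 aC; case: a => [a| |] // a0 aC; last first.
  exfalso; move: aC; rewrite (eq_integral (cst +oo%E)); last first.
    by move=> y _; rewrite poweRyr// gt_eqF.
  by rewrite integral_cst// measure_ball_volume// gt0_mulye ?lte_fin// leNgt ltry.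
rewrite lee_fin le_eqVlt in a0; case/predU1P: a0 => [<-|a0].
  by rewrite mul0e lee_fin ltW.
rewrite muleC -lee_pdivlMr// -EFinM; apply: var_Lnorm_le; first exact: divr_gt0.
rewrite var_modular_indic; [|exact: q0|exact: divr_gt0].
apply: (@le_trans _ _ (\int[mu]_(y in padic_ball g x) (C^-1%:E * a%:E `^ q y))%E).
  apply: ge0_le_integral => //.
  - by move=> y _; rewrite lee_fin powR_ge0.
  - under eq_fun do rewrite -poweR_EFin.
    by apply: mpow; rewrite lee_fin invr_ge0 divr_ge0// ltW.
  - by apply: measurable_funeM; apply: mpow; rewrite lee_fin ltW.
  move=> y _; rewrite -poweR_EFin invf_div mulrC EFinM.
  by apply: poweR_divl_le => //; rewrite lee_fin ltW.
rewrite ge0_integralZl_EFin ?invr_ge0 ?(ltW C0)//; last 2 first.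
- by move=> y _; exact: poweR_ge0.
- by apply: mpow; rewrite lee_fin ltW.
by rewrite lee_pdivrMl// mule1.
Qed.

Lemma var_Lnorm_mono (q : X -> R) (F G : X -> \bar R) : (forall y, 0 < q y) ->
  measurable_fun [set: X] q ->
  measurable_fun [set: X] F -> measurable_fun [set: X] G ->
  (forall y, `|F y| <= `|G y|)%E -> (var_Lnorm mu q F <= var_Lnorm mu q G)%E.
Proof.
move=> q0 mq mF mG FG; rewrite -[leRHS]mul1e.
apply: var_Lnorm_le_scale => // eta eta0; rewrite mul1r; apply: le_trans.
apply: ge0_le_integral => //.
- by move=> y _; exact: poweR_ge0.
- exact: measurable_modular.
- exact: measurable_modular.
move=> y _; apply: ge0_le_poweR; first exact: ltW.
  by rewrite mule_ge0// inve_ge0 lee_fin ltW.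
by apply: lee_wpmul2r; rewrite // inve_ge0 lee_fin ltW.
Qed.

(** Since the oscillation dominates avg |b| - b on each ball, every function below it
    has a small mean: constants give local integrability, and the positive part
    of avg |b| - b gives the Campanato condition around avg |b|, because
    |b - m| + m <= 2 max(m - b, 0) + |b| for m = avg |b|. *)
Lemma lipschitz_of_oscillation (b q : X -> R) : measurable_fun [set: X] b ->
  log_holder_exponent mu q -> (maximal_oscillation mu alpha beta q b < +oo)%E ->
  lipschitz_space mu beta b /\ {ae mu, forall x, 0 <= b x}.
Proof.
move=> mb hq osc.
have [C C0 meanC] := ball_mean_var_Lnorm hq.
have [qm [qM [_ _ qm1 qb]]] := var_exponent_bounds (proj1 hq).
have mq : measurable_fun [set: X] q by case: hq => -[].
have q1 x : 1 <= q x by case/andP: (qb x) => + _; apply: le_trans; exact: ltW.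
have q0 x : 0 < q x by rewrite (lt_le_trans _ (q1 x)).
pose G g x y := (((b y)%:E - mu (padic_ball g x) `^ (- (alpha / n%:R))
    * frac_maximal_in mu (padic_ball g x) alpha b y) * (\1_(padic_ball g x) y)%:E)%E.
have [S S0 GS] : exists2 S : R, 0 <= S & forall g x (N : R), 0 < N ->
    var_Lnorm mu q (fun y => (\1_(padic_ball g x) y)%:E) = N%:E ->
    (var_Lnorm mu q (G g x) <= (S * (p%:R ^ g) `^ beta * N)%:E)%E.
  pose S := Num.max 0 (fine (maximal_oscillation mu alpha beta q b)).
  exists S; first by rewrite le_max lexx.
  move=> g x N N0 NE.
  have oscS : (maximal_oscillation mu alpha beta q b <= S%:E)%E.
    move: osc; rewrite /S; case: (maximal_oscillation _ _ _ _ _) => [s _|//|_].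
      by rewrite lee_fin le_max lexx orbT.
    by rewrite leNye.
  have := le_trans (ereal_sup_ubound _) oscS.
  move=> /(_ _ (ex_intro2 _ _ (g, x) Logic.I erefl)) /=; rewrite NE -/(G g x).
  rewrite measure_ball_volume// poweR_EFin (ball_volume_powR pp n1).
  have d0 : 0 < (p%:R ^ g) `^ beta :> R.
    by rewrite powR_gt0// exprz_gt0// ltr0n prime_gt0.
  rewrite inver gt_eqF// mul1e inver gt_eqF// lee_pdivrMl// lee_pdivrMr//.
  by rewrite -!EFinM [(_ * S)%R]mulrC.
pose E := C * S; have E0 : 0 <= E by rewrite mulr_ge0// ltW.
have mi g x : measurable_fun [set: X] (\1_(padic_ball g x) : X -> R).
  by apply: measurable_indic; exact: measurable_padic_ball.
have mG g x : measurable_fun [set: X] (G g x).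
  rewrite (_ : G g x = fun y => ((V g `^ (- (alpha / n%:R)))%:E *
      commutator mu b alpha (\1_(padic_ball g x)) y * (\1_(padic_ball g x) y)%:E)%E).
    apply: emeasurable_funM; last exact/measurable_EFinP.
    by apply: measurable_funeM; exact: measurable_commutator.
  apply/funext => y.
  exact: (commutator_indic pp n1 haar beta0 alpha0 abn g x y mb).
have mean_below g x (h : X -> R) : measurable_fun [set: X] h ->
    (forall y, `|h y|%:E <= `|G g x y|)%E ->
    (ball_mean mu h g x <= (E * (p%:R ^ g) `^ beta)%:E)%E.
  move=> mh hG; have [N N0 NE] := var_Lnorm_indic pp haar g x mq q1.
  have := meanC h g x mh; rewrite NE => H.
  rewrite -(lee_pmul2r (x := N%:E))//; apply: le_trans H _.
  rewrite /E -!EFinM -!mulrA EFinM lee_pmul2l// mulrA.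
  apply: le_trans (GS g x N N0 NE); apply: var_Lnorm_mono => //.
  exact/measurable_EFinP.
have Mge g x y : padic_ball g x y -> (ball_mean mu b g x <=
    mu (padic_ball g x) `^ (- (alpha / n%:R)) * frac_maximal_in mu (padic_ball g x) alpha b y)%E.
  move=> xy; have gB : padic_ball g y `<=` padic_ball g x by rewrite (padic_ball_eq xy).
  have Va : 0 < V g `^ (alpha / n%:R) := powR_gt0 _ (V0 g).
  rewrite measure_ball_volume// poweR_EFin powRN lee_pdivlMl//.
  by have := frac_maximal_in_ge pp haar alpha b gB; rewrite (ball_mean_eq mu b xy).
have bfin g x : ball_mean mu b g x \is a fin_num.
  rewrite ge0_fin_numE ?ball_mean_ge0// ltey; apply/eqP => boo.
  pose M := E * (p%:R ^ g) `^ beta + 1.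
  have := mean_below g x (fun y => M * \1_(padic_ball g x) y) _ _.
  have M0 : 0 <= M by rewrite addr_ge0// mulr_ge0 ?powR_ge0.
  have -> : ball_mean mu (fun y => M * \1_(padic_ball g x) y)%R g x = M%:E.
    rewrite -[RHS](ball_mean_cst pp haar g x M0) /ball_mean; congr (_ * _)%E.
    by apply: eq_integral => y yB; rewrite /= indicE yB mulr1.
  have H : ~ (M%:E <= (E * (p%:R ^ g) `^ beta)%:E)%E.
    by rewrite lee_fin /M; apply/negP; rewrite -ltNge ltrDl.
  move=> K'; apply: H; apply: K'; first exact: measurable_funM.
  move=> y; rewrite /G indicE; have [yB|yB] := boolP (y \in padic_ball g x); last first.
    by rewrite mulr0 normr0 mule0 abse0.
  have := Mge g x y; rewrite boo leye_eq; rewrite inE in yB => /(_ yB)/eqP ->.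
  by rewrite mule1 /= leey.
pose m g x := fine (ball_mean mu b g x).
have m0 g x : 0 <= m g x by rewrite fine_ge0// ball_mean_ge0.
have E20 : 0 <= 2 * E by rewrite mulr_ge0.
have m_ball g x y : padic_ball g x y -> m g y = m g x.
  by move=> xy; rewrite /m (ball_mean_eq mu b xy).
apply: (campanato_lipschitz pp n1 haar beta0 E20 mb m_ball m0).
move=> g x; pose h y := Num.max (m g x - b y) 0 * \1_(padic_ball g x) y.
have mh : measurable_fun [set: X] h.
  apply: measurable_funM => //.
  by apply: measurable_maxr => //; exact: measurable_funB.
have h0 y : 0 <= h y by rewrite mulr_ge0// le_max lexx orbT.
have hmean : (ball_mean mu h g x <= (E * (p%:R ^ g) `^ beta)%:E)%E.
  apply: mean_below => // y; rewrite ger0_norm// /h /G indicE.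
  have [yB|yB] := boolP (y \in padic_ball g x); last first.
    by rewrite mulr0 mule0 abse0.
  rewrite mulr1 mule1; rewrite inE in yB; have := Mge g x y yB.
  rewrite -(fineK (bfin g x)) -/(m g x).
  case: (_ * _)%E => [w| |] //=; rewrite ?leey// !lee_fin => mw.
  rewrite ge_max normr_ge0 andbT distrC (le_trans _ (ler_norm _))//.
  by rewrite lerD2r.
pose u y := `|b y - m g x|; pose v y := 2 * h y.
have mu_ : measurable_fun [set: X] u.
  by apply: measurableT_comp => //; exact: measurable_funB.
have mv : measurable_fun [set: X] v by exact: measurable_funM.
have mnb : measurable_fun [set: X] (fun y => `|b y|) by exact: measurableT_comp.
have u0 y : 0 <= u y by exact: normr_ge0.
have v0 y : 0 <= v y by exact: mulr_ge0.
have nb0 y : 0 <= `|b y| by exact: normr_ge0.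
have c0 (y : X) : 0 <= cst (m g x) y by exact: m0.
have key : (ball_mean mu (u \+ cst (m g x))%R g x <=
    ball_mean mu (v \+ (fun y => `|b y|))%R g x)%E.
  apply: le_ball_mean => //; [exact: measurable_funD|exact: measurable_funD|].
  apply: aeW => y yB; rewrite !ger0_norm ?addr_ge0//= /u /v /h indicE mem_set//.
  rewrite mulr1; have b1 := ler_norm (b y); have b2 := normr_ge0 (b y).
  case: (leP (m g x - b y) 0) => mby.
    by rewrite ger0_norm; lra.
  by rewrite ltr0_norm; lra.
rewrite !ball_meanD// ball_mean_cst// ball_mean_norm// in key.
rewrite -(fineK (bfin g x)) -/(m g x) leeD2rE// in key.
rewrite -[leLHS]ball_mean_norm -/u (le_trans key)//.
rewrite ball_meanZ// ger0_norm// -mulrA EFinM lee_pmul2l//.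
Qed.

Lemma exists_exponent_pair : exists r q : X -> R, exponent_pair mu alpha beta r q.
Proof.
have ab0 : 0 < alpha + beta by exact: addr_gt0.
pose t := (alpha + beta) / n%:R.
have t0 : 0 < t by rewrite divr_gt0.
have t1 : t < 1 by rewrite ltr_pdivrMr// mul1r.
pose r := (1 + t^-1) / 2; pose q := (r^-1 - t)^-1.
have tV1 : 1 < t^-1 by rewrite invf_gt1.
have r1 : 1 < r by rewrite /r; lra.
have rt : r < t^-1 by rewrite /r; lra.
have rV : 0 < r^-1 - t.
  by rewrite subr_gt0 -[ltLHS]invrK ltf_pV2 ?posrE ?invr_gt0// (lt_trans _ r1).
have q1 : 1 < q.
  rewrite invf_gt1// ltrBlDr (@lt_trans _ _ 1)// ?ltrDl//.
  by rewrite invf_lt1// (lt_trans _ r1).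
have muT : (0 < mu [set: X])%E.
  apply: (@lt_le_trans _ _ (mu (padic_ball 0 0))).
    by rewrite measure_ball_volume// lte_fin.
  by apply: le_measure; rewrite ?inE//; exact: measurable_padic_ball.
have vcst c : 1 < c -> var_exponent mu (cst c : X -> R).
  move=> c1; have iE := ess_inf_cstr c muT; have sE := ess_sup_cstr c muT.
  by split => //; rewrite ?iE ?sE ?lte_fin ?ltry// => x; rewrite lexx.
have hcst c : 1 < c -> log_holder_exponent mu (cst c : X -> R).
  move=> c1; split; first exact: vcst.
  exists 1 => //; split => [g x|x y].
    have mBT : (0 < mrestr mu (measurable_padic_ball g x) [set: X])%E.
      by rewrite /mrestr setTI measure_ball_volume// lte_fin.
    rewrite /ball_ess_inf /ball_ess_sup.
    have -> := ess_inf_cstr c mBT; have -> := ess_sup_cstr c mBT.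
    by rewrite subee// mule0 lee_fin.
  rewrite subrr normr0 divr_ge0// divr_ge0// ln_ge0//.
    by rewrite (@le_trans _ _ p%:R) ?ler1n ?prime_gt0// lerDl le_min !padic_norm_ge0.
  by rewrite ler1n prime_gt0.
exists (cst r), (cst q); split => //; [exact: hcst|exact: hcst|exact: vcst| |].
  by have -> := ess_sup_cstr r muT; rewrite lte_fin -invf_div.
by move=> x /=; rewrite /q invrK.
Qed.

End lipschitz_of_oscillation.

(** * The five assertions *)

Theorem theorem1p1 (p : nat) (R : realType) (K : padicField p R) (n : nat)
    (mu : {measure set (padic_space K n) -> \bar R})
    (alpha beta : R) (b : padic_space K n -> R) :
  prime p -> (1 <= n)%N -> normalized_haar mu ->
  0 < beta < 1 -> 0 < alpha -> alpha < alpha + beta < n%:R ->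
  padic_locally_integrable mu b ->
  [<-> lipschitz_space mu beta b /\ {ae mu, forall x, 0 <= b x};
       forall r q : padic_space K n -> R, exponent_pair mu alpha beta r q ->
         var_bounded mu r q (commutator mu b alpha);
       exists r q : padic_space K n -> R, exponent_pair mu alpha beta r q /\
         var_bounded mu r q (commutator mu b alpha);
       exists r q : padic_space K n -> R, exponent_pair mu alpha beta r q /\
         (maximal_oscillation mu alpha beta q b < +oo)%E;
       forall r q : padic_space K n -> R, exponent_pair mu alpha beta r q ->
         (maximal_oscillation mu alpha beta q b < +oo)%E].
Proof.
move=> pp n1 haar /andP[beta0 _] alpha0 /andP[_ abn] [mb _].
have bounded r q : lipschitz_space mu beta b /\ {ae mu, forall x, 0 <= b x} ->
    exponent_pair mu alpha beta r q -> var_bounded mu r q (commutator mu b alpha).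
  by move=> [lip b0]; exact: commutator_bounded.
have osc r q : exponent_pair mu alpha beta r q ->
    var_bounded mu r q (commutator mu b alpha) ->
    (maximal_oscillation mu alpha beta q b < +oo)%E.
  exact: maximal_oscillation_lty.
have lip r q : exponent_pair mu alpha beta r q ->
    (maximal_oscillation mu alpha beta q b < +oo)%E ->
    lipschitz_space mu beta b /\ {ae mu, forall x, 0 <= b x}.
  by move=> [_ hq _ _ _]; exact: (lipschitz_of_oscillation pp n1 haar beta0 alpha0 abn mb hq).
have [r0 [q0 rq0]] := exists_exponent_pair pp n1 haar beta0 alpha0 abn.
tfae.
- by move=> lipb r q rq; exact: bounded.
- by move=> bd; exists r0, q0; split => //; exact: bd.
- by move=> [r [q [rq bd]]]; exists r, q; split => //; exact: osc bd.
- move=> [r [q [rq oscq]]] r' q' rq'; apply: osc (rq') _.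
  by apply: bounded rq'; exact: lip rq oscq.
- by move=> oscall; exact: lip rq0 (oscall _ _ rq0).
Qed.
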